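(* Let $0\le q<1$ and $x>0$. The expansion at $q=1$ of the q-Pochhammer symbol $(a,q)_\infty=\prod_{n=0}^\infty(1-aq^n)$ with $a=q^x$ is $$(q^x,q)_\infty=\frac{\sqrt{2\pi}}{\Gamma(x)}\left(\log\frac1q\right)^{\frac12-x}\prod_{\substack{k=0\\k\neq1}}^\infty e^{\frac{\zeta(2-k)}{k!}B_k(x)(\log q)^{k-1}}.$$
   Context: $B_k(x)$ are the Bernoulli polynomials, defined by $\frac{te^{xt}}{e^t-1}=\sum_{n=0}^\infty\frac{B_n(x)}{n!}t^n$; $\zeta$ is the Riemann zeta function; $\Gamma$ is the gamma function.
   Formalization: The displayed equality is read as an asymptotic expansion as q → 1 from below: for each N, the product over k ≤ N (k ≠ 1) is correct up to a factor 1 + O((log q)^N); the literal infinite product diverges for general x, and for x = 1 equality fails by exponentially small terms. *)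

(* Defs.v *)
From Stdlib Require Import Reals Factorial.
From Coquelicot Require Import Coquelicot.
Local Open Scope R_scope.

(* (a, q)_oo, as the limit of the partial products. *)
Definition qPochhammer (a q : R) : R :=
  real (Lim_seq (fun n => prod_f_R0 (fun i => 1 - a * q ^ i) n)).

Definition Gamma (x : R) : R :=
  RInt_gen (fun t => Rpower t (x - 1) * exp (- t))
    (at_right 0) (Rbar_locally p_infty).

(* Generating function of the Bernoulli polynomials near t = 0.  The point
   t = 0 itself is left out because the quotient is 0 / 0 there. *)
Definition is_bernoulli_poly (B : nat -> R -> R) : Prop :=
  forall x : R,
    locally' 0 (fun t : R =>
      is_pseries (fun n => B n x / INR (fact n)) t
        (t * exp (x * t) / (exp t - 1))).

(* u ^ s for u > 0, with the real logarithm of u. *)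
Definition cpower (u : R) (s : C) : C :=
  (exp (Re s * ln u) * cos (Im s * ln u),
   exp (Re s * ln u) * sin (Im s * ln u)).

Definition analytic_at (f : C -> C) (z0 : C) : Prop :=
  exists a : nat -> C,
    locally z0 (fun z : C =>
      is_pseries (K := C_AbsRing) (V := C_NormedModule) a (z - z0)%C (f z)).

(* Analytic continuation to C \ {1} of the Dirichlet series; since C \ {1} is
   connected, this determines zeta everywhere except at the pole s = 1. *)
Definition is_riemann_zeta (zeta : C -> C) : Prop :=
  (forall s : C, 1 < Re s ->
     is_series (K := C_AbsRing) (V := C_NormedModule)
       (fun n => (/ cpower (INR (S n)) s)%C) (zeta s)) /\
  (forall s : C, s <> RtoC 1 -> analytic_at zeta s).

(* zeta (2 - k) / k! * B_k(x) * (log q)^(k-1).  The number zeta (2 - k) is real,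
   and Re only turns it from an element of C into one of R. *)
Definition expansion_term (zeta : C -> C) (B : nat -> R -> R) (x q : R)
    (k : nat) : R :=
  Re (zeta (RtoC (2 - INR k))) / INR (fact k) * B k x
    * powerRZ (ln q) (Z.of_nat k - 1).

(* The product over k <= N, k <> 1, of the exponentials of these terms. *)
Definition expansion_prod (zeta : C -> C) (B : nat -> R -> R) (x q : R)
    (N : nat) : R :=
  prod_f_R0
    (fun k => if Nat.eqb k 1 then 1 else exp (expansion_term zeta B x q k)) N.

(* The infinite product  f(q) = g(q) * prod_(k >= 0) p_k(q), where the partial
   product over k <= N is P q N, read as an asymptotic expansion for q -> 1-:
   truncating it after k = N leaves a factor 1 + O((log q)^N), the order of
   the first omitted exponent.  For zeta (2 - k) / k! * B_k(x) * (log q)^(k-1)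
   the infinite product itself diverges for general x. *)
Definition product_expansion_at_1 (f g : R -> R) (P : R -> nat -> R) : Prop :=
  forall N : nat, exists K : R,
    at_left 1 (fun q : R => exists r : R,
      Rabs r <= K * Rabs (ln q) ^ N /\ f q = g q * P q N * (1 + r)).

(* Main.v *)
Require Import Defs.
From Stdlib Require Import Reals Factorial Lra Lia Wf_nat IndefiniteDescription.
From Coquelicot Require Import Coquelicot.
Local Open Scope R_scope.

(** Write q = e^{-t}, so that t -> 0+ as q -> 1-.  Expanding the logarithms of
    the factors of (q^x, q)_oo and summing over the factors first gives
    - log (q^x, q)_oo = L(x,t) := sum_{m >= 1} e^{-xmt} / (m (1 - e^{-mt}))
    ([qPochhammer_lambert]).

    The expansion of L.  With u = mt the m-th term is t times a function of u
    which, by the generating function of the Bernoulli polynomials taken at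
    - u, equals 1/u^2 - B_1(x)/u + (power series in u) near 0.  Removing 1/u^2
    and - B_1(x) e^{-u}/u leaves a function G which is smooth on [0,oo[ and
    decays like 1/u^2 together with its derivatives.  The removed parts sum to
    zeta(2)/t and B_1(x) log (1 - e^{-t}), and Euler-Maclaurin summation gives
    sum_m t G(mt) = I(x) + sum_j zeta(-j) G^{(j)}(0)/j! t^{j+1}, up to any power
    of t ([euler_maclaurin], [kernel_rest_expansion]).  The cut-off e^{-u}
    contributes to G^{(j)}(0) exactly what turns log (1 - e^{-t}) into log t,
    because the same summation formula applied to e^{-u} expands
    log ((1 - e^{-t})/t) ([log_expansion]).  This is [lambert_expansion].

    The numbers zeta(-j).  Summing H((m-1)t) - H(mt) over m and expanding each
    term by Taylor's formula shows that the Euler-Maclaurin coefficients obey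
    a recursion which determines them.  Summing (N-1)^{1-s} - N^{1-s} over N and
    expanding by the binomial series gives the same recursion for zeta at
    shifted arguments: it holds for Re s > 1, it continues analytically along
    every horizontal line Im s = y with y <> 0, since such a line avoids the
    pole ([landau_identity]), and letting y -> 0 at s = 1 - e yields the
    recursion for zeta(0), zeta(-1), ... ([em_coef_recursion]).  On a horizontal
    line everything is a real-analytic function of one real variable, so only
    the one-variable identity theorem is needed.

    The constant I(x).  The elementary relations between L(x,t), L(x+1,t) and
    L(x+s,t) show that e^{I(x)-I(1)} satisfies the functional equation and the
    logarithmic convexity bound of Gamma, hence equals Gamma(x)
    ([gamma_like_unique], in the spirit of Bohr and Mollerup).  The duplication
    L(1/2,t) + L(1,t) = L(1,t/2) gives I(1/2), and Gamma(1/2)^2 = pi, which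
    Wallis' integrals yield, then gives e^{-I(1)} = sqrt (2 pi). *)

Local Notation RN := R_NormedModule.
Local Notation RCN := R_CompleteNormedModule.

(** * Real series and elementary estimates *)

Lemma exp_le_mono x y : x <= y -> exp x <= exp y.
Proof. intros [H| ->]; [left; now apply exp_increasing|lra]. Qed.

Lemma ball_R (x y eps : R) : ball (M := R_UniformSpace) x eps y -> Rabs (y - x) < eps.
Proof. intros H; exact H. Qed.

Lemma locally_pos u (P : R -> Prop) : 0 < u -> (forall y, 0 < y -> P y) -> locally u P.
Proof.
  intros Hu HP; exists (mkposreal u Hu). intros y Hy. apply HP.
  apply ball_R in Hy. simpl in Hy. apply Rabs_lt_between in Hy. lra.
Qed.

Lemma inv_INR_S_lim : is_lim_seq (fun n => / INR (S n)) 0.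
Proof.
  apply (is_lim_seq_inv (fun n => INR (S n)) p_infty); [|discriminate].
  apply (is_lim_seq_incr_1 INR), is_lim_seq_INR.
Qed.

Lemma le_of_scaled a b : (forall n, a <= (1 + / INR (S n)) * b) -> a <= b.
Proof.
  intros H.
  apply (is_lim_seq_le (fun _ => a) (fun n => (1 + / INR (S n)) * b) a b); auto.
  - apply is_lim_seq_const.
  - replace (Finite b) with (Finite ((1 + 0) * b)) by (f_equal; ring).
    apply (is_lim_seq_scal_r _ b (Finite (1 + 0))).
    apply is_lim_seq_plus'; [apply is_lim_seq_const|apply inv_INR_S_lim].
Qed.

Lemma le_of_small a b D t : 0 < t -> (forall s, 0 < s <= t -> a <= b + D * s) -> a <= b.
Proof.
  intros Ht H. apply Rnot_lt_le. intros Hlt.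
  assert (HD := Rabs_pos D).
  assert (Hp : 0 < (a - b) / (2 * (Rabs D + 1))) by (apply Rdiv_lt_0_compat; lra).
  set (s := Rmin t ((a - b) / (2 * (Rabs D + 1)))).
  assert (Hs : 0 < s <= t) by (unfold s; split; [now apply Rmin_pos|apply Rmin_l]).
  assert (Hs2 : s <= (a - b) / (2 * (Rabs D + 1))) by apply Rmin_r.
  specialize (H s Hs).
  assert (D * s <= Rabs D * s) by (apply Rmult_le_compat_r; [lra|apply Rle_abs]).
  assert ((Rabs D + 1) * s <= (a - b) / 2).
  { apply Rle_trans with ((Rabs D + 1) * ((a - b) / (2 * (Rabs D + 1)))).
    - apply Rmult_le_compat_l; lra.
    - right; field; lra. }
  lra.
Qed.

Lemma mean_value (f f' : R -> R) a b :
  a <= b -> (forall s, a <= s <= b -> is_derive f s (f' s)) ->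
  exists y, a <= y <= b /\ f b - f a = f' y * (b - a).
Proof.
  intros Hab Hd.
  destruct (MVT_gen f a b f') as [y [Hy E]].
  - intros y; rewrite Rmin_left, Rmax_right by lra; intros Hy; apply Hd; lra.
  - intros y; rewrite Rmin_left, Rmax_right by lra; intros Hy.
    apply continuity_pt_filterlim.
    apply (ex_derive_continuous (V := RN)). eexists; apply Hd; lra.
  - rewrite Rmin_left, Rmax_right in Hy by lra. now exists y.
Qed.

Lemma nonneg_derivative_le (f f' : R -> R) a b :
  a <= b -> (forall s, a <= s <= b -> is_derive f s (f' s)) ->
  (forall s, a <= s <= b -> 0 <= f' s) -> f a <= f b.
Proof.
  intros Hab Hd Hp. destruct (mean_value f f' a b Hab Hd) as [y [Hy E]].
  specialize (Hp y Hy). assert (0 <= f' y * (b - a)) by (apply Rmult_le_pos; lra). lra.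
Qed.

Lemma series_partial_le (a : nat -> R) (l : R) (n : nat) :
  (forall k, 0 <= a k) -> is_series a l -> sum_n a n <= l.
Proof.
  intros Ha Hl.
  apply (is_lim_seq_incr_compare (sum_n a) l Hl).
  intros k; rewrite sum_Sn; unfold plus; simpl; specialize (Ha (S k)); lra.
Qed.

Lemma series_term_le (a : nat -> R) (l : R) (n : nat) :
  (forall k, 0 <= a k) -> is_series a l -> a n <= l.
Proof.
  intros Ha Hl. eapply Rle_trans; [|apply (series_partial_le a l n Ha Hl)].
  destruct n; [rewrite sum_O; lra|].
  rewrite sum_Sn; unfold plus; simpl.
  assert (0 <= sum_n a n); [|lra].
  apply Rle_trans with (sum_n (fun _ => 0) n).
  - rewrite sum_n_const; lra.
  - now apply sum_n_m_le.
Qed.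

Lemma is_series_abs_le (a b : nat -> R) (la lb : R) :
  (forall n, Rabs (a n) <= b n) -> is_series a la -> is_series b lb ->
  Rabs la <= lb.
Proof.
  intros H Ha Hb.
  apply (is_lim_seq_le (fun n => Rabs (sum_n a n)) (sum_n b) (Rabs la) lb).
  - intros n.
    refine (Rle_trans _ _ _ (norm_sum_n_m a 0 n) _).
    apply sum_n_m_le; exact H.
  - apply (is_lim_seq_abs _ la); exact Ha.
  - exact Hb.
Qed.

Lemma ex_series_abs_le (a b : nat -> R) :
  (forall n, Rabs (a n) <= b n) -> ex_series b -> ex_series a.
Proof. intros H; apply (ex_series_le (V := RCN) a b H). Qed.

Lemma Series_abs_le (a b : nat -> R) :
  (forall n, Rabs (a n) <= b n) -> ex_series b -> Rabs (Series a) <= Series b.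
Proof.
  intros H Hb; apply (is_series_abs_le a b); auto; apply Series_correct; auto.
  now apply (ex_series_abs_le a b).
Qed.

Lemma is_series_eq (a : nat -> R) (l l' : R) : is_series a l -> l = l' -> is_series a l'.
Proof. now intros H <-. Qed.

Lemma is_series_finite1 (a : nat -> R) :
  (forall k, a (S k) = 0) -> is_series a (a 0%nat).
Proof.
  intros H. apply (is_lim_seq_ext (fun _ => a 0%nat) _ (Finite (a 0%nat))); [|apply is_lim_seq_const].
  intros n; induction n as [|n IH]; [now rewrite sum_O|].
  rewrite sum_Sn, <- IH, H; unfold plus; simpl; ring.
Qed.

Lemma is_series_finite2 (a : nat -> R) :
  (forall k, a (S (S k)) = 0) -> is_series a (a 0%nat + a 1%nat).
Proof.
  intros H. apply (is_series_decr_1 (V := RN)).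
  replace (plus _ _) with (a 1%nat) by (unfold plus, opp; simpl; ring).
  apply (is_series_finite1 (fun k => a (S k))); auto.
Qed.

Lemma is_series_exp y : is_series (fun n => y ^ n / INR (fact n)) (exp y).
Proof.
  eapply is_series_ext; [|exact (proj1 (is_pseries_R _ _ _) (is_exp_Reals y))].
  intros n; simpl; unfold Rdiv; ring.
Qed.

(** Dominated convergence for series: the tails are small uniformly in k, and the
    heads converge termwise. *)
Lemma tannery (u : nat -> nat -> R) (M l : nat -> R) :
  (forall k n, Rabs (u k n) <= M n) -> ex_series M ->
  (forall n, is_lim_seq (fun k => u k n) (l n)) ->
  is_lim_seq (fun k => Series (u k)) (Series l).
Proof.
  intros Hu HM Hl.
  assert (HlM : forall n, Rabs (l n) <= M n).
  { intros n; apply (is_lim_seq_le (fun k => Rabs (u k n)) (fun _ => M n) (Rabs (l n)) (M n)).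
    - intros k; apply Hu.
    - apply (is_lim_seq_abs _ (l n)); apply Hl.
    - apply is_lim_seq_const. }
  apply is_lim_seq_Reals; intros eps Heps.
  assert (HMl := Series_correct _ HM).
  destruct (proj1 (is_lim_seq_Reals _ _) HMl (eps / 4)) as [N HN]; [lra|].
  specialize (HN N (Nat.le_refl N)).
  assert (HT : forall v, (forall n, Rabs (v n) <= M n) ->
    Rabs (Series v - sum_n v N) <= eps / 4).
  { intros v Hv.
    rewrite (Series_incr_n v (S N)); [|lia|now apply (ex_series_abs_le v M)].
    simpl pred. rewrite <- sum_n_Reals.
    replace (_ + _ - _) with (Series (fun k => v (S N + k)%nat)) by ring.
    eapply Rle_trans.
    - apply (Series_abs_le _ (fun k => M (S N + k)%nat)); [intros; apply Hv|].
      now apply (ex_series_incr_n M (S N)).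
    - unfold Rdist in HN. rewrite (Series_incr_n M (S N)) in HN; [|lia|assumption].
      simpl pred in HN. rewrite <- sum_n_Reals in HN.
      apply Rabs_lt_between in HN.
      match goal with |- ?x <= _ => set (T := x) in * end.
      match type of HN with _ < ?x - (?y + _) < _ => change x with y in HN; set (A := y) in * end. lra. }
  assert (HF : is_lim_seq (fun k => sum_n (u k) N) (sum_n l N)).
  { clear HT HN. induction N as [|N IH].
    - rewrite sum_O. apply (is_lim_seq_ext (fun k => u k 0%nat)); [|apply Hl].
      intros k; now rewrite sum_O.
    - rewrite sum_Sn. apply (is_lim_seq_ext (fun k => sum_n (u k) N + u k (S N))).
      + intros k; now rewrite sum_Sn.
      + apply is_lim_seq_plus'; auto. }
  destruct (proj1 (is_lim_seq_Reals _ _) HF (eps / 4)) as [K HK]; [lra|].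
  exists K; intros k Hk. specialize (HK k Hk). unfold Rdist in *.
  assert (H1 := HT (u k) (Hu k)). assert (H2 := HT l HlM).
  apply Rabs_le_between in H1; apply Rabs_le_between in H2.
  apply Rabs_lt_between in HK. apply Rabs_lt_between. lra.
Qed.

Lemma Series_sum_n_exchange (u : nat -> nat -> R) (K : nat) :
  (forall k, ex_series (fun n => u n k)) ->
  Series (fun n => sum_n (u n) K) = sum_n (fun k => Series (fun n => u n k)) K
  /\ ex_series (fun n => sum_n (u n) K).
Proof.
  intros H; induction K as [|K [IH1 IH2]].
  - rewrite sum_O; split.
    + apply Series_ext; intros n; now rewrite sum_O.
    + apply (ex_series_ext (fun n => u n 0%nat)); auto; intros n; now rewrite sum_O.
  - assert (He : forall n, sum_n (u n) K + u n (S K) = sum_n (u n) (S K))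
      by (intros n; now rewrite sum_Sn).
    rewrite sum_Sn, <- IH1; split.
    + rewrite <- (Series_ext _ _ He). now apply Series_plus.
    + apply (ex_series_ext _ _ He). now apply (ex_series_plus (V := RN)).
Qed.

(** The partial sums over k of the rows are dominated by M, so Tannery's theorem
    exchanges the limit in k with the sum over n. *)
Lemma series_fubini (u : nat -> nat -> R) (r M : nat -> R) :
  (forall n, ex_series (fun k => Rabs (u n k))) ->
  (forall n, Series (fun k => Rabs (u n k)) <= M n) -> ex_series M ->
  (forall n, is_series (u n) (r n)) ->
  is_series (fun k => Series (fun n => u n k)) (Series r).
Proof.
  intros H1 H2 H3 H4.
  assert (Hp : forall n K, sum_n (fun k => Rabs (u n k)) K <= M n).
  { intros n K; eapply Rle_trans; [|apply H2].
    apply series_partial_le; [intros; apply Rabs_pos|now apply Series_correct]. }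
  assert (Hu : forall n k, Rabs (u n k) <= M n).
  { intros n k; eapply Rle_trans; [|apply H2].
    apply (series_term_le (fun k => Rabs (u n k))); [intros; apply Rabs_pos|now apply Series_correct]. }
  assert (Hex : forall k, ex_series (fun n => u n k)).
  { intros k; apply (ex_series_abs_le _ M); auto. }
  apply (is_lim_seq_ext (fun K => Series (fun n => sum_n (u n) K)) _ (Finite (Series r))).
  - intros K; now apply Series_sum_n_exchange.
  - apply (tannery _ M r); auto.
    intros K n; eapply Rle_trans; [|apply (Hp n K)].
    apply (norm_sum_n_m (u n)).
Qed.

(** * Majorized power series *)

(** The l1 norm of the Taylor coefficients on the disk of radius r.  It is
    submultiplicative and passes to infinite sums of functions, which replaces
    Cauchy estimates in proofs that a series of analytic functions is analytic. *)
Definition majorized (f : R -> R) (s0 r M : R) : Prop :=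
  exists a : nat -> R,
    ex_series (fun k => Rabs (a k) * r ^ k) /\
    Series (fun k => Rabs (a k) * r ^ k) <= M /\
    forall h, Rabs h <= r -> is_series (fun k => a k * h ^ k) (f (s0 + h)).

Lemma Rabs_term_le (a h r : R) (k : nat) :
  Rabs h <= r -> Rabs (a * h ^ k) <= Rabs a * r ^ k.
Proof.
  intros Hh. rewrite Rabs_mult, <- RPow_abs.
  apply Rmult_le_compat_l; [apply Rabs_pos|].
  apply pow_incr; split; [apply Rabs_pos|assumption].
Qed.

Lemma majorized_abs_le f s0 r M h :
  majorized f s0 r M -> Rabs h <= r -> Rabs (f (s0 + h)) <= M.
Proof.
  intros [a [H1 [H2 H3]]] Hh. eapply Rle_trans; [|exact H2].
  eapply is_series_abs_le; [|apply (H3 h Hh)|apply Series_correct; exact H1].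
  intros k; now apply Rabs_term_le.
Qed.

Lemma majorized_nonneg f s0 r M : 0 <= r -> majorized f s0 r M -> 0 <= M.
Proof.
  intros Hr H. eapply Rle_trans; [apply Rabs_pos|].
  apply (majorized_abs_le f s0 r M 0 H). now rewrite Rabs_R0.
Qed.

Lemma majorized_ext f g s0 r M :
  (forall h, Rabs h <= r -> f (s0 + h) = g (s0 + h)) ->
  majorized f s0 r M -> majorized g s0 r M.
Proof.
  intros E [a [H1 [H2 H3]]]; exists a; repeat split; auto.
  intros h Hh; rewrite <- E; auto.
Qed.

Lemma majorized_le f s0 r r' M M' :
  0 <= r' <= r -> M <= M' -> majorized f s0 r M -> majorized f s0 r' M'.
Proof.
  intros Hr HM [a [H1 [H2 H3]]]; exists a.
  assert (H : forall k, 0 <= Rabs (a k) * r' ^ k <= Rabs (a k) * r ^ k).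
  { intros k; split.
    - apply Rmult_le_pos; [apply Rabs_pos|apply pow_le; lra].
    - apply Rmult_le_compat_l; [apply Rabs_pos|apply pow_incr; lra]. }
  repeat split.
  - eapply ex_series_abs_le; [|exact H1]. intros k; rewrite Rabs_pos_eq; apply H.
  - eapply Rle_trans; [apply Series_le; [exact H|exact H1]|lra].
  - intros h Hh; apply H3; lra.
Qed.

Lemma majorized_const c s0 r : majorized (fun _ => c) s0 r (Rabs c).
Proof.
  exists (fun k => match k with O => c | _ => 0 end).
  assert (H : is_series (fun k : nat =>
    Rabs (match k with O => c | S _ => 0 end) * r ^ k) (Rabs c)).
  { replace (Rabs c) with (Rabs c * r ^ 0) by (simpl; ring).
    apply (is_series_finite1 (fun k : nat =>
      Rabs (match k with O => c | S _ => 0 end) * r ^ k)).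
    intros k; rewrite Rabs_R0; ring. }
  repeat split.
  - now exists (Rabs c).
  - right; now apply is_series_unique.
  - intros h _. eapply is_series_eq;
      [apply (is_series_finite1 (fun k : nat => match k with O => c | S _ => 0 end * h ^ k))|].
    + intros k; ring.
    + simpl; ring.
Qed.

Lemma majorized_shift c s0 r :
  0 <= r -> majorized (fun s => s + c) s0 r (Rabs (s0 + c) + r).
Proof.
  intros Hr.
  set (a := fun k : nat => match k with O => s0 + c | S O => 1 | _ => 0 end).
  exists a.
  assert (H : is_series (fun k : nat => Rabs (a k) * r ^ k) (Rabs (s0 + c) + r)).
  { replace (Rabs (s0 + c) + r)
      with (Rabs (a 0%nat) * r ^ 0 + Rabs (a 1%nat) * r ^ 1)
      by (simpl; rewrite Rabs_R1; ring).
    apply (is_series_finite2 (fun k : nat => Rabs (a k) * r ^ k)).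
    intros k; simpl; rewrite Rabs_R0; ring. }
  repeat split.
  - eexists; exact H.
  - right; now apply is_series_unique.
  - intros h _. eapply is_series_eq; [apply (is_series_finite2 (fun k : nat => a k * h ^ k))|].
    + intros k; simpl; ring.
    + simpl; ring.
Qed.

Lemma majorized_plus f g s0 r M M' :
  0 <= r -> majorized f s0 r M -> majorized g s0 r M' ->
  majorized (fun s => f s + g s) s0 r (M + M').
Proof.
  intros Hr [a [A1 [A2 A3]]] [b [B1 [B2 B3]]].
  exists (fun k => a k + b k).
  assert (H : forall k, 0 <= Rabs (a k + b k) * r ^ k
                       <= Rabs (a k) * r ^ k + Rabs (b k) * r ^ k).
  { intros k; split.
    - apply Rmult_le_pos; [apply Rabs_pos|now apply pow_le].
    - rewrite <- Rmult_plus_distr_r.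
      apply Rmult_le_compat_r; [now apply pow_le|apply Rabs_triang]. }
  assert (Hx := ex_series_plus (V := RN) _ _ A1 B1).
  repeat split.
  - eapply ex_series_abs_le; [|exact Hx]. intros k; rewrite Rabs_pos_eq; apply H.
  - eapply Rle_trans; [apply Series_le; [exact H|exact Hx]|].
    rewrite Series_plus; auto; lra.
  - intros h Hh.
    eapply is_series_ext; [|exact (is_series_plus (V := RN) _ _ _ _ (A3 h Hh) (B3 h Hh))].
    intros k; unfold plus; simpl; ring.
Qed.

Lemma majorized_opp f s0 r M :
  majorized f s0 r M -> majorized (fun s => - f s) s0 r M.
Proof.
  intros [a [A1 [A2 A3]]]; exists (fun k => - a k).
  repeat split.
  - eapply ex_series_ext; [|exact A1]; intros k; simpl; now rewrite Rabs_Ropp.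
  - erewrite Series_ext; [exact A2|]. intros k; simpl; now rewrite Rabs_Ropp.
  - intros h Hh. eapply is_series_ext; [|exact (is_series_opp (V := RN) _ _ (A3 h Hh))].
    intros k; unfold opp; simpl; ring.
Qed.

Lemma majorized_mult f g s0 r M M' :
  0 <= r -> majorized f s0 r M -> majorized g s0 r M' ->
  majorized (fun s => f s * g s) s0 r (M * M').
Proof.
  intros Hr [a [A1 [A2 A3]]] [b [B1 [B2 B3]]].
  set (c := fun n => sum_f_R0 (fun k => a k * b (n - k)%nat) n).
  assert (Hpow : forall h n k, (k <= n)%nat -> h ^ k * h ^ (n - k) = h ^ n).
  { intros h n k Hk; rewrite <- pow_add; f_equal; lia. }
  assert (Habs : forall (d : nat -> R) h, Rabs h <= r ->
            ex_series (fun k => Rabs (d k) * r ^ k) ->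
            ex_series (fun n => Rabs (d n * h ^ n))).
  { intros d h Hh Hd; eapply ex_series_abs_le; [|exact Hd].
    intros k; rewrite Rabs_Rabsolu; now apply Rabs_term_le. }
  assert (Hrabs : forall (d : nat -> R), 
            ex_series (fun k => Rabs (d k) * r ^ k) ->
            ex_series (fun n => Rabs (Rabs (d n) * r ^ n))).
  { intros d Hd; eapply ex_series_ext; [|exact Hd].
    intros k; simpl; rewrite (Rabs_pos_eq (Rabs _ * _)); auto.
    apply Rmult_le_pos; [apply Rabs_pos|now apply pow_le]. }
  assert (Hn := is_series_mult _ _ _ _ (Series_correct _ A1) (Series_correct _ B1)
     (Hrabs a A1) (Hrabs b B1)).
  assert (HS : forall d r, (0 <= r) -> (forall k, 0 <= d k) -> ex_series (fun k => d k * r ^ k) ->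
      0 <= Series (fun k => d k * r ^ k)).
  { intros d r0 Hr0 Hd Hdd. 
    assert (Hk : forall k, 0 <= d k * r0 ^ k) by (intros k; apply Rmult_le_pos; [auto|now apply pow_le]).
    eapply Rle_trans; [apply (Hk 0%nat)|apply (series_term_le _ _ 0%nat Hk), Series_correct, Hdd]. }
  exists c.
  assert (H : forall n, 0 <= Rabs (c n) * r ^ n <=
     sum_f_R0 (fun k => Rabs (a k) * r ^ k * (Rabs (b (n - k)%nat) * r ^ (n - k))) n).
  { intros n; split; [apply Rmult_le_pos; [apply Rabs_pos|now apply pow_le]|].
    unfold c. eapply Rle_trans.
    - apply Rmult_le_compat_r; [now apply pow_le|apply Rsum_abs].
    - rewrite Rmult_comm, scal_sum. right. apply sum_eq; intros k Hk.
      rewrite Rabs_mult, <- (Hpow r n k Hk); ring. }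
  repeat split.
  - eapply ex_series_abs_le; [|eexists; exact Hn]. intros k; rewrite Rabs_pos_eq; apply H.
  - eapply Rle_trans; [apply Series_le; [exact H|eexists; exact Hn]|].
    rewrite (is_series_unique _ _ Hn).
    apply Rmult_le_compat; auto; apply HS; auto; intros; apply Rabs_pos.
  - intros h Hh.
    eapply is_series_ext; [|exact (is_series_mult _ _ _ _ (A3 h Hh) (B3 h Hh)
       (Habs a h Hh A1) (Habs b h Hh B1))].
    intros n; simpl. unfold c. rewrite Rmult_comm, scal_sum.
    apply sum_eq; intros k Hk. rewrite <- (Hpow h n k Hk); ring.
Qed.

Lemma majorized_exp lam s0 r :
  0 <= lam -> 0 <= r ->
  majorized (fun s => exp (- s * lam)) s0 r (exp (- s0 * lam + r * lam)).
Proof.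
  intros Hl Hr.
  assert (HE := is_series_exp).
  exists (fun k => exp (- s0 * lam) * (- lam) ^ k / INR (fact k)).
  assert (H : is_series (fun k => Rabs (exp (- s0 * lam) * (- lam) ^ k / INR (fact k)) * r ^ k)
             (exp (- s0 * lam + r * lam))).
  { rewrite exp_plus.
    eapply is_series_ext; [|exact (is_series_scal (V := RN) (exp (- s0 * lam)) _ _ (HE (r * lam)))].
    intros k; unfold scal; simpl; unfold mult; simpl.
    assert (Hf := INR_fact_lt_0 k). assert (He := exp_pos (- s0 * lam)).
    rewrite Rabs_div by lra. rewrite Rabs_mult.
    rewrite (Rabs_pos_eq (exp _)) by lra. rewrite (Rabs_pos_eq (INR _)) by lra.
    rewrite <- RPow_abs, Rabs_Ropp, (Rabs_pos_eq lam) by lra.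
    rewrite Rpow_mult_distr. field; lra. }
  repeat split.
  - eexists; exact H.
  - right; now apply is_series_unique.
  - intros h _. replace (- (s0 + h) * lam) with (- s0 * lam + (- lam * h)) by ring.
    rewrite exp_plus.
    eapply is_series_ext; [|exact (is_series_scal (V := RN) (exp (- s0 * lam)) _ _ (HE (- lam * h)))].
    intros k; unfold scal; simpl; unfold mult; simpl.
    rewrite Rpow_mult_distr. field. apply INR_fact_neq_0.
Qed.

(** The coefficients of the sum are the sums of the coefficients, by Fubini for
    the double series of all monomials. *)
Lemma majorized_series (f : nat -> R -> R) (M : nat -> R) s0 r :
  0 <= r -> (forall n, majorized (f n) s0 r (M n)) -> ex_series M ->
  majorized (fun s => Series (fun n => f n s)) s0 r (Series M).
Proof.
  intros Hr H HM.
  destruct (functional_choice _ H) as [a Ha].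
  set (c := fun k => Series (fun n => a n k)).
  assert (Hk : forall h, Rabs h <= r -> forall n k, Rabs (a n k * h ^ k) <= Rabs (a n k) * r ^ k).
  { intros h Hh n k; now apply Rabs_term_le. }
  assert (HF : is_series (fun k => Series (fun n => Rabs (a n k) * r ^ k))
     (Series (fun n => Series (fun k => Rabs (a n k) * r ^ k)))).
  { assert (E : forall n k, Rabs (Rabs (a n k) * r ^ k) = Rabs (a n k) * r ^ k).
    { intros n k; apply Rabs_pos_eq, Rmult_le_pos; [apply Rabs_pos|now apply pow_le]. }
    apply (series_fubini (fun n k => Rabs (a n k) * r ^ k) _ M); auto.
    - intros n; eapply ex_series_ext; [|exact (proj1 (Ha n))]. intros k; now rewrite E.
    - intros n; rewrite (Series_ext _ _ (E n)). apply (Ha n).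
    - intros n; apply Series_correct, (Ha n). }
  assert (Hpos : forall n k, 0 <= Rabs (a n k) * r ^ k).
  { intros n k; apply Rmult_le_pos; [apply Rabs_pos|now apply pow_le]. }
  assert (Hle : forall n k, Rabs (a n k) * r ^ k <= M n).
  { intros n k. destruct (Ha n) as [E1 [E2 _]]. eapply Rle_trans; [|exact E2].
    apply (series_term_le _ _ k (Hpos n) (Series_correct _ E1)). }
  assert (Hex : forall k, ex_series (fun n => Rabs (a n k) * r ^ k)).
  { intros k; apply (ex_series_abs_le _ M); auto. intros n; rewrite Rabs_pos_eq; auto. }
  assert (Hc : forall k, 0 <= Rabs (c k) * r ^ k <= Series (fun n => Rabs (a n k) * r ^ k)).
  { intros k; split; [apply Rmult_le_pos; [apply Rabs_pos|now apply pow_le]|].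
    rewrite <- (Rabs_pos_eq (r ^ k)) at 1 by now apply pow_le.
    rewrite <- Rabs_mult. unfold c. rewrite <- Series_scal_r.
    apply Series_abs_le; auto. intros n. apply Hk. rewrite Rabs_pos_eq; lra. }
  exists c. repeat split.
  - eapply ex_series_abs_le; [|eexists; exact HF]. intros k; rewrite Rabs_pos_eq; apply Hc.
  - eapply Rle_trans; [apply Series_le; [exact Hc|eexists; exact HF]|].
    rewrite (is_series_unique _ _ HF). apply Series_le; auto.
    intros n; split; [|apply (Ha n)].
    eapply Rle_trans; [apply (Hpos n 0%nat)|].
    apply (series_term_le _ _ 0%nat (Hpos n) (Series_correct _ (proj1 (Ha n)))).
  - intros h Hh. eapply is_series_ext; [|
      apply (series_fubini (fun n k => a n k * h ^ k) (fun n => f n (s0 + h)) M)]; auto.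
    + intros k; simpl. unfold c. now rewrite <- Series_scal_r.
    + intros n; eapply ex_series_abs_le; [|exact (proj1 (Ha n))].
      intros k; rewrite Rabs_Rabsolu; auto.
    + intros n. destruct (Ha n) as [E1 [E2 _]]. eapply Rle_trans; [|exact E2].
      apply Series_le; auto. intros k; split; [apply Rabs_pos|auto].
    + intros n; now apply (Ha n).
Qed.

(** * Analytic functions of a real variable *)

Lemma CV_radius_gt (a : nat -> R) (x rho : R) :
  Rabs x < rho -> ex_series (fun k => Rabs (a k) * rho ^ k) -> Rbar_lt (Rabs x) (CV_radius a).
Proof.
  intros Hx Hd. apply Rbar_lt_le_trans with rho; [exact Hx|].
  unfold CV_radius. apply (proj1 (Lub_Rbar_correct _)).
  eapply ex_series_ext; [|exact Hd]. intros k; simpl.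
  assert (H := Rabs_pos x). rewrite Rabs_mult, (Rabs_pos_eq (rho ^ k)); auto. apply pow_le; lra.
Qed.

Lemma pow_series_abs_conv (a : nat -> R) (r : R) :
  0 < r -> ex_series (fun k => a k * r ^ k) ->
  ex_series (fun k => Rabs (a k) * (r / 2) ^ k).
Proof.
  intros Hr Ha.
  assert (Hc : Rbar_le r (CV_radius a)).
  { apply Rbar_not_lt_le; intros Hlt.
    apply (CV_disk_outside a r).
    - rewrite Rabs_pos_eq; [exact Hlt|lra].
    - apply (ex_series_lim_0 _ Ha). }
  eapply ex_series_ext; [|apply (CV_disk_inside a (r / 2))].
  - intros k; simpl. rewrite Rabs_mult, (Rabs_pos_eq (_ ^ _)); auto. apply pow_le; lra.
  - rewrite Rabs_pos_eq by lra. apply Rbar_lt_le_trans with r; [simpl; lra|exact Hc].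
Qed.

(** Only values to the right of the centre are assumed to vanish, because the
    identity theorem below is applied at the left end of the zero set. *)
Lemma pow_series_zero_coef (a : nat -> R) (r : R) :
  0 < r -> ex_series (fun k => Rabs (a k) * r ^ k) ->
  (forall h, 0 < h <= r -> is_series (fun k => a k * h ^ k) 0) ->
  forall k, a k = 0.
Proof.
  intros Hr Ha Hz j; revert a Ha Hz.
  assert (Hshift : forall a, ex_series (fun k => Rabs (a k) * r ^ k) ->
             ex_series (fun k => Rabs (a (S k)) * r ^ k)).
  { intros a Ha. apply ex_series_ext with (fun k => / r * (Rabs (a (S k)) * r ^ S k)).
    - intros n; simpl; field; lra.
    - apply (ex_series_scal (V := RN) (/ r)).
      apply (ex_series_incr_1 (V := RN) (fun k => Rabs (a k) * r ^ k)); auto. }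
  assert (H0 : forall a, ex_series (fun k => Rabs (a k) * r ^ k) ->
     (forall h, 0 < h <= r -> is_series (fun k => a k * h ^ k) 0) -> a 0%nat = 0).
  { intros a Ha Hz. set (C := Series (fun k => Rabs (a (S k)) * r ^ k)).
    (* a_0 is minus the rest of the series, which is O(h) *)
    assert (Hb : forall h, 0 < h <= r -> Rabs (a 0%nat) <= h * C).
    { intros h Hh.
      assert (Hs : is_series (fun k => a (S k) * h ^ S k) (- a 0%nat)).
      { apply (is_series_incr_1 (V := RN) (fun k => a k * h ^ k)).
        eapply is_series_eq; [apply Hz; exact Hh|]. unfold plus; simpl; ring. }
      rewrite <- Rabs_Ropp.
      eapply is_series_abs_le; [|exact Hs|].
      2:{ apply (is_series_scal (V := RN) h), Series_correct, Hshift, Ha. }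
      intros k; unfold scal; simpl; unfold mult; simpl.
      replace (a (S k) * (h * h ^ k)) with (h * (a (S k) * h ^ k)) by ring.
      rewrite Rabs_mult, (Rabs_pos_eq h) by lra.
      apply Rmult_le_compat_l; [lra|].
      apply Rabs_term_le. rewrite Rabs_pos_eq; lra. }
    destruct (Req_dec (a 0%nat) 0) as [E|E]; [exact E|exfalso].
    assert (Hp := Rabs_pos_lt _ E).
    assert (HC : 0 < C).
    { specialize (Hb r ltac:(lra)).
      destruct (Rle_or_lt C 0); auto.
      assert (r * C <= 0) by (rewrite <- (Rmult_0_r r); apply Rmult_le_compat_l; lra). lra. }
    set (h := Rmin r (Rabs (a 0%nat) / (2 * C))).
    assert (Hd : 0 < Rabs (a 0%nat) / (2 * C)) by (apply Rdiv_lt_0_compat; lra).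
    assert (Hh : 0 < h <= r) by (unfold h; split; [now apply Rmin_pos|apply Rmin_l]).
    assert (Hh2 : h * C <= Rabs (a 0%nat) / 2).
    { replace (Rabs (a 0%nat) / 2) with (Rabs (a 0%nat) / (2 * C) * C) by (field; lra).
      apply Rmult_le_compat_r; [lra|apply Rmin_r]. }
    specialize (Hb h Hh). lra. }
  induction j as [|j IH]; intros a Ha Hz; [now apply H0|].
  apply (IH (fun k => a (S k))); [now apply Hshift|].
  intros h Hh.
  apply is_series_ext with (fun k => / h * (a (S k) * h ^ S k)).
  { intros n; simpl; field; lra. }
  eapply is_series_eq.
  - apply (is_series_scal (V := RN) (/ h)).
    apply (is_series_incr_1 (V := RN) (fun k => a k * h ^ k)).
    eapply is_series_eq; [apply Hz; exact Hh|].
    rewrite (H0 a Ha Hz) at 1. instantiate (1 := 0). unfold plus; simpl; ring.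
  - unfold scal; simpl; unfold mult; simpl; ring.
Qed.

Definition analytic_real_at (f : R -> R) (c : R) : Prop :=
  exists r M, 0 < r /\ majorized f c r M.

(** Identity theorem: at the infimum of the half lines on which f vanishes, the
    local power series vanishes to the right, hence also to the left. *)
Lemma analytic_continuation_left (f : R -> R) (lo hi : R) :
  (forall c, lo < c -> analytic_real_at f c) ->
  (forall s, hi < s -> f s = 0) ->
  forall s, lo < s -> f s = 0.
Proof.
  intros Ha Hhi s Hs.
  set (E := fun z => z <= - s /\ forall y, - z < y -> f y = 0).
  destruct (completeness E) as [m [Hm1 Hm2]].
  { exists (- s); intros z Hz; apply Hz. }
  { exists (- Rmax hi s); split; [apply Ropp_le_contravar, Rmax_r|].
    intros y Hy; apply Hhi. assert (H := Rmax_l hi s). lra. }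
  assert (Hms : m <= - s) by (apply Hm2; intros z Hz; apply Hz).
  assert (Hzero : forall y, - m < y -> f y = 0).
  { intros y Hy. destruct (Req_dec (f y) 0) as [|Hn]; auto. exfalso.
    assert (m <= - y); [|lra].
    apply Hm2; intros z [Hz1 Hz2]. destruct (Rle_or_lt z (- y)); auto.
    exfalso; apply Hn, Hz2; lra. }
  destruct (Ha (- m)) as [r [M [Hr [a [A1 [A2 A3]]]]]]; [lra|].
  assert (Hca : forall k, a k = 0).
  { apply (pow_series_zero_coef a r); auto. intros h Hh.
    eapply is_series_eq; [apply A3; rewrite Rabs_pos_eq; lra|]. apply Hzero; lra. }
  assert (Hloc : forall h, Rabs h <= r -> f (- m + h) = 0).
  { intros h Hh. rewrite <- (is_series_unique _ _ (A3 h Hh)).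
    apply is_series_unique. apply is_series_ext with (fun _ => 0).
    - intros k; now rewrite Hca, Rmult_0_l.
    - apply (is_series_finite1 (fun _ => 0)); auto. }
  destruct (Req_dec s (- m)) as [->|Hne].
  { rewrite <- (Rplus_0_r (- m)). apply Hloc. rewrite Rabs_R0; lra. }
  assert (Hx : E (- Rmax s (- m - r))).
  { split; [apply Ropp_le_contravar, Rmax_l|]. intros y Hy.
    assert (H := Rmax_r s (- m - r)).
    destruct (Rle_or_lt y (- m)) as [Hy2|Hy2]; [|now apply Hzero].
    replace y with (- m + (y + m)) by ring. apply Hloc. apply Rabs_le; lra. }
  apply Hm1 in Hx. exfalso.
  assert (Rmax s (- m - r) < - m); [|lra].
  apply Rmax_lub_lt; lra.
Qed.

Lemma analytic_real_plus f g c :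
  analytic_real_at f c -> analytic_real_at g c -> analytic_real_at (fun s => f s + g s) c.
Proof.
  intros [r1 [M1 [H1 F1]]] [r2 [M2 [H2 F2]]].
  exists (Rmin r1 r2), (M1 + M2).
  assert (0 < Rmin r1 r2) by now apply Rmin_pos.
  assert (A := Rmin_l r1 r2). assert (B := Rmin_r r1 r2).
  split; auto. apply majorized_plus; [lra| |].
  - apply (majorized_le f c r1 _ M1); auto; lra.
  - apply (majorized_le g c r2 _ M2); auto; lra.
Qed.

Lemma analytic_real_mult f g c :
  analytic_real_at f c -> analytic_real_at g c -> analytic_real_at (fun s => f s * g s) c.
Proof.
  intros [r1 [M1 [H1 F1]]] [r2 [M2 [H2 F2]]].
  exists (Rmin r1 r2), (M1 * M2).
  assert (0 < Rmin r1 r2) by now apply Rmin_pos.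
  assert (A := Rmin_l r1 r2). assert (B := Rmin_r r1 r2).
  split; auto. apply majorized_mult; [lra| |].
  - apply (majorized_le f c r1 _ M1); auto; lra.
  - apply (majorized_le g c r2 _ M2); auto; lra.
Qed.

Lemma analytic_real_opp f c :
  analytic_real_at f c -> analytic_real_at (fun s => - f s) c.
Proof.
  intros [r1 [M1 [H1 F1]]]; exists r1, M1; split; auto. now apply majorized_opp.
Qed.

Lemma analytic_real_const a c : analytic_real_at (fun _ => a) c.
Proof. exists 1, (Rabs a); split; [lra|apply majorized_const]. Qed.

Lemma analytic_real_translate f g c d :
  (forall h, f (c + h) = g (d + h)) -> analytic_real_at f c -> analytic_real_at g d.
Proof.
  intros E [r [M [Hr [a [H1 [H2 H3]]]]]]. exists r, M; split; auto.
  exists a; repeat split; auto. intros h Hh; rewrite <- E; auto.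
Qed.

Lemma analytic_real_lim f c : analytic_real_at f c -> is_lim (fun h => f (c + h)) 0 (f c).
Proof.
  intros [r [M [Hr [a [H1 [H2 H3]]]]]].
  assert (Hcv : Rbar_lt (Rabs 0) (CV_radius a)).
  { apply CV_radius_gt with r; auto. rewrite Rabs_R0; lra. }
  assert (E : forall h, Rabs h <= r -> PSeries a h = f (c + h)).
  { intros h Hh; unfold PSeries; now apply is_series_unique, H3. }
  apply is_lim_ext_loc with (PSeries a).
  - exists (mkposreal r Hr). intros y Hy _. apply E.
    apply ball_R in Hy; simpl in Hy. rewrite Rminus_0_r in Hy. lra.
  - rewrite <- (Rplus_0_r c), <- E at 1 by (rewrite Rabs_R0; lra).
    apply is_lim_continuity. now apply PSeries_continuity.
Qed.

(** * Complex powers and the complex binomial series *)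

Lemma C_ext (z w : C) : fst z = fst w -> snd z = snd w -> z = w.
Proof. destruct z, w; simpl; now intros -> ->. Qed.

Lemma Rabs_fst_le (z : C) : Rabs (fst z) <= Cmod z.
Proof. eapply Rle_trans; [apply Rmax_l|apply Rmax_Cmod]. Qed.

Lemma Rabs_snd_le (z : C) : Rabs (snd z) <= Cmod z.
Proof. eapply Rle_trans; [apply Rmax_r|apply Rmax_Cmod]. Qed.

Lemma cpower_add u s s' : cpower u (s + s')%C = (cpower u s * cpower u s')%C.
Proof.
  destruct s as [a b], s' as [a' b']; unfold cpower; simpl.
  rewrite !Rmult_plus_distr_r, exp_plus, cos_plus, sin_plus.
  apply C_ext; simpl; ring.
Qed.

Lemma cpower_0 u : cpower u 0%C = 1%C.
Proof.
  unfold cpower; simpl; rewrite !Rmult_0_l, exp_0, cos_0, sin_0.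
  apply C_ext; simpl; ring.
Qed.

Lemma cpower_inv u s : (/ cpower u s)%C = cpower u (- s)%C.
Proof.
  assert (H : (cpower u s * cpower u (- s) = 1)%C).
  { rewrite <- cpower_add, <- (cpower_0 u); f_equal; ring. }
  assert (Hn : cpower u s <> 0%C).
  { intros E; rewrite E in H. apply (f_equal fst) in H; simpl in H. lra. }
  replace (cpower u (- s)) with (/ cpower u s * (cpower u s * cpower u (- s)))%C.
  - rewrite H; ring.
  - field; exact Hn.
Qed.

Lemma cpower_opp_nat u k : 0 < u -> cpower u (- RtoC (INR k))%C = RtoC (/ u ^ k).
Proof.
  intros Hu; unfold cpower, RtoC; simpl.
  rewrite Ropp_0, Rmult_0_l, cos_0, sin_0, Ropp_mult_distr_l_reverse, exp_Ropp.
  rewrite <- Rpower_pow by assumption. unfold Rpower.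
  apply C_ext; simpl; ring.
Qed.

Lemma cpower_1 s : cpower 1 s = 1%C.
Proof.
  unfold cpower; rewrite ln_1, !Rmult_0_r, exp_0, cos_0, sin_0. apply C_ext; simpl; ring.
Qed.

Lemma Cmod_cpower u s : Cmod (cpower u s) = exp (Re s * ln u).
Proof.
  unfold cpower, Cmod; cbn [fst snd].
  set (e := exp _). assert (He : 0 < e) by apply exp_pos.
  replace ((e * cos (Im s * ln u)) ^ 2 + (e * sin (Im s * ln u)) ^ 2)
    with (e ^ 2 * (Rsqr (sin (Im s * ln u)) + Rsqr (cos (Im s * ln u)))) by (unfold Rsqr; ring).
  rewrite sin2_cos2, Rmult_1_r. apply sqrt_pow2; lra.
Qed.

Lemma cpower_mult u v s : 0 < u -> 0 < v -> (cpower u s * cpower v s)%C = cpower (u * v) s.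
Proof.
  intros Hu Hv; unfold cpower. rewrite ln_mult by assumption.
  rewrite !Rmult_plus_distr_l, exp_plus, cos_plus, sin_plus.
  apply C_ext; simpl; ring.
Qed.

(** Componentwise convergence: all estimates on zeta are made on real and
    imaginary parts, where real power series are available. *)
Definition is_cseries (a : nat -> C) (l : C) : Prop :=
  is_series (fun n => fst (a n)) (fst l) /\ is_series (fun n => snd (a n)) (snd l).

Lemma is_cseries_of (a : nat -> C) (l : C) :
  is_series (K := C_AbsRing) (V := C_NormedModule) a l -> is_cseries a l.
Proof.
  intros H.
  assert (Hf : forall n, sum_n (fun k => fst (a k)) n = fst (sum_n (G := C_AbelianMonoid) a n)).
  { induction n as [|n IH]; [now rewrite !sum_O|]. rewrite !sum_Sn, IH; reflexivity. }
  assert (Hs : forall n, sum_n (fun k => snd (a k)) n = snd (sum_n (G := C_AbelianMonoid) a n)).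
  { induction n as [|n IH]; [now rewrite !sum_O|]. rewrite !sum_Sn, IH; reflexivity. }
  split; intros P [eps HP];
    (destruct (H (fun z => ball (M := C_UniformSpace) l eps z)) as [N HN];
     [now exists eps|]); exists N; intros n Hn; apply HP.
  - rewrite Hf. apply (HN n Hn).
  - rewrite Hs. apply (HN n Hn).
Qed.

Lemma is_cseries_scal (c : C) a l :
  is_cseries a l -> is_cseries (fun n => (c * a n)%C) (c * l)%C.
Proof.
  intros [H1 H2]; split; simpl.
  - eapply is_series_ext; [|exact (is_series_minus (V := RN) _ _ _ _
      (is_series_scal (V := RN) (fst c) _ _ H1)
      (is_series_scal (V := RN) (snd c) _ _ H2))].
    intros n; reflexivity.
  - eapply is_series_ext; [|exact (is_series_plus (V := RN) _ _ _ _
      (is_series_scal (V := RN) (fst c) _ _ H2)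
      (is_series_scal (V := RN) (snd c) _ _ H1))].
    intros n; reflexivity.
Qed.

Lemma is_cseries_plus a b la lb :
  is_cseries a la -> is_cseries b lb -> is_cseries (fun n => (a n + b n)%C) (la + lb)%C.
Proof.
  intros [H1 H2] [H3 H4]; split; simpl.
  - exact (is_series_plus (V := RN) _ _ _ _ H1 H3).
  - exact (is_series_plus (V := RN) _ _ _ _ H2 H4).
Qed.

Lemma is_cseries_ext a b l : (forall n, a n = b n) -> is_cseries a l -> is_cseries b l.
Proof.
  intros E [H1 H2]; split; (eapply is_series_ext; [|eassumption]); intros n; simpl; now rewrite E.
Qed.

Lemma is_cseries_eq a l l' : is_cseries a l -> l = l' -> is_cseries a l'.
Proof. now intros H <-. Qed.

(** (s-1) s (s+1) ... (s+k-2) / k!, the coefficient of w^k in (1-w)^{1-s}. *)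
Fixpoint rising_binom (k : nat) (s : C) : C :=
  match k with
  | O => 1%C
  | S k' => (rising_binom k' s * ((s - 1 + RtoC (INR k')) * RtoC (/ INR (S k'))))%C
  end.

(** The same product with A in place of s - 1: a bound when |s - 1| <= A, in
    absolute value and in the norm of [majorized]. *)
Fixpoint rising_major (A : R) (k : nat) : R :=
  match k with
  | O => 1
  | S k' => rising_major A k' * ((A + INR k') * / INR (S k'))
  end.

Lemma rising_major_pos A k : 0 < A -> 0 < rising_major A k.
Proof.
  intros HA; induction k as [|k IH]; cbn [rising_major]; [lra|].
  assert (H := pos_INR k). assert (H2 := lt_0_INR (S k) ltac:(lia)).
  repeat apply Rmult_lt_0_compat; auto; [lra|now apply Rinv_0_lt_compat].
Qed.

Lemma rising_major_summable A rho :
  0 < A -> 0 < rho < 1 -> ex_series (fun k => rising_major A k * rho ^ k).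
Proof.
  intros HA Hr.
  assert (Hp : forall k, 0 < rising_major A k * rho ^ k).
  { intros k; apply Rmult_lt_0_compat; [now apply rising_major_pos|apply pow_lt; lra]. }
  apply ex_series_ext with (fun k => Rabs (rising_major A k * rho ^ k)).
  { intros n; apply Rabs_pos_eq; left; apply Hp. }
  apply ex_series_DAlembert with rho; [lra| |].
  - intros n; specialize (Hp n); lra.
  - apply is_lim_seq_ext with (fun n => rho * (1 + (A - 1) * / INR (S n))).
    + intros n; symmetry. rewrite Rabs_pos_eq by (left; apply Rdiv_lt_0_compat; apply Hp).
      cbn [rising_major pow].
      assert (H1 := rising_major_pos A n HA). assert (H2 : rho ^ n <> 0) by (apply pow_nonzero; lra).
      assert (H3 := lt_0_INR (S n) ltac:(lia)). rewrite S_INR in *. field. lra.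
    + replace (Finite rho) with (Finite (rho * (1 + (A - 1) * 0))) by (f_equal; ring).
      apply (is_lim_seq_scal_l _ rho (Finite _)).
      apply is_lim_seq_plus'; [apply is_lim_seq_const|].
      apply (is_lim_seq_scal_l _ (A - 1) (Finite _)), inv_INR_S_lim.
Qed.

Lemma rising_binom_le s A k :
  Cmod (s - 1) <= A -> Cmod (rising_binom k s) <= rising_major A k.
Proof.
  intros HA; induction k as [|k IH]; cbn [rising_major rising_binom].
  { rewrite Cmod_1; lra. }
  assert (H2 := lt_0_INR (S k) ltac:(lia)).
  rewrite !Cmod_mult, !Cmod_R, (Rabs_pos_eq (/ _)) by (left; now apply Rinv_0_lt_compat).
  apply Rmult_le_compat; auto using Cmod_ge_0.
  - apply Rmult_le_pos; [apply Cmod_ge_0|left; now apply Rinv_0_lt_compat].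
  - apply Rmult_le_compat_r; [left; now apply Rinv_0_lt_compat|].
    eapply Rle_trans; [apply Cmod_triangle|].
    rewrite Cmod_R, (Rabs_pos_eq (INR k)) by apply pos_INR. lra.
Qed.

(** For a complex exponent s the series is characterized by its first order
    differential equation in the real variable w. *)
Lemma complex_binomial_series (s : C) (w : R) :
  0 <= w < 1 ->
  is_cseries (fun k => (rising_binom k s * RtoC (w ^ k))%C) (cpower (1 - w) (1 - s)%C).
Proof.
  intros Hw.
  destruct s as [sg y]. set (s := (sg, y) : C).
  set (p := fun k => fst (rising_binom k s)). set (q := fun k => snd (rising_binom k s)).
  set (b := sg - 1).
  assert (Hp : forall k, INR (S k) * p (S k) = p k * (b + INR k) - q k * y).
  { intros k; unfold p, q, b; cbn [rising_binom]; unfold s. 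
    assert (H := not_0_INR (S k) ltac:(lia)).
    destruct (rising_binom k (sg, y)) as [u v].
    unfold Cmult, RtoC, Cminus, Cplus, Copp; cbn [fst snd]. field; auto. }
  assert (Hq : forall k, INR (S k) * q (S k) = q k * (b + INR k) + p k * y).
  { intros k; unfold p, q, b; cbn [rising_binom]; unfold s. 
    assert (H := not_0_INR (S k) ltac:(lia)).
    destruct (rising_binom k (sg, y)) as [u v].
    unfold Cmult, RtoC, Cminus, Cplus, Copp; cbn [fst snd]. field; auto. }
  set (A := Cmod (s - 1) + 1).
  assert (HA : 0 < A) by (unfold A; assert (H := Cmod_ge_0 (s - 1)); lra).
  assert (Hpq : forall k, Rabs (p k) <= rising_major A k /\ Rabs (q k) <= rising_major A k).
  { intros k; assert (H : Cmod (rising_binom k s) <= rising_major A k)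
      by (apply rising_binom_le; unfold A; lra).
    split; (eapply Rle_trans; [|exact H]); [apply Rabs_fst_le|apply Rabs_snd_le]. }
  assert (HD : forall (a : nat -> R) z, 0 <= z < 1 -> (forall k, Rabs (a k) <= rising_major A k) ->
      Rbar_lt (Rabs z) (CV_radius a)).
  { intros a z Hz Ha. apply CV_radius_gt with ((1 + z) / 2).
    - rewrite Rabs_pos_eq; lra.
    - eapply ex_series_abs_le; [|apply (rising_major_summable A ((1 + z) / 2) HA); lra].
      intros k. assert (Hz2 : 0 <= ((1 + z) / 2) ^ k) by (apply pow_le; lra).
      rewrite Rabs_mult, Rabs_Rabsolu, (Rabs_pos_eq (_ ^ k)) by auto.
      apply Rmult_le_compat_r; auto. }
  assert (Hser : forall (a : nat -> R) z, 0 <= z < 1 -> (forall k, Rabs (a k) <= rising_major A k) ->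
      is_series (fun k => a k * z ^ k) (PSeries a z) /\
      is_series (fun k => INR (S k) * a (S k) * z ^ k) (PSeries (PS_derive a) z) /\
      is_series (fun k => INR k * a k * z ^ k) (z * PSeries (PS_derive a) z)).
  { intros a z Hz Ha. assert (Hd := HD a z Hz Ha).
    assert (H1 : is_series (fun k => INR (S k) * a (S k) * z ^ k) (PSeries (PS_derive a) z)).
    { apply (proj1 (is_pseries_R (PS_derive a) z _)). apply PSeries_correct.
      apply CV_radius_inside. now rewrite CV_radius_derive. }
    repeat split; auto.
    - apply (proj1 (is_pseries_R a z _)). apply PSeries_correct.
      apply CV_radius_inside; auto.
    - apply (is_series_decr_1 (V := RN)).
      eapply is_series_eq.
      + apply is_series_ext with (fun k => z * (INR (S k) * a (S k) * z ^ k)); [intros k; simpl; ring|].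
        exact (is_series_scal (V := RN) z _ _ H1).
      + unfold scal, plus, opp; simpl; unfold mult; simpl. ring. }
  set (P := PSeries p). set (Q := PSeries q).
  set (P' := PSeries (PS_derive p)). set (Q' := PSeries (PS_derive q)).
  assert (HP : forall z, 0 <= z < 1 -> (1 - z) * P' z = b * P z - y * Q z).
  { intros z Hz. destruct (Hser p z Hz) as [p1 [p2 p3]]; [apply Hpq|].
    destruct (Hser q z Hz) as [q1 [q2 q3]]; [apply Hpq|].
    assert (E : P' z = b * P z - y * Q z + z * P' z); [|lra].
    refine (eq_trans (eq_sym (is_series_unique _ _ p2)) _). apply is_series_unique.
    eapply is_series_ext; [|exact (is_series_plus (V := RN) _ _ _ _
      (is_series_minus (V := RN) _ _ _ _
        (is_series_scal (V := RN) b _ _ p1)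
        (is_series_scal (V := RN) y _ _ q1)) p3)].
    intros k; rewrite Hp; unfold scal, plus, minus, opp; simpl; unfold mult, plus, opp; simpl; ring. }
  assert (HQ : forall z, 0 <= z < 1 -> (1 - z) * Q' z = b * Q z + y * P z).
  { intros z Hz. destruct (Hser p z Hz) as [p1 [p2 p3]]; [apply Hpq|].
    destruct (Hser q z Hz) as [q1 [q2 q3]]; [apply Hpq|].
    assert (E : Q' z = b * Q z + y * P z + z * Q' z); [|lra].
    refine (eq_trans (eq_sym (is_series_unique _ _ q2)) _). apply is_series_unique.
    eapply is_series_ext; [|exact (is_series_plus (V := RN) _ _ _ _
      (is_series_plus (V := RN) _ _ _ _
        (is_series_scal (V := RN) b _ _ q1)
        (is_series_scal (V := RN) y _ _ p1)) q3)].
    intros k; rewrite Hq; unfold scal, plus, minus, opp; simpl; unfold mult, plus, opp; simpl; ring. }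
  assert (dP : forall z, 0 <= z < 1 -> is_derive P z (P' z)).
  { intros z Hz; apply is_derive_PSeries, HD; auto; apply Hpq. }
  assert (dQ : forall z, 0 <= z < 1 -> is_derive Q z (Q' z)).
  { intros z Hz; apply is_derive_PSeries, HD; auto; apply Hpq. }
  assert (p1 : is_series (fun k => p k * w ^ k) (P w))
    by exact (proj1 (Hser p w Hw (fun k => proj1 (Hpq k)))).
  assert (q1 : is_series (fun k => q k * w ^ k) (Q w))
    by exact (proj1 (Hser q w Hw (fun k => proj2 (Hpq k)))).
  (* the series P + iQ solves (1 - z) f' = (s - 1) f, so (P + iQ) (1 - z)^{s-1} = U + iV is constant *)
  set (l := fun z => ln (1 - z)).
  set (U := fun z => exp (b * l z) * (P z * cos (y * l z) - Q z * sin (y * l z))).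
  set (V := fun z => exp (b * l z) * (P z * sin (y * l z) + Q z * cos (y * l z))).
  assert (P0 : P 0 = 1) by (unfold P; rewrite PSeries_0; reflexivity).
  assert (Q0 : Q 0 = 0) by (unfold Q; rewrite PSeries_0; reflexivity).
  clearbody P Q P' Q'.
  assert (HUV : U w = 1 /\ V w = 0).
  { assert (HUV0 : U 0 = 1 /\ V 0 = 0).
    { unfold U, V, l. rewrite Rminus_0_r, ln_1, !Rmult_0_r, exp_0, cos_0, sin_0, P0, Q0; lra. }
    destruct (Req_dec w 0) as [->|Hw0]; [exact HUV0|].
    assert (dUV : forall z, 0 <= z <= w -> is_derive U z 0 /\ is_derive V z 0).
    { intros z Hz. unfold U, V, l.
      assert (HPz := dP z ltac:(lra)). assert (HQz := dQ z ltac:(lra)).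
      assert (E1 := HP z ltac:(lra)). assert (E2 := HQ z ltac:(lra)).
      assert (HP'z : P' z = (b * P z - y * Q z) / (1 - z)) by (rewrite <- E1; field; lra).
      assert (HQ'z : Q' z = (b * Q z + y * P z) / (1 - z)) by (rewrite <- E2; field; lra).
      split; (auto_derive;
        [repeat split; try lra; [exists (P' z)|exists (Q' z)]; auto|];
        replace (Derive (fun x : R => P x) z) with (P' z) by (symmetry; apply is_derive_unique; exact HPz);
        replace (Derive (fun x : R => Q x) z) with (Q' z) by (symmetry; apply is_derive_unique; exact HQz);
        rewrite HP'z, HQ'z; field; lra). }
    assert (H0w : 0 < w) by lra.
    split.
    - rewrite <- (proj1 HUV0). symmetry; exact (eq_is_derive (V := RN) U 0 w (fun z Hz => proj1 (dUV z Hz)) H0w).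
    - refine (eq_trans _ (proj2 HUV0)).
      symmetry; exact (eq_is_derive (V := RN) V 0 w (fun z Hz => proj2 (dUV z Hz)) H0w). }
  destruct HUV as [HU HV]. unfold U, V in HU, HV.
  set (L := l w) in *. assert (Hcs := sin2_cos2 (y * L)). unfold Rsqr in Hcs.
  set (cc := cos (y * L)) in *. set (ss := sin (y * L)) in *.
  assert (He := exp_pos (b * L)). set (E := exp (b * L)) in *.
  assert (HPw : P w = / E * cc).
  { replace (P w) with (P w * (ss * ss + cc * cc)) by (rewrite Hcs; ring).
    replace (P w * (ss * ss + cc * cc)) with
      (/ E * (cc * (E * (P w * cc - Q w * ss)) + ss * (E * (P w * ss + Q w * cc)))) by (field; lra).
    rewrite HU, HV; ring. }
  assert (HQw : Q w = - (/ E * ss)).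
  { replace (Q w) with (Q w * (ss * ss + cc * cc)) by (rewrite Hcs; ring).
    replace (Q w * (ss * ss + cc * cc)) with
      (/ E * (cc * (E * (P w * ss + Q w * cc)) - ss * (E * (P w * cc - Q w * ss)))) by (field; lra).
    rewrite HU, HV; ring. }
  split; simpl.
  - eapply is_series_eq.
    + eapply is_series_ext; [|exact p1]. intros k; unfold p; simpl; ring.
    + rewrite HPw. fold (l w). fold L. unfold E. rewrite <- exp_Ropp.
      replace (1 + - sg) with (- b) by (unfold b; ring).
      replace (0 + - y) with (- y) by ring.
      rewrite !Ropp_mult_distr_l_reverse, cos_neg. reflexivity.
  - eapply is_series_eq.
    + eapply is_series_ext; [|exact q1]. intros k; unfold q; simpl; ring.
    + rewrite HQw. fold (l w). fold L. unfold E. rewrite <- exp_Ropp.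
      replace (1 + - sg) with (- b) by (unfold b; ring).
      replace (0 + - y) with (- y) by ring.
      rewrite !Ropp_mult_distr_l_reverse, sin_neg. unfold ss; ring.
Qed.

(** * Landau's identity for the zeta function *)

Definition Cmajorized (f : R -> C) (s0 r M : R) : Prop :=
  exists M1 M2, majorized (fun s => fst (f s)) s0 r M1 /\
    majorized (fun s => snd (f s)) s0 r M2 /\ M1 + M2 <= M.

Lemma Cmajorized_le f s0 r M M' : M <= M' -> Cmajorized f s0 r M -> Cmajorized f s0 r M'.
Proof. intros H [M1 [M2 [H1 [H2 H3]]]]; exists M1, M2; repeat split; auto; lra. Qed.

(** Adding the norms of the real and imaginary parts keeps the norm exactly
    submultiplicative; a constant factor here would spoil the products
    [rising_binom] of unbounded length. *)
Lemma Cmajorized_mult f g s0 r M M' :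
  0 <= r -> Cmajorized f s0 r M -> Cmajorized g s0 r M' ->
  Cmajorized (fun s => (f s * g s)%C) s0 r (M * M').
Proof.
  intros Hr [a [b [Ha [Hb Hab]]]] [c [d [Hc [Hd Hcd]]]].
  assert (a0 := majorized_nonneg _ _ _ _ Hr Ha). assert (b0 := majorized_nonneg _ _ _ _ Hr Hb).
  assert (c0 := majorized_nonneg _ _ _ _ Hr Hc). assert (d0 := majorized_nonneg _ _ _ _ Hr Hd).
  exists (a * c + b * d), (a * d + b * c). simpl; repeat split.
  - apply (majorized_plus (fun s => fst (f s) * fst (g s)) (fun s => - (snd (f s) * snd (g s)))); auto.
    + now apply majorized_mult.
    + now apply majorized_opp, majorized_mult.
  - apply (majorized_plus (fun s => fst (f s) * snd (g s)) (fun s => snd (f s) * fst (g s))); auto;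
      now apply majorized_mult.
  - replace (a * c + b * d + (a * d + b * c)) with ((a + b) * (c + d)) by ring.
    apply Rmult_le_compat; lra.
Qed.

Lemma Cmajorized_rising_binom A y s0 r k :
  0 <= r -> Rabs (s0 - 1) + r + Rabs y <= A ->
  Cmajorized (fun s => rising_binom k (s, y)) s0 r (rising_major A k).
Proof.
  intros Hr HA; induction k as [|k IH]; cbn [rising_major rising_binom].
  { exists (Rabs 1), (Rabs 0). simpl; repeat split; try apply majorized_const.
    rewrite Rabs_R1, Rabs_R0; lra. }
  apply Cmajorized_mult; auto.
  assert (H2 := lt_0_INR (S k) ltac:(lia)). assert (H3 := pos_INR k).
  assert (H4 : 0 < / INR (S k)) by now apply Rinv_0_lt_compat.
  exists ((Rabs (s0 + (INR k - 1)) + r) * Rabs (/ INR (S k))), (Rabs (y * / INR (S k))).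
  repeat split.
  - apply (majorized_ext (fun s => (s + (INR k - 1)) * / INR (S k))).
    + intros h _; cbn [fst snd Cmult Cplus Cminus Copp RtoC]; ring.
    + apply majorized_mult; auto; [now apply majorized_shift|apply majorized_const].
  - apply (majorized_ext (fun s => y * / INR (S k))); [|apply majorized_const].
    intros h _; cbn [fst snd Cmult Cplus Cminus Copp RtoC]; ring.
  - rewrite Rabs_mult, (Rabs_pos_eq (/ _)) by lra.
    rewrite <- Rmult_plus_distr_r. apply Rmult_le_compat_r; [lra|].
    replace (s0 + (INR k - 1)) with (s0 - 1 + INR k) by ring.
    assert (H := Rabs_triang (s0 - 1) (INR k)). rewrite (Rabs_pos_eq (INR k)) in H; lra.
Qed.

Lemma Cmajorized_cpower u y s0 r k :
  1 <= u -> 0 <= r ->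
  Cmajorized (fun s => cpower u (1 - (s, y) - RtoC (INR k))%C) s0 r
    (2 * exp ((1 - s0 + r) * ln u) / u ^ k).
Proof.
  intros Hu Hr.
  assert (Hl : 0 <= ln u) by (rewrite <- ln_1; destruct Hu as [Hu|<-]; [left; apply ln_increasing; lra|lra]).
  assert (Hup : 0 < u ^ k) by (apply pow_lt; lra).
  set (e := exp ((1 - INR k) * ln u)).
  assert (Hpos : 0 < e) by apply exp_pos.
  assert (HB : forall c, -1 <= c <= 1 ->
    majorized (fun s => exp ((1 - s - INR k) * ln u) * c) s0 r (exp ((1 - s0 + r) * ln u) / u ^ k)).
  { intros c Hc.
    apply (majorized_ext (fun s => e * c * exp (- s * ln u))).
    { intros h _. unfold e. rewrite Rmult_assoc, (Rmult_comm c), <- Rmult_assoc, <- exp_plus.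
      f_equal. f_equal. ring. }
    apply (majorized_le _ s0 r r (Rabs (e * c) * exp (- s0 * ln u + r * ln u))); [lra| |].
    - replace (exp ((1 - s0 + r) * ln u) / u ^ k) with (e * exp (- s0 * ln u + r * ln u)).
      + apply Rmult_le_compat_r; [left; apply exp_pos|].
        rewrite Rabs_mult, (Rabs_pos_eq e) by lra.
        rewrite <- (Rmult_1_r e) at 2. apply Rmult_le_compat_l; [lra|]. now apply Rabs_le.
      + unfold e. rewrite <- exp_plus. unfold Rdiv.
        rewrite <- Rpower_pow by lra. unfold Rpower.
        rewrite <- exp_Ropp, <- exp_plus. f_equal; ring.
    - apply majorized_mult; auto; [apply majorized_const|now apply majorized_exp]. }
  exists (exp ((1 - s0 + r) * ln u) / u ^ k), (exp ((1 - s0 + r) * ln u) / u ^ k).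
  repeat split.
  - eapply majorized_ext; [|apply (HB (cos ((0 + - y + - 0) * ln u)))].
    + intros h _; unfold cpower; cbn [fst snd Cmult Cplus Cminus Copp RtoC Re Im].
      f_equal.
    + apply COS_bound.
  - eapply majorized_ext; [|apply (HB (sin ((0 + - y + - 0) * ln u)))].
    + intros h _; unfold cpower; cbn [fst snd Cmult Cplus Cminus Copp RtoC Re Im].
      f_equal.
    + apply SIN_bound.
  - right; field; lra.
Qed.

Lemma Cmajorized_series (f : nat -> R -> C) (M : nat -> R) s0 r :
  0 <= r -> (forall n, Cmajorized (f n) s0 r (M n)) -> ex_series M ->
  Cmajorized (fun s => (Series (fun n => fst (f n s)), Series (fun n => snd (f n s)))) s0 r (Series M).
Proof.
  intros Hr H HM.
  destruct (functional_choice _ H) as [M1 H1].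
  destruct (functional_choice _ H1) as [M2 H2].
  assert (P1 : forall n, 0 <= M1 n) by (intros n; apply (majorized_nonneg _ _ _ _ Hr (proj1 (H2 n)))).
  assert (P2 : forall n, 0 <= M2 n)
    by (intros n; apply (majorized_nonneg _ _ _ _ Hr (proj1 (proj2 (H2 n))))).
  assert (L : forall n, M1 n + M2 n <= M n) by (intros n; apply (H2 n)).
  assert (E1 : ex_series M1).
  { apply (ex_series_abs_le M1 M); auto. intros n; rewrite Rabs_pos_eq by auto.
    specialize (P2 n); specialize (L n); lra. }
  assert (E2 : ex_series M2).
  { apply (ex_series_abs_le M2 M); auto. intros n; rewrite Rabs_pos_eq by auto.
    specialize (P1 n); specialize (L n); lra. }
  exists (Series M1), (Series M2); repeat split.
  - apply (majorized_series (fun n s => fst (f n s))); auto. intros n; apply (H2 n).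
  - apply (majorized_series (fun n s => snd (f n s))); auto. intros n; apply (H2 n).
  - rewrite <- Series_plus by auto. apply Series_le; auto. intros n; split; auto.
    specialize (P1 n); specialize (P2 n); lra.
Qed.

(** The integers N >= 2, for which 1/N <= 1/2 keeps the binomial series of
    (N-1)^{1-s} = N^{1-s} (1-1/N)^{1-s} away from the boundary of its disk. *)
Definition base (n : nat) : R := INR (S (S n)).

Lemma base_ge2 n : 2 <= base n.
Proof. unfold base; rewrite !S_INR; assert (H := pos_INR n); lra. Qed.

Lemma inv_base_sq_summable : ex_series (fun n => / (base n) ^ 2).
Proof.
  apply (ex_series_abs_le _ (fun n => / INR (S n) - / INR (S (S n)))).
  - intros n. assert (H := base_ge2 n). unfold base in *.
    rewrite Rabs_pos_eq by (left; apply Rinv_0_lt_compat, pow_lt; lra).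
    rewrite (S_INR (S n)) in *. set (x := INR (S n)) in *.
    assert (Hx : 1 <= x) by lra.
    replace (/ x - / (x + 1)) with (/ (x * (x + 1))) by (field; lra).
    apply Rinv_le_contravar; nra.
  - exists 1.
    apply (is_lim_seq_ext (fun n => 1 - / INR (S (S n))) _ (Finite 1)).
    + intros n; induction n as [|n IH].
      * rewrite sum_O; simpl; field.
      * rewrite sum_Sn, <- IH. unfold plus; simpl; ring.
    + replace (Finite 1) with (Finite (1 - 0)) by (f_equal; ring).
      apply is_lim_seq_minus'; [apply is_lim_seq_const|].
      apply (is_lim_seq_incr_1 (fun n => / INR (S n))), inv_INR_S_lim.
Qed.

Definition shift_term (n k : nat) (s : C) : C :=
  (rising_binom k s * cpower (base n) (1 - s - RtoC (INR k)))%C.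

(** (N-1)^{1-s} minus the first K + 1 terms of its binomial expansion in 1/N, in a
    form that shows its size N^{-s-K}. *)
Definition shift_defect (K n : nat) (s : C) : C :=
  (Series (fun k => fst (shift_term n (S K + k) s)),
   Series (fun k => snd (shift_term n (S K + k) s))).

Definition landau_tail (K : nat) (s : C) : C :=
  (Series (fun n => fst (shift_defect K n s)), Series (fun n => snd (shift_defect K n s))).

Definition defect_bound (A : R) (K : nat) : R :=
  Series (fun k => 2 * (rising_major A (S K + k) * (/ 2) ^ k)).

Lemma defect_bound_summable A K :
  0 < A -> ex_series (fun k => 2 * (rising_major A (S K + k) * (/ 2) ^ k)).
Proof.
  intros HA. apply (ex_series_scal (V := RN) 2).
  apply ex_series_ext with (fun k => 2 ^ S K * (rising_major A (S K + k) * (/ 2) ^ (S K + k))).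
  { intros k. rewrite pow_add, (pow_inv 2 (S K)).
    match goal with |- ?a = ?b => change (@eq R a b) end.
    field. apply (pow_nonzero 2 (S K)); lra. }
  apply (ex_series_scal (V := RN) (2 ^ S K)).
  apply (ex_series_incr_n (V := RN) (fun k => rising_major A k * (/ 2) ^ k) (S K)).
  apply rising_major_summable; lra.
Qed.

Lemma base_power_le (x : R) (K n k : nat) :
  x <= INR K - 1 ->
  exp (x * ln (base n)) / base n ^ (S K + k) <= (/ 2) ^ k * / base n ^ 2.
Proof.
  intros Hx. assert (Hb := base_ge2 n).
  assert (Hl : 0 < ln (base n)) by (rewrite <- ln_1; apply ln_increasing; lra).
  rewrite pow_add. unfold Rdiv. rewrite Rinv_mult.
  replace (exp (x * ln (base n)) * (/ base n ^ S K * / base n ^ k))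
    with (/ base n ^ k * (exp (x * ln (base n)) * / base n ^ S K)) by ring.
  assert (Hi : 0 < / base n ^ k) by (apply Rinv_0_lt_compat, pow_lt; lra).
  assert (Hj : 0 < / base n ^ S K) by (apply Rinv_0_lt_compat, pow_lt; lra).
  apply Rmult_le_compat; [lra| | |].
  - apply Rmult_le_pos; [left; apply exp_pos|lra].
  - rewrite pow_inv. apply Rinv_le_contravar; [apply pow_lt; lra|].
    apply pow_incr; lra.
  - rewrite <- !Rpower_pow by lra. unfold Rpower.
    rewrite <- !exp_Ropp, <- exp_plus.
    apply exp_le_mono. rewrite S_INR. simpl INR. nra.
Qed.

Lemma landau_tail_majorized K y s0 r A :
  0 <= r -> 2 <= s0 - r + INR K -> Rabs (s0 - 1) + r + Rabs y <= A -> 0 < A ->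
  exists M, Cmajorized (fun s => landau_tail K (s, y)) s0 r M.
Proof.
  intros Hr HK HA HA0.
  exists (Series (fun n => defect_bound A K * / base n ^ 2)).
  apply (Cmajorized_series (fun n s => shift_defect K n (s, y))); auto.
  2:{ apply (ex_series_scal (V := RN) (defect_bound A K)), inv_base_sq_summable. }
  intros n. assert (Hb := base_ge2 n).
  unfold defect_bound. rewrite <- Series_scal_r.
  apply (Cmajorized_series (fun k s => shift_term n (S K + k) (s, y))); auto.
  - intros k.
    apply Cmajorized_le with
      (rising_major A (S K + k) * (2 * exp ((1 - s0 + r) * ln (base n)) / base n ^ (S K + k))).
    + assert (H := base_power_le (1 - s0 + r) K n k ltac:(lra)).
      assert (H1 := rising_major_pos A (S K + k) HA0). unfold Rdiv in *.
      replace (2 * (rising_major A (S K + k) * (/ 2) ^ k) * / base n ^ 2)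
        with (rising_major A (S K + k) * (2 * ((/ 2) ^ k * / base n ^ 2))) by ring.
      apply Rmult_le_compat_l; lra.
    + apply Cmajorized_mult; auto.
      * now apply Cmajorized_rising_binom.
      * apply Cmajorized_cpower; lra.
  - apply ex_series_scal_r. now apply defect_bound_summable.
Qed.

Lemma shift_term_series n s :
  is_cseries (fun k => shift_term n k s) (cpower (base n - 1) (1 - s)%C).
Proof.
  assert (Hb := base_ge2 n).
  eapply is_cseries_eq; [eapply is_cseries_ext; [|apply (is_cseries_scal (cpower (base n) (1 - s)%C)),
    (complex_binomial_series s (/ base n))]|].
  - intros k; unfold shift_term. 
    change (1 - s - RtoC (INR k))%C with ((1 - s) + - RtoC (INR k))%C.
    rewrite cpower_add, cpower_opp_nat, pow_inv by lra. simpl; ring.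
  - split; [left; apply Rinv_0_lt_compat; lra|].
    rewrite <- Rinv_1. apply Rinv_lt_contravar; lra.
  - rewrite cpower_mult; [|lra|].
    + f_equal; field; lra.
    + assert (/ base n <= / 2) by (apply Rinv_le_contravar; lra). lra.
Qed.

Lemma shift_defect_succ n s K :
  shift_defect K n s = (shift_term n (S K) s + shift_defect (S K) n s)%C.
Proof.
  destruct (shift_term_series n s) as [H1 H2].
  unfold shift_defect. apply C_ext; cbn [fst snd Cplus].
  - rewrite Series_incr_1.
    + rewrite Nat.add_0_r. f_equal. apply Series_ext; intros k; do 2 f_equal; lia.
    + apply (proj1 (ex_series_incr_n (V := RN) (fun k => fst (shift_term n k s)) (S K))).
      eexists; eassumption.
  - rewrite Series_incr_1.
    + rewrite Nat.add_0_r. f_equal. apply Series_ext; intros k; do 2 f_equal; lia.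
    + apply (proj1 (ex_series_incr_n (V := RN) (fun k => snd (shift_term n k s)) (S K))).
      eexists; eassumption.
Qed.

Lemma shift_defect_0 n s :
  shift_defect 0 n s = (cpower (base n - 1) (1 - s) - cpower (base n) (1 - s))%C.
Proof.
  assert (E : shift_term n 0 s = cpower (base n) (1 - s)%C).
  { unfold shift_term; cbn [rising_binom INR]. rewrite Cmult_1_l; f_equal; ring. }
  destruct (shift_term_series n s) as [H1 H2].
  assert (G1 := is_series_unique _ _ H1). assert (G2 := is_series_unique _ _ H2).
  rewrite Series_incr_1 in G1 by (eexists; eassumption).
  rewrite Series_incr_1 in G2 by (eexists; eassumption).
  rewrite E in G1, G2. unfold shift_defect. cbn [plus Nat.add] in *.
  apply C_ext; cbn [fst snd Cplus Cminus Copp]; [rewrite <- G1|rewrite <- G2]; ring.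
Qed.

Section Landau.

Variable zeta : C -> C.
Hypothesis Hzeta : is_riemann_zeta zeta.

Lemma zeta_minus_one_series z :
  1 < Re z -> is_cseries (fun n => cpower (base n) (- z)%C) (zeta z - 1)%C.
Proof.
  intros Hz. destruct (is_cseries_of _ _ (proj1 Hzeta z Hz)) as [H1 H2].
  split.
  - apply is_series_ext with (fun n => fst (/ cpower (INR (S (S n))) z)%C).
    { intros n; unfold base; now rewrite cpower_inv. }
    apply (is_series_incr_1 (V := RN) (fun n => fst (/ cpower (INR (S n)) z)%C)).
    eapply is_series_eq; [exact H1|]. rewrite cpower_inv, cpower_1.
    unfold plus; simpl; ring.
  - apply is_series_ext with (fun n => snd (/ cpower (INR (S (S n))) z)%C).
    { intros n; unfold base; now rewrite cpower_inv. }
    apply (is_series_incr_1 (V := RN) (fun n => snd (/ cpower (INR (S n)) z)%C)).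
    eapply is_series_eq; [exact H2|]. rewrite cpower_inv, cpower_1.
    unfold plus; simpl; ring.
Qed.

(** The terms of order k <= K of the binomial expansion of (N-1)^{1-s} - N^{1-s},
    summed over N >= 2: the powers N^{1-s-k} sum to zeta (s+k-1) - 1. *)
Fixpoint landau_sum (K : nat) (s : C) : C :=
  match K with
  | O => 0%C
  | S K' => (landau_sum K' s + rising_binom (S K') s * (zeta (s + RtoC (INR K')) - 1))%C
  end.

(** Passing from K to K + 1 moves one binomial term, summed over N, from the
    defect to zeta. *)
Lemma landau_series s K :
  1 < Re s -> is_cseries (fun n => shift_defect K n s) (1 - landau_sum K s)%C.
Proof.
  intros Hs; induction K as [|K IH].
  - assert (Hpart : forall n, sum_n (fun n => fst (shift_defect 0 n s)) n =
                1 - fst (cpower (base n) (1 - s)%C) /\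
              sum_n (fun n => snd (shift_defect 0 n s)) n = - snd (cpower (base n) (1 - s)%C)).
    { (* for K = 0 the defect is (N-1)^{1-s} - N^{1-s}, which telescopes to 1 *)
      assert (Hd : forall n, shift_defect 0 n s =
         (cpower (INR (S n)) (1 - s) - cpower (base n) (1 - s))%C).
      { intros n; rewrite shift_defect_0; unfold base; rewrite (S_INR (S n)).
        do 2 f_equal; ring. }
      induction n as [|n [IH1 IH2]].
      - rewrite !sum_O, !Hd. change (INR 1) with 1. rewrite cpower_1. simpl; split; ring.
      - rewrite !sum_Sn, IH1, IH2, !Hd. unfold base. cbn [fst snd Cminus Cplus Copp].
        unfold plus; simpl; split; ring. }
    assert (Hlim : is_lim_seq (fun n => Cmod (cpower (base n) (1 - s)%C)) 0).
    { apply is_lim_seq_ext with (fun n => exp ((1 - Re s) * ln (base n))).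
      { intros n; rewrite Cmod_cpower; reflexivity. }
      apply (is_lim_comp_seq exp _ m_infty 0).
      - apply is_lim_exp_m.
      - exists 0%nat; discriminate.
      - replace m_infty with (Rbar_mult (Finite (1 - Re s)) p_infty).
        + apply (is_lim_seq_scal_l _ (1 - Re s) p_infty).
          apply (is_lim_comp_seq ln _ p_infty p_infty).
          * apply is_lim_ln_p.
          * exists 0%nat; discriminate.
          * apply (is_lim_seq_incr_1 (fun n => INR (S n))), (is_lim_seq_incr_1 INR), is_lim_seq_INR.
        + simpl. destruct Rle_dec; [exfalso; lra|]. reflexivity. }
    assert (H0 : forall g : C -> R, (forall z, Rabs (g z) <= Cmod z) ->
        is_lim_seq (fun n => g (cpower (base n) (1 - s)%C)) 0).
    { intros g Hg. apply is_lim_seq_abs_0.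
      apply (is_lim_seq_le_le (fun _ => 0) _ (fun n => Cmod (cpower (base n) (1 - s)%C))); auto.
      - intros n; split; [apply Rabs_pos|apply Hg].
      - apply is_lim_seq_const. }
    split.
    + apply (is_lim_seq_ext (fun n => 1 - fst (cpower (base n) (1 - s)%C)) _
        (Finite (fst (1 - landau_sum 0 s)%C))).
      { intros n; symmetry; apply Hpart. }
      replace (fst (1 - landau_sum 0 s)%C) with (1 - 0) by (simpl; ring).
      apply is_lim_seq_minus'; [apply is_lim_seq_const|exact (H0 fst Rabs_fst_le)].
    + apply (is_lim_seq_ext (fun n => - snd (cpower (base n) (1 - s)%C)) _
        (Finite (snd (1 - landau_sum 0 s)%C))).
      { intros n; symmetry; apply Hpart. }
      replace (Finite (snd (1 - landau_sum 0 s)%C)) with (Rbar_opp (Finite 0))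
        by (simpl; f_equal; ring).
      apply -> is_lim_seq_opp. exact (H0 snd Rabs_snd_le).
  - assert (HK := pos_INR K).
    assert (Hz : 1 < Re (s + RtoC (INR K))%C) by (simpl; unfold Re in Hs; lra).
    eapply is_cseries_eq.
    + eapply is_cseries_ext; [|apply (is_cseries_plus _ _ _ _ IH
        (is_cseries_scal (- rising_binom (S K) s)%C _ _ (zeta_minus_one_series _ Hz)))].
      intros n; cbn beta. rewrite (shift_defect_succ n s K).
      unfold shift_term. rewrite S_INR, RtoC_plus.
      replace (1 - s - (RtoC (INR K) + RtoC 1))%C with (- (s + RtoC (INR K)))%C by ring.
      ring.
    + cbn [landau_sum]. ring.
Qed.

Lemma landau_identity_right s K :
  1 < Re s -> (landau_sum K s + landau_tail K s = 1)%C.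
Proof.
  intros Hs. destruct (landau_series s K Hs) as [H1 H2].
  assert (E : landau_tail K s = (1 - landau_sum K s)%C).
  { apply C_ext; cbn [fst snd landau_tail]; now apply is_series_unique. }
  rewrite E; ring.
Qed.

(** The restriction of a complex power series to the line z0 + h d has the real
    coefficients Re (d^k a_k) and Im (d^k a_k). *)
Lemma analytic_at_line (f : C -> C) (z0 d : C) :
  Rabs (fst d) <= 1 -> Rabs (snd d) <= 1 -> analytic_at f z0 ->
  analytic_real_at (fun h => fst (f (z0 + RtoC h * d)%C)) 0 /\
  analytic_real_at (fun h => snd (f (z0 + RtoC h * d)%C)) 0.
Proof.
  intros Hd1 Hd2 [a [eps Ha]].
  assert (Heps := cond_pos eps). set (r := eps / 2).
  assert (Hs : forall h, Rabs h <= r ->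
     is_cseries (fun k => (RtoC (h ^ k) * (d ^ k * a k))%C) (f (z0 + RtoC h * d)%C)).
  { intros h Hh. eapply is_cseries_ext; [|apply is_cseries_of, Ha].
    - intros k.
      replace (z0 + RtoC h * d - z0)%C with (RtoC h * d)%C by ring.
      assert (E : forall k, pow_n (K := C_AbsRing) (RtoC h * d)%C k = (RtoC (h ^ k) * d ^ k)%C).
      { clear k; induction k as [|k IH]; [simpl; apply C_ext; simpl; ring|].
        cbn [pow_n]. rewrite IH. unfold mult; simpl. rewrite RtoC_mult. ring. }
      rewrite E. unfold scal; simpl; unfold mult; simpl. ring.
    - unfold ball; simpl; unfold prod_ball; simpl. unfold ball; simpl; unfold AbsRing_ball, abs, minus, plus, opp; simpl.
      assert (H1 : forall u, Rabs u <= 1 -> Rabs (h * u) < eps).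
      { intros u Hu; rewrite Rabs_mult. unfold r in Hh.
        assert (Hp := Rabs_pos h). assert (Hq := Rabs_pos u).
        assert (Rabs h * Rabs u <= eps / 2 * 1) by (apply Rmult_le_compat; lra). lra. }
      destruct z0 as [x0 y0], d as [d1 d2]; simpl in *. split.
      + replace (x0 + (h * d1 - 0 * d2) + - x0) with (h * d1) by ring. now apply H1.
      + replace (y0 + (h * d2 + 0 * d1) + - y0) with (h * d2) by ring. now apply H1. }
  assert (Hr : 0 < r) by (unfold r; lra).
  assert (Main : forall (c : nat -> R) (F : R -> R),
     (forall h, Rabs h <= r -> is_series (fun k => c k * h ^ k) (F h)) ->
     analytic_real_at F 0).
  { intros c F HF. exists (r / 2). eexists; split; [lra|]. exists c.
    split; [|split; [apply Rle_refl|]].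
    - apply pow_series_abs_conv; auto. eexists; apply HF. rewrite Rabs_pos_eq; lra.
    - intros h Hh. rewrite Rplus_0_l. apply HF. lra. }
  split.
  - apply (Main (fun k => fst (d ^ k * a k)%C)). intros h Hh.
    eapply is_series_ext; [|apply (proj1 (Hs h Hh))]. intros k; simpl; ring.
  - apply (Main (fun k => snd (d ^ k * a k)%C)). intros h Hh.
    eapply is_series_ext; [|apply (proj2 (Hs h Hh))]. intros k; simpl; ring.
Qed.

Definition analytic_C_at (f : R -> C) (c : R) : Prop :=
  analytic_real_at (fun s => fst (f s)) c /\ analytic_real_at (fun s => snd (f s)) c.

Lemma analytic_C_mult f g c :
  analytic_C_at f c -> analytic_C_at g c -> analytic_C_at (fun s => (f s * g s)%C) c.
Proof.
  intros [H1 H2] [H3 H4]; split; cbn [fst snd Cmult].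
  - apply (analytic_real_plus (fun s => fst (f s) * fst (g s)) (fun s => - (snd (f s) * snd (g s)))).
    + now apply analytic_real_mult.
    + now apply analytic_real_opp, analytic_real_mult.
  - apply (analytic_real_plus (fun s => fst (f s) * snd (g s)) (fun s => snd (f s) * fst (g s)));
      now apply analytic_real_mult.
Qed.

Lemma analytic_C_plus f g c :
  analytic_C_at f c -> analytic_C_at g c -> analytic_C_at (fun s => (f s + g s)%C) c.
Proof. intros [H1 H2] [H3 H4]; split; cbn [fst snd Cplus]; now apply analytic_real_plus. Qed.

Lemma analytic_C_const a c : analytic_C_at (fun s => a) c.
Proof. split; apply analytic_real_const. Qed.

Lemma analytic_C_of_majorized f c r M : 0 < r -> Cmajorized f c r M -> analytic_C_at f c.
Proof. intros Hr [M1 [M2 [H1 [H2 _]]]]; split; [exists r, M1|exists r, M2]; auto. Qed.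

Lemma zeta_analytic_horizontal y k c :
  y <> 0 -> analytic_C_at (fun s => zeta ((s, y) + RtoC (INR k))%C) c.
Proof.
  intros Hy.
  assert (Hz : ((c, y) + RtoC (INR k))%C <> RtoC 1).
  { intros E; apply (f_equal snd) in E; simpl in E; lra. }
  destruct (analytic_at_line zeta _ 1%C ltac:(simpl; rewrite Rabs_R1; lra)
     ltac:(simpl; rewrite Rabs_R0; lra) (proj2 Hzeta _ Hz)) as [H1 H2].
  split; [eapply analytic_real_translate; [|exact H1]|eapply analytic_real_translate; [|exact H2]];
    intros h; simpl; do 2 f_equal; apply C_ext; simpl; ring.
Qed.

Lemma landau_sum_analytic y K c :
  y <> 0 -> analytic_C_at (fun s => landau_sum K (s, y)) c.
Proof.
  intros Hy; induction K as [|K IH]; cbn [landau_sum]; [apply analytic_C_const|].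
  apply analytic_C_plus; auto. apply analytic_C_mult.
  - eapply (analytic_C_of_majorized _ c 1); [lra|].
    apply Cmajorized_rising_binom; [lra|apply Rle_refl].
  - apply (analytic_C_plus (fun s => zeta ((s, y) + RtoC (INR K))%C) (fun _ => (- (1))%C)).
    + now apply zeta_analytic_horizontal.
    + apply analytic_C_const.
Qed.

Lemma landau_tail_analytic y K c :
  2 - INR K < c -> analytic_C_at (fun s => landau_tail K (s, y)) c.
Proof.
  intros Hc. set (r := c + INR K - 2).
  assert (Hr : 0 < r) by (unfold r; lra).
  assert (H1 := Rabs_pos (c - 1)). assert (H2 := Rabs_pos y).
  destruct (landau_tail_majorized K y c r (Rabs (c - 1) + r + Rabs y)) as [M HM]; try lra.
  - unfold r; lra.
  - now apply (analytic_C_of_majorized _ c r M).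
Qed.

(** A horizontal line off the real axis meets no pole of zeta (s+k-1), so the
    identity extends from s > 1 to the left. *)
Lemma landau_identity K s y :
  y <> 0 -> 2 - INR K < s ->
  (landau_sum K (s, y) + landau_tail K (s, y) = 1)%C.
Proof.
  intros Hy Hs.
  assert (HD : forall c, 2 - INR K < c ->
     analytic_C_at (fun s => (landau_sum K (s, y) + landau_tail K (s, y) + - (1))%C) c).
  { intros c Hc. apply analytic_C_plus; [|apply analytic_C_const].
    apply analytic_C_plus; [now apply landau_sum_analytic|now apply landau_tail_analytic]. }
  assert (H0 : forall s, 1 < s -> (landau_sum K (s, y) + landau_tail K (s, y) + - (1))%C = 0%C).
  { intros t Ht. rewrite landau_identity_right by exact Ht. ring. }
  assert (E : (landau_sum K (s, y) + landau_tail K (s, y) + - (1))%C = 0%C).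
  { apply C_ext.
    - refine (analytic_continuation_left (fun s => fst (landau_sum K (s, y) + landau_tail K (s, y) + - (1))%C) (2 - INR K) 1 _ _ s Hs).
      + intros c Hc; apply (HD c Hc).
      + intros t Ht; cbn beta; now rewrite H0.
    - refine (analytic_continuation_left (fun s => snd (landau_sum K (s, y) + landau_tail K (s, y) + - (1))%C) (2 - INR K) 1 _ _ s Hs).
      + intros c Hc; apply (HD c Hc).
      + intros t Ht; cbn beta; now rewrite H0. }
  replace (landau_sum K (s, y) + landau_tail K (s, y))%C
    with (landau_sum K (s, y) + landau_tail K (s, y) + - (1) + 1)%C by ring.
  rewrite E; ring.
Qed.

End Landau.

(** * The values of zeta at the nonpositive integers *)

Definition Clim0 (f : R -> C) (l : C) : Prop :=
  is_lim (fun y => fst (f y)) 0 (fst l) /\ is_lim (fun y => snd (f y)) 0 (snd l).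

Lemma is_lim_mult0 f g a b :
  is_lim f 0 (Finite a) -> is_lim g 0 (Finite b) -> is_lim (fun y => f y * g y) 0 (a * b).
Proof.
  intros Hf Hg. apply (is_lim_mult f g 0 (Finite a) (Finite b)); auto. exact I.
Qed.

Lemma Clim0_mult f g a b :
  Clim0 f a -> Clim0 g b -> Clim0 (fun y => (f y * g y)%C) (a * b)%C.
Proof.
  intros [H1 H2] [H3 H4]; split; cbn [fst snd Cmult].
  - apply is_lim_minus'; now apply is_lim_mult0.
  - apply is_lim_plus'; now apply is_lim_mult0.
Qed.

Lemma Clim0_plus f g a b :
  Clim0 f a -> Clim0 g b -> Clim0 (fun y => (f y + g y)%C) (a + b)%C.
Proof.
  intros [H1 H2] [H3 H4]; split; cbn [fst snd Cplus]; now apply is_lim_plus'.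
Qed.

Lemma Clim0_const a : Clim0 (fun _ => a) a.
Proof. split; apply is_lim_const. Qed.

Lemma Clim0_ext f g a :
  (forall y, y <> 0 -> Rabs y < 1 -> f y = g y) -> Clim0 f a -> Clim0 g a.
Proof.
  intros E [H1 H2]; split; (eapply is_lim_ext_loc; [|eassumption]);
    (exists (mkposreal 1 Rlt_0_1); intros y Hy Hn; rewrite E; auto;
     apply ball_R in Hy; simpl in Hy; now rewrite Rminus_0_r in Hy).
Qed.

Lemma Clim0_unique f a b : Clim0 f a -> Clim0 f b -> a = b.
Proof.
  intros [H1 H2] [H3 H4].
  apply is_lim_unique in H1; apply is_lim_unique in H2.
  apply is_lim_unique in H3; apply is_lim_unique in H4.
  apply C_ext; [rewrite H1 in H3; now injection H3|rewrite H2 in H4; now injection H4].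
Qed.

Lemma Clim0_small f c :
  (forall y, y <> 0 -> Rabs y < 1 -> Rabs (fst (f y)) <= Rabs y * c /\ Rabs (snd (f y)) <= Rabs y * c) ->
  Clim0 f 0%C.
Proof.
  intros H.
  assert (Main : forall g, (forall y, y <> 0 -> Rabs y < 1 -> Rabs (g y) <= Rabs y * c) -> is_lim g 0 0).
  { intros g Hg.
    assert (Hid : is_lim (fun y => Rabs y * c) 0 0).
    { assert (Ha : is_lim Rabs 0 (Rabs 0)) by apply is_lim_continuity, Rcontinuity_abs.
      rewrite Rabs_R0 in Ha. assert (Hm := is_lim_mult0 _ _ _ _ Ha (is_lim_const c 0)).
      rewrite Rmult_0_l in Hm. exact Hm. }
    apply (is_lim_le_le_loc (fun y => - (Rabs y * c)) (fun y => Rabs y * c)).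
    - exists (mkposreal 1 Rlt_0_1); intros y Hy Hn. apply Rabs_le_between. apply Hg; auto.
      apply ball_R in Hy; simpl in Hy; now rewrite Rminus_0_r in Hy.
    - assert (Ho := is_lim_opp (fun y => Rabs y * c) 0 (Finite 0) Hid).
      simpl in Ho. rewrite Ropp_0 in Ho. exact Ho.
    - exact Hid. }
  split; simpl; apply Main; intros y Hy Hy1; now apply H.
Qed.

Lemma rising_binom_lim0 k s : Clim0 (fun y => rising_binom k (s, y)) (rising_binom k (s, 0)).
Proof.
  induction k as [|k IH]; cbn [rising_binom]; [apply Clim0_const|].
  apply Clim0_mult; auto. apply Clim0_mult; [|apply Clim0_const].
  apply Clim0_plus; [|apply Clim0_const]. apply Clim0_plus; [|apply Clim0_const].
  split; simpl; [apply is_lim_const|apply is_lim_id].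
Qed.

(** For s = 1 - e the power (1-w)^{1-s} is the polynomial (1-w)^e. *)
Lemma rising_binom_integer e k :
  (k <= e)%nat ->
  rising_binom k ((1 - INR e)%R, 0%R)
  = RtoC ((-1) ^ k * (INR (fact e) / (INR (fact k) * INR (fact (e - k))))).
Proof.
  induction k as [|k IH]; intros Hk.
  - rewrite Nat.sub_0_r. cbn [rising_binom pow fact INR]. apply C_ext; simpl; auto.
    field. apply INR_fact_neq_0.
  - cbn [rising_binom]. rewrite IH by lia.
    replace (e - k)%nat with (S (e - S k)) by lia.
    rewrite !fact_simpl, !mult_INR.
    assert (E : INR (S (e - S k)) = INR e - INR k).
    { replace (S (e - S k)) with (e - k)%nat by lia. apply minus_INR; lia. }
    assert (H1 : INR (S (e - S k)) <> 0) by (apply not_0_INR; lia).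
    assert (H2 : INR (S k) <> 0) by (apply not_0_INR; lia).
    assert (H3 := INR_fact_neq_0 k). assert (H4 := INR_fact_neq_0 (e - S k)).
    rewrite E in *.
    apply C_ext; cbn [fst snd Cmult Cplus Cminus Copp RtoC]; [|ring].
    cbn [pow]. field. repeat split; auto.
Qed.

(** For k > e the product contains the factor s - 1 + e = iy. *)
Lemma rising_binom_small e k y A :
  Rabs y <= 1 -> INR e + 1 <= A -> (e < k)%nat ->
  Cmod (rising_binom k ((1 - INR e)%R, y)) <= Rabs y * rising_major A k.
Proof.
  intros Hy HA Hk. assert (Hep := pos_INR e).
  assert (Hyp := Rabs_pos y).
  assert (Hs : Cmod (((1 - INR e)%R, y) - 1)%C <= A).
  { replace (((1 - INR e)%R, y) - 1)%C with (RtoC (- INR e) + RtoC y * Ci)%C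
      by (apply C_ext; simpl; ring).
    eapply Rle_trans; [apply Cmod_triangle|].
    rewrite Cmod_mult, !Cmod_R, Cmod_Ci, Rabs_Ropp, (Rabs_pos_eq (INR e)); lra. }
  induction k as [|k IH]; [lia|].
  cbn [rising_binom rising_major]. rewrite !Cmod_mult.
  assert (H2 := lt_0_INR (S k) ltac:(lia)).
  assert (H4 : 0 < / INR (S k)) by now apply Rinv_0_lt_compat.
  assert (Hkp := pos_INR k).
  rewrite !Cmod_R, (Rabs_pos_eq (/ _)) by lra.
  destruct (Nat.eq_dec e k) as [<-|Hne].
  - assert (Hb := rising_binom_le ((1 - INR e)%R, y) A e Hs).
    replace ((((1 - INR e)%R, y) - 1 + RtoC (INR e))%C) with (RtoC y * Ci)%C
      by (apply C_ext; simpl; ring).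
    rewrite Cmod_mult, Cmod_R, Cmod_Ci, Rmult_1_r.
    replace (Rabs y * (rising_major A e * ((A + INR e) * / INR (S e))))
      with (rising_major A e * ((Rabs y * (A + INR e)) * / INR (S e))) by ring.
    apply Rmult_le_compat; auto using Cmod_ge_0.
    + apply Rmult_le_pos; lra.
    + apply Rmult_le_compat_r; [lra|].
      rewrite <- (Rmult_1_r (Rabs y)) at 1. apply Rmult_le_compat_l; lra.
  - specialize (IH ltac:(lia)). rewrite <- (Rmult_assoc (Rabs y)).
    apply Rmult_le_compat; auto using Cmod_ge_0.
    + apply Rmult_le_pos; [apply Cmod_ge_0|lra].
    + apply Rmult_le_compat_r; [lra|].
      eapply Rle_trans; [apply Cmod_triangle|]. rewrite Cmod_R, (Rabs_pos_eq (INR k)); lra.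
Qed.

Lemma landau_tail_lim0 e :
  Clim0 (fun y => landau_tail (S (S e)) ((1 - INR e)%R, y)) 0%C.
Proof.
  set (A := INR e + 1). assert (HA : 0 < A) by (unfold A; assert (H := pos_INR e); lra).
  set (K := S (S e)).
  apply Clim0_small with (Series (fun n => defect_bound A K * / base n ^ 2)).
  intros y Hy Hy1. assert (Hyp := Rabs_pos y).
  assert (Hterm : forall n k, Cmod (shift_term n (S K + k) ((1 - INR e)%R, y)) <=
     Rabs y * (2 * (rising_major A (S K + k) * (/ 2) ^ k) * / base n ^ 2)).
  { intros n k. unfold shift_term. rewrite Cmod_mult, Cmod_cpower.
    assert (H1 := rising_binom_small e (S K + k) y A ltac:(lra) ltac:(unfold A; lra) ltac:(unfold K; lia)).
    assert (H2 := base_power_le (INR e) K n k).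
    assert (Hb := base_ge2 n). assert (Hbp : 0 < base n ^ (S K + k)) by (apply pow_lt; lra).
    assert (H3 := rising_major_pos A (S K + k) HA).
    replace (exp (Re (1 - ((1 - INR e)%R, y) - RtoC (INR (S K + k)))%C * ln (base n)))
      with (exp (INR e * ln (base n)) / base n ^ (S K + k)).
    - assert (Hx : INR e <= INR K - 1) by (unfold K; rewrite !S_INR; lra).
      specialize (H2 Hx).
      set (X := exp (INR e * ln (base n)) / base n ^ (S K + k)) in *.
      assert (HX : 0 <= X) by (unfold X; apply Rlt_le, Rdiv_lt_0_compat; [apply exp_pos|lra]).
      apply Rle_trans with (Rabs y * rising_major A (S K + k) * ((/ 2) ^ k * / base n ^ 2)).
      + apply Rmult_le_compat; auto using Cmod_ge_0.
      + assert (0 <= Rabs y * rising_major A (S K + k) * ((/ 2) ^ k * / base n ^ 2)); [|lra].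
        apply Rmult_le_pos; [apply Rmult_le_pos; lra|].
        apply Rmult_le_pos; [apply pow_le; lra|left; apply Rinv_0_lt_compat, pow_lt; lra].
    - rewrite <- Rpower_pow by lra. unfold Rpower, Rdiv. rewrite <- exp_Ropp, <- exp_plus.
      f_equal. unfold Re; cbn [fst snd Cplus Cminus Copp RtoC]. ring. }
  assert (Hser := defect_bound_summable A K HA).
  assert (Hdef : forall n, Rabs (fst (shift_defect K n ((1 - INR e)%R, y))) <= Rabs y * (defect_bound A K * / base n ^ 2)
      /\ Rabs (snd (shift_defect K n ((1 - INR e)%R, y))) <= Rabs y * (defect_bound A K * / base n ^ 2)).
  { intros n. unfold shift_defect, defect_bound; cbn [fst snd].
    rewrite <- Series_scal_r, <- Series_scal_l.
    assert (He : ex_series (fun k => Rabs y * (2 * (rising_major A (S K + k) * (/ 2) ^ k) * / base n ^ 2))).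
    { apply (ex_series_scal (V := RN) (Rabs y)). apply ex_series_scal_r. exact Hser. }
    split; apply Series_abs_le; auto; intros k; (eapply Rle_trans; [|apply Hterm]);
      [apply Rabs_fst_le|apply Rabs_snd_le]. }
  rewrite <- Series_scal_l.
  assert (He : ex_series (fun n => Rabs y * (defect_bound A K * / base n ^ 2))).
  { apply (ex_series_scal (V := RN) (Rabs y)).
    apply (ex_series_scal (V := RN) (defect_bound A K)), inv_base_sq_summable. }
  split; unfold landau_tail; cbn [fst snd]; apply Series_abs_le; auto; intros n; apply Hdef.
Qed.

Section Recursion.

Variable zeta : C -> C.
Hypothesis Hzeta : is_riemann_zeta zeta.

Lemma zeta_lim0 x : x <> 1 -> Clim0 (fun y => zeta (x, y)) (zeta (RtoC x)).
Proof.
  intros Hx.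
  assert (Hz : RtoC x <> RtoC 1) by (intros E; apply Hx; now injection E).
  destruct (analytic_at_line zeta _ Ci ltac:(simpl; rewrite Rabs_R0; lra)
     ltac:(simpl; rewrite Rabs_R1; lra) (proj2 Hzeta _ Hz)) as [H1 H2].
  apply analytic_real_lim in H1. apply analytic_real_lim in H2.
  assert (E : forall h, (RtoC x + RtoC (0 + h) * Ci)%C = (x, h)).
  { intros h; apply C_ext; simpl; ring. }
  assert (E0 : (RtoC x + RtoC 0 * Ci)%C = RtoC x).
  { apply C_ext; simpl; ring. }
  rewrite E0 in *.
  split; (eapply is_lim_ext; [|eassumption]); intros h; cbn beta; now rewrite E.
Qed.

Lemma landau_sum_lim0 e K :
  (K <= e)%nat ->
  Clim0 (fun y => landau_sum zeta K ((1 - INR e)%R, y)) (landau_sum zeta K ((1 - INR e)%R, 0%R)).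
Proof.
  induction K as [|K IH]; intros HK; cbn [landau_sum]; [apply Clim0_const|].
  apply Clim0_plus; [apply IH; lia|].
  apply Clim0_mult; [apply rising_binom_lim0|].
  apply Clim0_plus; [|apply Clim0_const].
  assert (HKe := le_INR _ _ HK). rewrite S_INR in HKe.
  eapply Clim0_ext; [|replace (((1 - INR e)%R, 0%R) + RtoC (INR K))%C with (RtoC (1 - INR e + INR K));
    [apply zeta_lim0|]].
  - intros y _ _; cbn beta. f_equal. apply C_ext; simpl; ring.
  - lra.
  - apply C_ext; simpl; ring.
Qed.

(** For s = 1 - e + iy the term k = e + 1 is singular as y -> 0: it contains
    zeta (1+iy), multiplied by the factor iy of the binomial coefficient. *)
Lemma landau_sum_split e y :
  landau_sum zeta (S (S e)) ((1 - INR e)%R, y) =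
  (landau_sum zeta e ((1 - INR e)%R, y)
   + rising_binom e ((1 - INR e)%R, y) * RtoC (/ INR (S e)) * (RtoC y * Ci * (zeta (1%R, y) - 1))
   + rising_binom (S (S e)) ((1 - INR e)%R, y) * (zeta (2%R, y) - 1))%C.
Proof.
  cbn [landau_sum].
  replace (((1 - INR e)%R, y) + RtoC (INR (S e)))%C with ((2%R, y) : C)
    by (rewrite S_INR; apply C_ext; simpl; ring).
  replace (((1 - INR e)%R, y) + RtoC (INR e))%C with ((1%R, y) : C)
    by (apply C_ext; simpl; ring).
  f_equal. f_equal.
  change (rising_binom (S e) ((1 - INR e)%R, y)) with
   (rising_binom e ((1 - INR e)%R, y) * ((((1 - INR e)%R, y) - 1 + RtoC (INR e)) * RtoC (/ INR (S e))))%C.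
  replace (((1 - INR e)%R, y) - 1 + RtoC (INR e))%C with (RtoC y * Ci)%C
    by (apply C_ext; simpl; ring).
  ring.
Qed.

Lemma rising_binom_large_lim0 e : 
  Clim0 (fun y => rising_binom (S (S e)) ((1 - INR e)%R, y)) 0%C.
Proof.
  apply Clim0_small with (rising_major (INR e + 1) (S (S e))).
  intros y Hy Hy1.
  assert (H := rising_binom_small e (S (S e)) y (INR e + 1) ltac:(lra) ltac:(lra) ltac:(lia)).
  split; (eapply Rle_trans; [|exact H]); [apply Rabs_fst_le|apply Rabs_snd_le].
Qed.

Lemma landau_sum_last_lim0 e :
  Clim0 (fun y => (rising_binom (S (S e)) ((1 - INR e)%R, y) * (zeta (2%R, y) - 1))%C) 0%C.
Proof.
  replace (RtoC 0) with (0 * (zeta (RtoC 2) - 1))%C by ring.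
  apply Clim0_mult; [apply rising_binom_large_lim0|].
  apply Clim0_plus; [apply zeta_lim0; lra|apply Clim0_const].
Qed.

Lemma landau_identity_at e y : y <> 0 ->
  (landau_sum zeta (S (S e)) ((1 - INR e)%R, y) + landau_tail (S (S e)) ((1 - INR e)%R, y) = 1)%C.
Proof. intros Hy; apply landau_identity; auto. rewrite !S_INR; lra. Qed.

(** The residue of zeta at 1 comes out of Landau's identity itself, at e = 0. *)
Lemma zeta_pole : Clim0 (fun y => (RtoC y * Ci * (zeta (1%R, y) - 1))%C) 1%C.
Proof.
  assert (H := landau_tail_lim0 0). assert (H2 := landau_sum_last_lim0 0).
  assert (Hs := Clim0_plus _ _ _ _ (Clim0_const 1%C)
    (Clim0_mult _ _ _ _ (Clim0_const (- (1))%C) (Clim0_plus _ _ _ _ H H2))).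
  replace (1 + - (1) * (0 + 0))%C with (RtoC 1) in Hs by ring.
  eapply Clim0_ext; [|exact Hs].
  intros y Hy _. cbn beta.
  assert (E := landau_identity_at 0 y Hy). rewrite landau_sum_split in E.
  change (rising_binom 0 ((1 - INR 0)%R, y)) with (RtoC 1) in E.
  change (landau_sum zeta 0 ((1 - INR 0)%R, y)) with (RtoC 0) in E.
  change (INR 1) with 1 in E. rewrite Rinv_1 in E.
  set (X := (RtoC y * Ci * (zeta (1%R, y) - 1))%C) in *.
  set (P := (rising_binom 2 ((1 - INR 0)%R, y) * (zeta (2%R, y) - 1))%C) in *.
  set (T := landau_tail 2 ((1 - INR 0)%R, y)) in *.
  transitivity ((0 + 1 * 1 * X + P + T) - P - T)%C; [rewrite E; ring|ring].
Qed.

(** Landau's identity with K = e + 2 in the limit y -> 0: the term k = e + 1 leaves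
    the residue, the later ones vanish. *)
Lemma zeta_recursion_complex e :
  (landau_sum zeta e ((1 - INR e)%R, 0%R) + RtoC ((-1) ^ e / INR (S e)) = 1)%C.
Proof.
  assert (H1 := landau_tail_lim0 e). assert (H2 := landau_sum_last_lim0 e).
  assert (H3 := landau_sum_lim0 e e (Nat.le_refl e)).
  assert (H4 := Clim0_mult _ _ _ _ (Clim0_mult _ _ _ _ (rising_binom_lim0 e (1 - INR e))
     (Clim0_const (RtoC (/ INR (S e))))) zeta_pole).
  assert (Hs := Clim0_plus _ _ _ _ (Clim0_plus _ _ _ _ (Clim0_plus _ _ _ _ H3 H4) H2) H1).
  assert (Hc : Clim0 (fun _ => 1%C) (landau_sum zeta e ((1 - INR e)%R, 0%R) +
        rising_binom e ((1 - INR e)%R, 0%R) * RtoC (/ INR (S e)) * 1 + 0 + 0)%C).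
  { eapply Clim0_ext; [|exact Hs]. intros y Hy _; cbn beta.
    rewrite <- landau_sum_split. now apply landau_identity_at. }
  rewrite (Clim0_unique _ _ _ (Clim0_const 1%C) Hc).
  rewrite rising_binom_integer by lia. rewrite Nat.sub_diag.
  replace (INR (fact e) / (INR (fact e) * INR (fact 0))) with 1
    by (simpl; field; apply INR_fact_neq_0).
  unfold Rdiv. rewrite !RtoC_mult. ring.
Qed.

Definition zeta_at_neg (j : nat) : R := Re (zeta (RtoC (- INR j))).

Lemma landau_sum_integer e K :
  (K <= e)%nat ->
  Re (landau_sum zeta K ((1 - INR e)%R, 0%R)) =
  sum_n (fun k => (-1) ^ k * (INR (fact e) / (INR (fact k) * INR (fact (e - k))))
     * match k with O => 0 | _ => zeta_at_neg (e - k) - 1 end) K.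
Proof.
  induction K as [|K IH]; intros HK.
  - rewrite sum_O. simpl. ring.
  - rewrite sum_Sn, <- IH by lia. cbn [landau_sum]. 
    rewrite rising_binom_integer by lia.
    unfold zeta_at_neg.
    replace (((1 - INR e)%R, 0%R) + RtoC (INR K))%C with (RtoC (- INR (e - S K))).
    2:{ rewrite minus_INR, S_INR by lia. apply C_ext; simpl; ring. }
    unfold Re, plus; cbn [fst snd Cplus Cmult Cminus Copp RtoC AbelianMonoid.plus]; simpl.
    ring.
Qed.

Lemma alternating_binomial_sum e :
  (0 < e)%nat ->
  sum_n (fun k => (-1) ^ k * (INR (fact e) / (INR (fact k) * INR (fact (e - k))))) e = 0.
Proof.
  intros He. rewrite sum_n_Reals.
  assert (H := binomial (-1) 1 e).
  replace (-1 + 1) with 0 in H by ring. rewrite pow_i in H by lia.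
  rewrite H at 1. apply sum_eq. intros i Hi. unfold Binomial.C. rewrite pow1.
  ring.
Qed.

(** The coefficients of Euler-Maclaurin summation.  Index 0 belongs to the
    integral, which is minus the value at 0 of the primitive vanishing at
    infinity. *)
Definition em_coef (z : nat -> R) (i : nat) : R :=
  match i with O => -1 | S j => z j / INR (fact j) end.

Lemma sum_n_first (u : nat -> R) p : sum_n u (S p) = u 0%nat + sum_n (fun k => u (S k)) p.
Proof.
  induction p as [|p IH]; [now rewrite sum_Sn, !sum_O|].
  rewrite sum_Sn, IH, (sum_Sn (fun k => u (S k))). unfold plus; simpl; ring.
Qed.

(** What telescoping H(mt) - H((m+1)t) imposes on the coefficients of
    Euler-Maclaurin summation, order by order in t; p = 0 is the normalization. *)
Definition em_recursion (b : nat -> R) : Prop :=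
  forall p, sum_n (fun k => (-1) ^ S k / INR (fact (S k)) * b (p - k)%nat) p
            = match p with O => 1 | _ => 0 end.

Lemma em_coef_recursion : em_recursion (em_coef zeta_at_neg).
Proof.
  intros [|p].
  { rewrite sum_O. simpl. field. }
  assert (H := f_equal Re (zeta_recursion_complex (S p))).
  assert (HRe : forall a b : C, Re (a + b)%C = Re a + Re b) by reflexivity.
  rewrite HRe in H. rewrite landau_sum_integer in H by lia.
  assert (Ha := alternating_binomial_sum (S p) ltac:(lia)).
  assert (Hfe := INR_fact_neq_0 (S p)).
  change (Re (RtoC ((-1) ^ S p / INR (S (S p))))) with ((-1) ^ S p / INR (S (S p))) in H.
  change (Re (RtoC 1)) with 1 in H.
  rewrite sum_n_first in H, Ha. rewrite sum_Sn.
  set (X := sum_n _ p). set (Y := sum_n _ p) in H. set (Z := sum_n _ p) in Ha.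
  assert (E : Y = INR (fact (S p)) * X - Z).
  { unfold X, Y, Z.
    assert (Hsum : forall n, (n <= p)%nat -> forall u v w : nat -> R, forall c,
       (forall k, (k <= n)%nat -> w k = c * u k - v k) ->
       sum_n w n = c * sum_n u n - sum_n v n).
    { induction n as [|n IHn]; intros Hn u v w c Hw; [rewrite !sum_O; apply Hw; lia|].
      rewrite !sum_Sn, (IHn ltac:(lia) u v w c), Hw by (try lia; intros; apply Hw; lia).
      unfold plus; simpl; ring. }
    apply Hsum; auto. intros k Hk.
    replace (S p - k)%nat with (S (S p - S k)) by lia.
    cbn [em_coef]. field. repeat split; apply INR_fact_neq_0. }
  rewrite E in H. clearbody X Y Z. clear E HRe.
  rewrite Nat.sub_diag. cbn [em_coef].
  rewrite Nat.sub_0_r in Ha, H. change (fact 0) with 1%nat in Ha, H. change (INR 1) with 1 in Ha, H.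
  rewrite (fact_simpl (S p)), mult_INR.
  assert (H2 : INR (S (S p)) <> 0) by (apply not_0_INR; lia).
  rewrite Rmult_1_l in Ha, H.
  change ((-1) ^ 0) with 1 in Ha, H. 
  replace (INR (fact (S p)) / (1 * INR (fact (S p)))) with 1 in Ha, H by (field; auto).
  change ((-1) ^ S (S p)) with (-1 * (-1) ^ S p).
  unfold plus; cbn -[pow fact INR].
  apply (Rmult_eq_reg_l (INR (fact (S p)))); auto.
  set (t := (-1) ^ S p) in *.
  replace (INR (fact (S p)) * (X + -1 * t / (INR (S (S p)) * INR (fact (S p))) * -1))
    with (INR (fact (S p)) * X + t / INR (S (S p))) by (field; auto).
  lra.
Qed.

End Recursion.

(** * Remainders of order t^K and finite sums *)

Definition bigO (K : nat) (F : R -> R) : Prop :=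
  exists c, forall t, 0 < t <= 1 -> Rabs (F t) <= c * t ^ K.

Fixpoint psum (u : nat -> R) (K : nat) : R :=
  match K with O => 0 | S K' => psum u K' + u K' end.

Lemma psum_sum_n u K : psum u (S K) = sum_n u K.
Proof.
  induction K as [|K IH]; [rewrite sum_O; simpl; ring|].
  rewrite sum_Sn, <- IH; reflexivity.
Qed.

Lemma psum_ext u v K : (forall k, (k < K)%nat -> u k = v k) -> psum u K = psum v K.
Proof.
  induction K as [|K IH]; intros H; simpl; auto.
  rewrite IH by (intros; apply H; lia). now rewrite H by lia.
Qed.

Lemma psum_first u K : psum u (S K) = u 0%nat + psum (fun k => u (S k)) K.
Proof. induction K as [|K IH]; [simpl; ring|]. cbn [psum] in *. rewrite IH; ring. Qed.

Lemma psum_plus u v K : psum (fun k => u k + v k) K = psum u K + psum v K.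
Proof. induction K as [|K IH]; simpl; [ring|rewrite IH; ring]. Qed.

Lemma psum_scal c u K : psum (fun k => c * u k) K = c * psum u K.
Proof. induction K as [|K IH]; simpl; [ring|rewrite IH; ring]. Qed.

Lemma psum_triangle (f : nat -> nat -> R) K :
  psum (fun j => psum (f j) (K - j)) K = psum (fun q => psum (fun j => f j (q - j)%nat) (S q)) K.
Proof.
  induction K as [|K IH]; [reflexivity|].
  change (psum (fun q => psum (fun j => f j (q - j)%nat) (S q)) (S K)) with
    (psum (fun q => psum (fun j => f j (q - j)%nat) (S q)) K + psum (fun j => f j (K - j)%nat) (S K)).
  rewrite <- IH.
  assert (E : psum (fun j => psum (f j) (S K - j)) (S K)
     = psum (fun j => psum (f j) (K - j) + f j (K - j)%nat) (S K)).
  { apply psum_ext; intros k Hk. replace (S K - k)%nat with (S (K - k)) by lia. reflexivity. }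
  rewrite E, psum_plus. f_equal.
  cbn [psum]. rewrite Nat.sub_diag. simpl; ring.
Qed.

Lemma bigO_ext K F G : (forall t, 0 < t <= 1 -> F t = G t) -> bigO K F -> bigO K G.
Proof. intros E [c H]; exists c; intros t Ht; rewrite <- E; auto. Qed.

Lemma bigO_plus K F G : bigO K F -> bigO K G -> bigO K (fun t => F t + G t).
Proof.
  intros [c H] [d H']; exists (c + d); intros t Ht.
  eapply Rle_trans; [apply Rabs_triang|]. specialize (H t Ht); specialize (H' t Ht); lra.
Qed.

Lemma bigO_scal K a F : bigO K F -> bigO K (fun t => a * F t).
Proof.
  intros [c H]; exists (Rabs a * c); intros t Ht.
  rewrite Rabs_mult, Rmult_assoc. apply Rmult_le_compat_l; [apply Rabs_pos|auto].
Qed.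

Lemma bigO_pow K j F : bigO K F -> bigO (j + K) (fun t => t ^ j * F t).
Proof.
  intros [c H]; exists c; intros t Ht.
  assert (Hp : 0 <= t ^ j) by (apply pow_le; lra).
  rewrite Rabs_mult, (Rabs_pos_eq (t ^ j)), pow_add by auto.
  specialize (H t Ht). 
  replace (c * (t ^ j * t ^ K)) with (t ^ j * (c * t ^ K)) by ring.
  apply Rmult_le_compat_l; auto.
Qed.

Lemma bigO_psum K (F : nat -> R -> R) n :
  (forall j, (j < n)%nat -> bigO K (F j)) -> bigO K (fun t => psum (fun j => F j t) n).
Proof.
  induction n as [|n IH]; intros H; simpl.
  - exists 0; intros t Ht; rewrite Rabs_R0; lra.
  - apply bigO_plus; [apply IH; intros; apply H; lia|apply H; lia].
Qed.

Lemma bigO_weaken K K' F : (K' <= K)%nat -> bigO K F -> bigO K' F.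
Proof.
  intros HK [c H]; exists c; intros t Ht. specialize (H t Ht).
  assert (Hp : 0 < t ^ K) by (apply pow_lt; lra).
  assert (Hc : 0 <= c).
  { apply Rmult_le_reg_r with (t ^ K); auto. assert (H0 := Rabs_pos (F t)); lra. }
  eapply Rle_trans; [exact H|]. apply Rmult_le_compat_l; auto.
  replace K with (K' + (K - K'))%nat by lia. rewrite pow_add.
  rewrite <- (Rmult_1_r (t ^ K')) at 2. apply Rmult_le_compat_l; [apply pow_le; lra|].
  rewrite <- (pow1 (K - K')). apply pow_incr; lra.
Qed.

(** * Euler-Maclaurin summation on a half line *)

Lemma riemann_sum_bound (a : nat -> R) c t :
  0 < t -> (forall m, Rabs (a m) <= c * (t / (1 + INR (S m) * t) ^ 2)) ->
  ex_series a /\ Rabs (Series a) <= c.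
Proof.
  intros Ht Ha.
  (* t / (1 + (m+1)t)^2 is at most the m-th step of the telescoping sum of 1 / (1 + mt) *)
  set (b := fun m => / (1 + INR m * t) - / (1 + INR (S m) * t)).
  assert (Hpos : forall m, 0 < 1 + INR m * t).
  { intros m; assert (H := pos_INR m); nra. }
  assert (Hb : is_series b 1).
  { apply (is_lim_seq_ext (fun n => 1 - / (1 + INR (S n) * t)) _ (Finite 1)).
    - intros n; unfold b; induction n as [|n IH].
      + rewrite sum_O. simpl. rewrite Rmult_0_l, Rplus_0_r, Rinv_1. reflexivity.
      + rewrite sum_Sn, <- IH. unfold plus; cbn -[INR]. ring.
    - replace (Finite 1) with (Finite (1 - 0)) by (f_equal; ring).
      apply is_lim_seq_minus'; [apply is_lim_seq_const|].
      apply (is_lim_seq_inv (fun n => 1 + INR (S n) * t) p_infty); [|discriminate].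
      apply (is_lim_seq_incr_1 (fun n => 1 + INR n * t)).
      eapply is_lim_seq_plus; [apply is_lim_seq_const| |].
      + apply (is_lim_seq_scal_r INR t p_infty), is_lim_seq_INR.
      + simpl. destruct Rle_dec; [|exfalso; lra]. destruct Rle_lt_or_eq_dec; [|exfalso; lra].
        reflexivity. }
  assert (Hc : 0 <= c).
  { specialize (Ha 0%nat). assert (H0 := Rabs_pos (a 0%nat)).
    assert (H1 : 0 < t / (1 + INR 1 * t) ^ 2)
      by (apply Rdiv_lt_0_compat; [lra|apply pow_lt, (Hpos 1%nat)]).
    apply Rmult_le_reg_r with (t / (1 + INR 1 * t) ^ 2); lra. }
  assert (Hab : forall m, Rabs (a m) <= c * b m).
  { intros m; eapply Rle_trans; [apply Ha|]. apply Rmult_le_compat_l; auto.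
    unfold b. assert (H1 := Hpos m). assert (H2 := Hpos (S m)).
    rewrite S_INR in *. set (x := 1 + INR m * t) in *.
    replace (1 + (INR m + 1) * t) with (x + t) in * by (unfold x; ring).
    replace (/ x - / (x + t)) with (t * / (x * (x + t))) by (field; lra).
    unfold Rdiv. apply Rmult_le_compat_l; [lra|].
    apply Rinv_le_contravar; nra. }
  assert (Hcb := is_series_scal (V := RN) c _ _ Hb).
  split.
  - apply (ex_series_abs_le a (fun m => c * b m)); auto. eexists; exact Hcb.
  - eapply Rle_trans; [apply (Series_abs_le a (fun m => c * b m)); auto; eexists; exact Hcb|].
    right. transitivity (c * 1); [exact (is_series_unique _ _ Hcb)|ring].
Qed.

(** g 0 is a primitive, vanishing at infinity, of the function to be summed, and
    the g (n+2) are the derivatives of that function. *)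
Definition decaying_tower (g : nat -> R -> R) : Prop :=
  (forall n u, 0 <= u -> is_derive (g n) u (g (S n) u)) /\
  (forall n, exists c, forall u, 0 <= u -> Rabs (g (S n) u) <= c / (1 + u) ^ 2) /\
  is_lim (g 0%nat) p_infty 0.

Definition dilated_sum (f : R -> R) (t : R) : R := Series (fun m => t * f (INR (S m) * t)).

Lemma decay_const_nonneg (f : R -> R) c :
  (forall u, 0 <= u -> Rabs (f u) <= c / (1 + u) ^ 2) -> 0 <= c.
Proof.
  intros H. specialize (H 0 ltac:(lra)). assert (H0 := Rabs_pos (f 0)).
  replace (c / (1 + 0) ^ 2) with c in H by field. lra.
Qed.

Lemma decay_lim (f : R -> R) c :
  (forall u, 0 <= u -> Rabs (f u) <= c / (1 + u) ^ 2) -> is_lim f p_infty 0.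
Proof.
  intros H. assert (Hc := decay_const_nonneg f c H).
  apply is_lim_spec. intros eps. assert (He := cond_pos eps).
  exists (Rmax 0 (c / eps)). intros u Hu.
  assert (Hu0 : 0 < u) by (eapply Rle_lt_trans; [apply Rmax_l|exact Hu]).
  assert (Hu1 : c / eps < u) by (eapply Rle_lt_trans; [apply Rmax_r|exact Hu]).
  rewrite Rminus_0_r. eapply Rle_lt_trans; [apply H; lra|].
  apply Rmult_lt_reg_r with ((1 + u) ^ 2); [apply pow_lt; lra|].
  unfold Rdiv. rewrite Rmult_assoc, Rinv_l, Rmult_1_r by (apply pow_nonzero; lra).
  assert (c < u * eps).
  { apply Rmult_lt_reg_r with (/ eps); [now apply Rinv_0_lt_compat|].
    rewrite Rmult_assoc, Rinv_r, Rmult_1_r by lra. exact Hu1. }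
  nra.
Qed.

Lemma tower_lim g n : decaying_tower g -> is_lim (g n) p_infty 0.
Proof.
  intros [_ [H2 H3]]. destruct n as [|n]; auto.
  destruct (H2 n) as [c Hc]. now apply (decay_lim _ c).
Qed.

(** The derivative in h of the Taylor remainder of g n is minus that of g (n+1). *)
Lemma tower_taylor_backward (g : nat -> R -> R) :
  (forall n u, 0 <= u -> is_derive (g n) u (g (S n) u)) ->
  forall K n M u h, 0 <= h <= u ->
  (forall v, u - h <= v <= u -> Rabs (g (n + S K)%nat v) <= M) ->
  Rabs (g n (u - h) - psum (fun k => (- h) ^ k / INR (fact k) * g (n + k)%nat u) (S K)) <= M * h ^ S K.
Proof.
  intros Hg.
  assert (MV : forall (r r' : R -> R) h B, 0 <= h -> r 0 = 0 ->
     (forall s, 0 <= s <= h -> is_derive r s (r' s)) ->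
     (forall s, 0 <= s <= h -> Rabs (r' s) <= B) -> Rabs (r h) <= B * h).
  { intros r r' h B Hh H0 Hd HB.
    destruct (mean_value r r' 0 h Hh Hd) as [x [Hx E]].
    rewrite H0, !Rminus_0_r in E. rewrite E, Rabs_mult, (Rabs_pos_eq h) by lra.
    apply Rmult_le_compat_r; [lra|]. apply HB; lra. }
  assert (Hcomp : forall n u s, 0 <= u - s -> is_derive (fun s => g n (u - s)) s (- g (S n) (u - s))).
  { intros n u s Hs.
    replace (- g (S n) (u - s)) with (scal (-1) (g (S n) (u - s)))
      by (unfold scal; simpl; unfold mult; simpl; ring).
    apply (is_derive_comp (V := RN) (g n) (fun s => u - s)).
    - now apply Hg.
    - auto_derive; auto; ring. }
  induction K as [|K IH]; intros n M u h Hh HM.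
  - cbn [psum]. rewrite Nat.add_0_r.
    replace (g n (u - h) - (0 + (- h) ^ 0 / INR (fact 0) * g n u)) with (g n (u - h) - g n u)
      by (simpl; field).
    rewrite pow_1.
    apply (MV (fun s => g n (u - s) - g n u) (fun s => - g (S n) (u - s))); [lra| | |].
    + rewrite Rminus_0_r; ring.
    + intros s Hs. 
      replace (- g (S n) (u - s)) with (minus (- g (S n) (u - s)) 0)
        by (unfold minus, plus, opp; simpl; ring).
      apply (is_derive_minus (V := RN) (fun s => g n (u - s)) (fun _ => g n u)).
      * apply Hcomp; lra.
      * apply (is_derive_const (V := RN)).
    + intros s Hs. rewrite Rabs_Ropp. 
      replace (S n) with (n + 1)%nat by lia. apply HM; lra.
  - set (r := fun s => g n (u - s) - psum (fun k => (- s) ^ k / INR (fact k) * g (n + k)%nat u) (S (S K))).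
    set (r' := fun s => - (g (S n) (u - s) - psum (fun k => (- s) ^ k / INR (fact k) * g (S n + k)%nat u) (S K))).
    replace (M * h ^ S (S K)) with (M * h ^ S K * h) by (simpl; ring).
    apply (MV r r'); [lra| | |].
    + unfold r. rewrite psum_first. rewrite Nat.add_0_r, Rminus_0_r.
      rewrite (psum_ext _ (fun _ => 0 * 0)) by (intros k _; rewrite Ropp_0, pow_ne_zero by lia; unfold Rdiv; ring).
      rewrite psum_scal. simpl. field.
    + intros s Hs. unfold r, r'.
      assert (Hps : forall N, is_derive (fun s => psum (fun k => (- s) ^ S k / INR (fact (S k)) * g (n + S k)%nat u) N) s
          (- psum (fun k => (- s) ^ k / INR (fact k) * g (S n + k)%nat u) N)).
      { induction N as [|N IHN]; cbn [psum].
        - rewrite Ropp_0. apply (is_derive_const (V := RN)).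
        - rewrite Ropp_plus_distr. apply (is_derive_plus (V := RN)); auto.
          replace (n + S N)%nat with (S n + N)%nat by lia.
          rewrite fact_simpl, mult_INR.
          assert (H1 := INR_fact_neq_0 N). assert (H2 : INR (S N) <> 0) by (apply not_0_INR; lia).
          auto_derive; auto. cbn [pred]. unfold Rdiv.
          rewrite S_INR in *. simpl. field; split; auto. change (INR (S N) <> 0); now rewrite S_INR. }
      apply is_derive_ext with (fun s => g n (u - s) - (g n u + psum (fun k => (- s) ^ S k / INR (fact (S k)) * g (n + S k)%nat u) (S K))).
      { intros z. rewrite (psum_first _ (S K)). rewrite Nat.add_0_r. simpl pow at 2. 
        change (INR (fact 0)) with 1. rewrite Rdiv_1_r, Rmult_1_l. reflexivity. }
      match goal with |- is_derive _ _ (- (?a - ?b)) =>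
        replace (- (a - b)) with (minus (- a) (plus 0 (- b)))
         by (unfold minus, plus, opp; simpl; ring) end.
      apply (is_derive_minus (V := RN)).
      * apply Hcomp; lra.
      * apply (is_derive_plus (V := RN)); [apply (is_derive_const (V := RN))|apply Hps].
    + intros s Hs. unfold r'. rewrite Rabs_Ropp.
      eapply Rle_trans; [apply (IH (S n) M u s)|].
      * lra.
      * intros v Hv. replace (S n + S K)%nat with (n + S (S K))%nat by lia. apply HM; lra.
      * apply Rmult_le_compat_l; [|apply pow_incr; lra].
        eapply Rle_trans; [apply Rabs_pos|apply (HM u); lra].
Qed.

Lemma dilated_sum_bound (f : R -> R) c t :
  0 < t -> (forall u, 0 <= u -> Rabs (f u) <= c / (1 + u) ^ 2) ->
  ex_series (fun m => t * f (INR (S m) * t)) /\ Rabs (dilated_sum f t) <= c.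
Proof.
  intros Ht Hc. apply (riemann_sum_bound _ c t Ht).
  intros m. rewrite Rabs_mult, (Rabs_pos_eq t) by lra.
  assert (H := Hc (INR (S m) * t) ltac:(apply Rmult_le_pos; [apply pos_INR|lra])).
  replace (c * (t / (1 + INR (S m) * t) ^ 2)) with (t * (c / (1 + INR (S m) * t) ^ 2))
    by (unfold Rdiv; ring).
  apply Rmult_le_compat_l; lra.
Qed.

Section EulerMaclaurin.

Variable b : nat -> R.
Hypothesis Hb : em_recursion b.

(** g n 0 is the sum over m of g n (mt) - g n ((m+1)t); expand each difference by
    Taylor's formula at the right end point. *)
Lemma telescoped_taylor g n K : decaying_tower g ->
  bigO (S K) (fun t => g n 0 -
    psum (fun k => (-1) ^ S k / INR (fact (S k)) * t ^ k * dilated_sum (g (S n + k)%nat) t) (S K)).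
Proof.
  intros Hg. assert (Hg' := Hg). destruct Hg' as [H1 [H2 _]].
  destruct (H2 (n + S K)%nat) as [c Hc].
  exists (4 * c). intros t Ht.
  assert (c0 := decay_const_nonneg _ c Hc).
  set (u := fun m => INR (S m) * t).
  set (d := fun m => g n (u m - t) - g n (u m)).
  set (T := fun m => psum (fun k => (- t) ^ S k / INR (fact (S k)) * g (S n + k)%nat (u m)) (S K)).
  assert (Hu : forall m, u m - t = INR m * t) by (intros m; unfold u; rewrite S_INR; ring).
  assert (Hup : forall m, 0 <= INR m * t) by (intros m; apply Rmult_le_pos; [apply pos_INR|lra]).
  (* the Taylor bound lives on [mt, (m+1)t]; the factor 4 moves it from 1 + mt to 1 + (m+1)t, as t <= 1 *)
  assert (Hrho : forall m, Rabs (d m - T m) <= 4 * c * t ^ S K * (t / (1 + u m) ^ 2)).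
  { intros m.
    assert (Ht1 := tower_taylor_backward g H1 (S K) n (c / (1 + (u m - t)) ^ 2) (u m) t).
    rewrite psum_first in Ht1.
    assert (E : d m - T m = g n (u m - t) -
      ((- t) ^ 0 / INR (fact 0) * g (n + 0)%nat (u m) +
       psum (fun k : nat => (- t) ^ S k / INR (fact (S k)) * g (n + S k)%nat (u m)) (S K))).
    { unfold d, T. rewrite Nat.add_0_r. change (INR (fact 0)) with 1. simpl pow at 2.
      rewrite (psum_ext (fun k => (- t) ^ S k / INR (fact (S k)) * g (n + S k)%nat (u m))
        (fun k => (- t) ^ S k / INR (fact (S k)) * g (S n + k)%nat (u m))).
      - rewrite Rdiv_1_r. ring.
      - intros k _; do 2 f_equal; lia. }
    rewrite E. specialize (Hup m). assert (Hum := Hu m).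
    eapply Rle_trans; [apply Ht1|].
    - lra.
    - intros v Hv. replace (n + S (S K))%nat with (S (n + S K)) by lia.
      eapply Rle_trans; [apply Hc; lra|]. unfold Rdiv. apply Rmult_le_compat_l; auto.
      apply Rinv_le_contravar; [apply pow_lt; lra|apply pow_incr; lra].
    - replace (t ^ S (S K)) with (t ^ S K * t) by (simpl; ring).
      assert (Hp : 0 < t ^ S K) by (apply pow_lt; lra).
      set (P := t ^ S K) in *. set (x := 1 + (u m - t)).
      assert (Hx : 1 <= x) by (unfold x; lra).
      replace (1 + u m) with (x + t) by (unfold x; ring).
      assert (Hinv : / x ^ 2 <= 4 * / (x + t) ^ 2).
      { replace (4 * / (x + t) ^ 2) with (/ ((x + t) ^ 2 / 4)) by (field; lra).
        apply Rinv_le_contravar; [|nra].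
        apply Rdiv_lt_0_compat; [apply pow_lt; lra|lra]. }
      assert (HcP : 0 <= c * P * t) by (apply Rmult_le_pos; [apply Rmult_le_pos; lra|lra]).
      unfold Rdiv.
      replace (c * / x ^ 2 * (P * t)) with (c * P * t * / x ^ 2) by ring.
      replace (4 * c * P * (t * / (x + t) ^ 2)) with (c * P * t * (4 * / (x + t) ^ 2)) by ring.
      now apply Rmult_le_compat_l. }
  destruct (riemann_sum_bound (fun m => d m - T m) (4 * c * t ^ S K) t) as [Hr1 Hr2]; [lra|exact Hrho|].
  assert (HT : forall N, ex_series (fun m => psum (fun k => (- t) ^ S k / INR (fact (S k)) * g (S n + k)%nat (u m)) N) /\
     Series (fun m => psum (fun k => (- t) ^ S k / INR (fact (S k)) * g (S n + k)%nat (u m)) N)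
      = psum (fun k => (-1) ^ S k / INR (fact (S k)) * t ^ k * dilated_sum (g (S n + k)%nat) t) N).
  { induction N as [|N [IH1 IH2]]; cbn [psum].
    - split; [|apply (is_series_unique (fun _ => 0)), (is_series_finite1 (fun _ => 0)); auto].
      exists 0; apply (is_series_finite1 (fun _ => 0)); auto.
    - assert (Ex : ex_series (fun m => t * g (S n + N)%nat (INR (S m) * t))).
      { destruct (H2 (n + N)%nat) as [d' Hd']. apply (dilated_sum_bound _ d' t); auto; lra. }
      assert (Eq : forall m, (-1) ^ S N / INR (fact (S N)) * t ^ N * (t * g (S n + N)%nat (INR (S m) * t))
         = (- t) ^ S N / INR (fact (S N)) * g (S n + N)%nat (u m)).
      { intros m. unfold u. replace (- t) with (-1 * t) by ring. rewrite Rpow_mult_distr.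
        change (t ^ S N) with (t * t ^ N). field. apply (INR_fact_neq_0 (S N)). }
      assert (Ex2 : ex_series (fun m => (- t) ^ S N / INR (fact (S N)) * g (S n + N)%nat (u m))).
      { eapply ex_series_ext; [exact Eq|]. apply (ex_series_scal (V := RN)). exact Ex. }
      split.
      + apply (ex_series_plus (V := RN)); auto.
      + rewrite Series_plus by auto. rewrite IH2. f_equal.
        rewrite <- (Series_ext _ _ Eq), Series_scal_l. reflexivity. }
  destruct (HT (S K)) as [HT1 HT2].
  assert (Hd : is_series d (g n 0)).
  { apply (is_lim_seq_ext (fun m => g n 0 - g n (INR (S m) * t)) _ (Finite (g n 0))).
    - intros m; induction m as [|m IH].
      + rewrite sum_O. unfold d. rewrite Hu. change (INR 0) with 0. rewrite Rmult_0_l. reflexivity.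
      + rewrite sum_Sn, <- IH. unfold d. rewrite Hu. unfold u, plus; cbn -[INR]. ring.
    - replace (Finite (g n 0)) with (Finite (g n 0 - 0)) by (f_equal; ring).
      apply is_lim_seq_minus'; [apply is_lim_seq_const|].
      apply (is_lim_comp_seq (g n) _ p_infty 0).
      + now apply tower_lim.
      + exists 0%nat; discriminate.
      + apply (is_lim_seq_incr_1 (fun m => INR m * t)).
        replace p_infty with (Rbar_mult p_infty t).
        * apply (is_lim_seq_scal_r INR t p_infty), is_lim_seq_INR.
        * simpl. destruct Rle_dec; [|exfalso; lra]. destruct Rle_lt_or_eq_dec; [|exfalso; lra].
          reflexivity. }
  rewrite <- HT2, <- (is_series_unique _ _ Hd), <- Series_minus; auto. eexists; exact Hd.
Qed.

(** [telescoped_taylor] expresses the sum of g (n+1) by the sums of the higher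
    derivatives, which carry additional powers of t.  Induction on the order K
    inserts their expansions; collecting the powers of t leaves the recursion
    satisfied by b. *)
Lemma euler_maclaurin g : decaying_tower g ->
  forall K n, bigO K (fun t => dilated_sum (g (S n)) t - psum (fun i => b i * t ^ i * g (n + i)%nat 0) K).
Proof.
  intros Hg K. induction K as [K IH] using lt_wf_ind. intros n.
  destruct K as [|K].
  { destruct Hg as [_ [H2 _]]. destruct (H2 n) as [c Hc]. exists c. intros t Ht.
    cbn [psum]. rewrite Rminus_0_r. simpl pow. rewrite Rmult_1_r.
    apply (dilated_sum_bound _ c t); auto; lra. }
  assert (HT := telescoped_taylor g n K Hg).
  set (w := fun j => (-1) ^ j / INR (fact (S (S j)))).
  assert (b0 : b 0%nat = -1).
  { assert (H := Hb 0%nat). rewrite sum_O in H. simpl in H. lra. }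
  (* the recursion for b, with its leading term isolated *)
  assert (Hrec : forall q, psum (fun j => w j * b (q - j)%nat) (S q) = b (S q)).
  { intros q. assert (H := Hb (S q)). rewrite sum_n_first in H.
    rewrite psum_sum_n. rewrite Nat.sub_0_r in H.
    rewrite (sum_n_ext _ (fun k => (-1) ^ S (S k) / INR (fact (S (S k))) * b (q - k)%nat)).
    - change (fact 1) with 1%nat in H. 
      change (fun k : nat => (-1) ^ S (S k) / INR (fact (S (S k))) * b (S q - S k)%nat)
        with (fun k : nat => (-1) ^ S (S k) / INR (fact (S (S k))) * b (q - k)%nat) in H.
      set (X := sum_n _ q) in *. change (@eq R X (b (S q))).
      clearbody X. simpl in H. change (R_AbelianMonoid : Type) with R in X. lra.
    - intros k; unfold w. simpl pow. f_equal. unfold Rdiv. ring. }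
  assert (Herr : bigO (S K) (fun t => psum (fun j => w j * (t ^ S j *
     (dilated_sum (g (S (n + S j))) t - psum (fun i => b i * t ^ i * g (n + S j + i)%nat 0) (K - j)))) K)).
  { apply bigO_psum. intros j Hj. apply bigO_scal.
    replace (S K) with (S j + (K - j))%nat by lia. apply bigO_pow.
    apply (IH (K - j)%nat); lia. }
  eapply bigO_ext; [|exact (bigO_plus _ _ _ Herr HT)].
  intros t Ht. cbn beta.
  rewrite (psum_first (fun k => (-1) ^ S k / INR (fact (S k)) * t ^ k * dilated_sum (g (S n + k)%nat) t)).
  rewrite (psum_first (fun i => b i * t ^ i * g (n + i)%nat 0)).
  rewrite b0, !Nat.add_0_r. change (fact 1) with 1%nat. change (INR 1) with 1. 
  rewrite (psum_ext (fun j => w j * (t ^ S j *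
     (dilated_sum (g (S (n + S j))) t - psum (fun i => b i * t ^ i * g (n + S j + i)%nat 0) (K - j))))
     (fun j => (-1) ^ S (S j) / INR (fact (S (S j))) * t ^ S j * dilated_sum (g (S n + S j)%nat) t
        + -1 * psum (fun i => w j * t ^ S j * (b i * t ^ i * g (n + S j + i)%nat 0)) (K - j))).
  2:{ intros j _. rewrite psum_scal. unfold w. simpl pow. unfold Rdiv. change (S n + S j)%nat with (S (n + S j)). ring. }
  rewrite psum_plus, psum_scal.
  rewrite (psum_triangle (fun j i => w j * t ^ S j * (b i * t ^ i * g (n + S j + i)%nat 0))).
  rewrite (psum_ext (fun q => psum _ (S q)) (fun q => b (S q) * t ^ S q * g (n + S q)%nat 0)).
  - cbn -[INR fact psum dilated_sum]. field.
  - intros q _. rewrite <- Hrec.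
    rewrite (psum_ext _ (fun j => (t ^ S q * g (n + S q)%nat 0) * (w j * b (q - j)%nat))).
    + rewrite psum_scal. ring.
    + intros j Hj. replace (n + S j + (q - j))%nat with (n + S q)%nat by lia.
      replace (t ^ S q) with (t ^ S j * t ^ (q - j)) by (rewrite <- pow_add; f_equal; lia). ring.
Qed.

End EulerMaclaurin.

(** * Smooth functions decaying at infinity *)

Definition decays (p : nat) (f : R -> R) : Prop :=
  forall c, 0 < c -> exists M, forall u, c <= u -> Rabs (f u) <= M / u ^ p.

(** k derivatives on ]0,oo[, all of them O(u^{-p}) away from 0.  The recursion
    over k, rather than a sequence of derivatives, makes stability under
    products an induction that needs no Leibniz formula. *)
Fixpoint smooth_decay (k p : nat) (f : R -> R) : Prop :=
  decays p f /\
  match k with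
  | O => True
  | S k' => exists f', (forall u, 0 < u -> is_derive f u (f' u)) /\ smooth_decay k' p f'
  end.

Lemma smooth_decay_decays k p f : smooth_decay k p f -> decays p f.
Proof. destruct k; intros H; apply H. Qed.

Lemma smooth_decay_pred k p f : smooth_decay (S k) p f -> smooth_decay k p f.
Proof.
  revert f; induction k as [|k IH]; intros f [H [f' [H1 H2]]].
  - split; auto.
  - split; auto. exists f'; split; auto.
Qed.

Lemma decays_plus p f g : decays p f -> decays p g -> decays p (fun u => f u + g u).
Proof.
  intros Hf Hg c Hc. destruct (Hf c Hc) as [M1 H1], (Hg c Hc) as [M2 H2].
  exists (M1 + M2); intros u Hu. eapply Rle_trans; [apply Rabs_triang|].
  specialize (H1 u Hu); specialize (H2 u Hu). unfold Rdiv in *. lra.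
Qed.

Lemma decays_scal p a f : decays p f -> decays p (fun u => a * f u).
Proof.
  intros Hf c Hc. destruct (Hf c Hc) as [M1 H1].
  exists (Rabs a * M1); intros u Hu. rewrite Rabs_mult. unfold Rdiv in *. rewrite Rmult_assoc.
  apply Rmult_le_compat_l; [apply Rabs_pos|auto].
Qed.

Lemma decays_mult p f g : decays p f -> decays 0 g -> decays p (fun u => f u * g u).
Proof.
  intros Hf Hg c Hc. destruct (Hf c Hc) as [M1 H1], (Hg c Hc) as [M2 H2].
  exists (M1 * M2); intros u Hu.
  specialize (H1 u Hu); specialize (H2 u Hu). simpl in H2. rewrite Rdiv_1_r in H2.
  rewrite Rabs_mult. replace (M1 * M2 / u ^ p) with (M1 / u ^ p * M2) by (unfold Rdiv; ring).
  apply Rmult_le_compat; auto using Rabs_pos.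
Qed.

Lemma smooth_decay_plus k p f g :
  smooth_decay k p f -> smooth_decay k p g -> smooth_decay k p (fun u => f u + g u).
Proof.
  revert f g; induction k as [|k IH]; intros f g [H1 H2] [H3 H4]; split; auto using decays_plus.
  destruct H2 as [f' [Hf Hf']], H4 as [g' [Hg Hg']].
  exists (fun u => f' u + g' u); split; auto.
  intros u Hu. apply (is_derive_plus (V := RN)); auto.
Qed.

Lemma smooth_decay_scal k p a f :
  smooth_decay k p f -> smooth_decay k p (fun u => a * f u).
Proof.
  revert f; induction k as [|k IH]; intros f [H1 H2]; split; auto using decays_scal.
  destruct H2 as [f' [Hf Hf']].
  exists (fun u => a * f' u); split; auto.
  intros u Hu. apply (is_derive_scal f u a). auto.
Qed.

Lemma smooth_decay_mult k p f g :
  smooth_decay k p f -> smooth_decay k 0 g -> smooth_decay k p (fun u => f u * g u).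
Proof.
  revert f g; induction k as [|k IH]; intros f g Hf Hg;
    assert (Df := smooth_decay_decays _ _ _ Hf); assert (Dg := smooth_decay_decays _ _ _ Hg);
    split; auto using decays_mult.
  assert (Pf := smooth_decay_pred _ _ _ Hf). assert (Pg := smooth_decay_pred _ _ _ Hg).
  destruct Hf as [_ [f' [H1 H2]]], Hg as [_ [g' [H3 H4]]].
  exists (fun u => f' u * g u + f u * g' u); split.
  - intros u Hu. apply (is_derive_mult f g); auto. intros; apply Rmult_comm.
  - apply smooth_decay_plus; auto.
Qed.

(** Used with f' a polynomial in f and in functions already treated: the induction
    on k then closes on itself. *)
Lemma smooth_decay_step k p f f' :
  decays p f -> (forall u, 0 < u -> is_derive f u (f' u)) ->
  smooth_decay k p f' -> smooth_decay (S k) p f.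
Proof. intros H1 H2 H3; split; auto. now exists f'. Qed.

Lemma smooth_decay_inv k : smooth_decay k 0 (fun u => / u).
Proof.
  assert (D : decays 0 (fun u => / u)).
  { intros c Hc; exists (/ c); intros u Hu. simpl. rewrite Rdiv_1_r.
    rewrite Rabs_pos_eq by (left; apply Rinv_0_lt_compat; lra).
    apply Rinv_le_contravar; lra. }
  induction k as [|k IH]; [split; auto|].
  apply (smooth_decay_step k 0 _ (fun u => -1 * (/ u * / u))); auto.
  - intros u Hu. auto_derive; [lra|field; lra].
  - apply smooth_decay_scal. now apply smooth_decay_mult.
Qed.

Lemma smooth_decay_inv_sq k : smooth_decay k 2 (fun u => / u ^ 2).
Proof.
  assert (D : decays 2 (fun u => / u ^ 2)).
  { intros c Hc; exists 1; intros u Hu. unfold Rdiv; rewrite Rmult_1_l.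
    rewrite Rabs_pos_eq by (left; apply Rinv_0_lt_compat, pow_lt; lra). lra. }
  induction k as [|k IH]; [split; auto|].
  apply (smooth_decay_step k 2 _ (fun u => -2 * (/ u ^ 2 * / u))); auto.
  - intros u Hu. auto_derive; [apply Rgt_not_eq; nra|field; lra].
  - apply smooth_decay_scal. apply smooth_decay_mult; auto using smooth_decay_inv.
Qed.

Lemma exp_opp_le_inv_sq y : 0 < y -> exp (- y) <= 4 / y ^ 2.
Proof.
  intros Hy. rewrite exp_Ropp. unfold Rdiv.
  replace (4 * / y ^ 2) with (/ (y / 2) ^ 2) by (field; lra).
  apply Rinv_le_contravar; [apply pow_lt; lra|].
  replace y with (y / 2 + y / 2) at 2 by field. rewrite exp_plus.
  assert (H := exp_ineq1_le (y / 2)). simpl. nra.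
Qed.

Lemma smooth_decay_exp k x : 0 < x -> smooth_decay k 2 (fun u => exp (- (x * u))).
Proof.
  intros Hx.
  assert (D : decays 2 (fun u => exp (- (x * u)))).
  { intros c Hc; exists (4 / x ^ 2); intros u Hu. 
    rewrite Rabs_pos_eq by (left; apply exp_pos).
    replace (4 / x ^ 2 / u ^ 2) with (4 / (x * u) ^ 2) by (field; lra).
    apply exp_opp_le_inv_sq. nra. }
  induction k as [|k IH]; [split; auto|].
  apply (smooth_decay_step k 2 _ (fun u => - x * exp (- (x * u)))); auto.
  - intros u Hu. auto_derive; auto; ring.
  - now apply smooth_decay_scal.
Qed.

Lemma one_minus_exp_pos u : 0 < u -> 0 < 1 - exp (- u).
Proof.
  intros Hu. assert (exp (- u) < exp 0) by (apply exp_increasing; lra).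
  rewrite exp_0 in *; lra.
Qed.

Lemma smooth_decay_geom k : smooth_decay k 0 (fun u => / (1 - exp (- u))).
Proof.
  assert (D : decays 0 (fun u => / (1 - exp (- u)))).
  { intros c Hc; exists (/ (1 - exp (- c))); intros u Hu. simpl. rewrite Rdiv_1_r.
    assert (H1 := one_minus_exp_pos c Hc). assert (H2 := one_minus_exp_pos u ltac:(lra)).
    rewrite Rabs_pos_eq by (left; now apply Rinv_0_lt_compat).
    apply Rinv_le_contravar; auto.
    assert (exp (- u) <= exp (- c)) by (apply exp_le_mono; lra). lra. }
  induction k as [|k IH]; [split; auto|].
  apply (smooth_decay_step k 0 _ (fun u => / (1 - exp (- u)) + -1 * (/ (1 - exp (- u)) * / (1 - exp (- u))))); auto.
  - intros u Hu. assert (H := one_minus_exp_pos u Hu).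
    auto_derive; [lra|field; lra].
  - apply smooth_decay_plus; auto. apply smooth_decay_scal. now apply smooth_decay_mult.
Qed.

Lemma smooth_decay_Derive_n k p f :
  smooth_decay k p f ->
  (forall u, 0 < u -> forall j, (j <= k)%nat -> ex_derive_n f j u) /\ decays p (Derive_n f k).
Proof.
  revert f; induction k as [|k IH]; intros f Hf.
  - split; [|apply (smooth_decay_decays _ _ _ Hf)].
    intros u Hu j Hj. replace j with 0%nat by lia. exact I.
  - destruct Hf as [D [f' [H1 H2]]]. destruct (IH f' H2) as [I1 I2].
    assert (E : forall n u, 0 < u -> Derive_n f (S n) u = Derive_n f' n u).
    { intros n u Hu. replace (S n) with (n + 1)%nat by lia. rewrite <- Derive_n_comp.
      apply Derive_n_ext_loc. apply locally_pos; auto.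
      intros y Hy. simpl. now apply is_derive_unique, H1. }
    split.
    + intros u Hu [|j] Hj; [exact I|].
      destruct j as [|j]; [simpl; eexists; now apply H1|].
      simpl. apply ex_derive_ext_loc with (Derive_n f' j).
      * apply locally_pos; auto. intros y Hy. symmetry. apply (E j y Hy).
      * apply (I1 u Hu (S j)); lia.
    + intros c Hc. destruct (I2 c Hc) as [M HM]. exists M; intros u Hu.
      rewrite E by lra. auto.
Qed.

Lemma monotone_limit (F : R -> R) (M : R) :
  (forall a b, 0 < a <= b -> F a <= F b) -> (forall t, 0 < t -> Rabs (F t) <= M) ->
  exists l : R, filterlim F (Rbar_locally p_infty) (locally l).
Proof.
  intros Hm Hb.
  set (E := fun z => exists t, 0 < t /\ z = F t).
  destruct (completeness E) as [m [Hm1 Hm2]].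
  { exists M; intros z [t [Ht ->]]. specialize (Hb t Ht). apply Rabs_le_between in Hb. lra. }
  { exists (F 1), 1; split; [lra|auto]. }
  exists m. intros P [eps HP]. assert (He := cond_pos eps).
  assert (Hex : exists t0, 0 < t0 /\ m - eps < F t0).
  { destruct (Classical_Prop.classic (exists t0, 0 < t0 /\ m - eps < F t0)) as [H|H]; auto.
    exfalso. assert (m <= m - eps); [|lra].
    apply Hm2. intros z [t [Ht ->]]. apply Rnot_lt_le. intros Hlt. apply H. now exists t. }
  destruct Hex as [t0 [Ht0 Hlt]].
  exists t0. intros t Ht. apply HP.
  assert (H1 := Hm t0 t ltac:(lra)).
  assert (H2 := Hm1 (F t) (ex_intro _ t (conj (Rlt_trans _ _ _ Ht0 Ht) eq_refl))).
  change (Rabs (F t - m) < eps). apply Rabs_lt_between. lra.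
Qed.

Lemma primitive_vanishing_at_infinity (G : R -> R) (C : R) :
  (forall u, 0 <= u -> continuous G u) ->
  locally 0 (continuous G) ->
  (forall u, 0 <= u -> Rabs (G u) <= C / (1 + u) ^ 2) ->
  exists H : R -> R, (forall u, 0 <= u -> is_derive H u (G u)) /\ is_lim H p_infty 0.
Proof.
  intros Hc [e0 He0] Hb.
  set (F := fun u => RInt G 0 u).
  assert (dF : forall u, 0 <= u -> is_derive F u (G u)).
  { intros u Hu. apply (is_derive_RInt (V := RN) G F 0); auto.
    exists e0. intros y Hy. apply (RInt_correct (V := RCN)).
    apply (ex_RInt_continuous (V := RCN)). intros z Hz.
    destruct (Rle_or_lt 0 z) as [Hz0|Hz0]; auto.
    apply He0. apply ball_R in Hy. apply Rabs_lt_between in Hy.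
    assert (Rmin 0 y <= z) by apply Hz.
    assert (Rmin 0 y = y).
    { apply Rmin_right. unfold Rmin in H; destruct Rle_dec; lra. }
    change (Rabs (z - 0) < e0). apply Rabs_lt_between. lra. }
  assert (C0 := decay_const_nonneg G C Hb).
  assert (F0 : F 0 = 0) by apply (RInt_point (V := RCN)).
  set (k := fun u => C * (1 - / (1 + u))).
  assert (dk : forall u, 0 <= u -> is_derive k u (C / (1 + u) ^ 2)).
  { intros u Hu. unfold k. auto_derive; [lra|field; lra]. }
  assert (Hk : forall u, 0 <= u -> 0 <= k u <= C).
  { intros u Hu. unfold k. assert (H1 : 0 < / (1 + u)) by (apply Rinv_0_lt_compat; lra).
    assert (H2 : / (1 + u) <= / 1) by (apply Rinv_le_contravar; lra). rewrite Rinv_1 in H2. nra. }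
  (* |G| is at most the derivative of the bounded function k, so F + k and k - F are monotone *)
  assert (Hup : forall a b, 0 <= a <= b -> F a + k a <= F b + k b).
  { intros a b Hab. apply (nonneg_derivative_le (fun s => F s + k s) (fun s => G s + C / (1 + s) ^ 2)); [lra| |].
    - intros s Hs. apply (is_derive_plus (V := RN)); [apply dF|apply dk]; lra.
    - intros s Hs. specialize (Hb s ltac:(lra)). apply Rabs_le_between in Hb. lra. }
  assert (Hdn : forall u, 0 <= u -> k 0 - F 0 <= k u - F u).
  { intros u Hu. apply (nonneg_derivative_le (fun s => k s - F s) (fun s => C / (1 + s) ^ 2 - G s)); [lra| |].
    - intros s Hs. apply (is_derive_minus (V := RN)); [apply dk|apply dF]; lra.
    - intros s Hs. specialize (Hb s ltac:(lra)). apply Rabs_le_between in Hb. lra. }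
  assert (k0 : k 0 = 0) by (unfold k; field).
  destruct (monotone_limit (fun u => F u + k u) (2 * C)) as [l Hl].
  { intros a b Hab; apply Hup; lra. }
  { intros u Hu. assert (A := Hup 0 u ltac:(lra)). assert (B := Hdn u ltac:(lra)).
    assert (D := Hk u ltac:(lra)). apply Rabs_le_between. lra. }
  exists (fun u => F u - (l - C)). split.
  - intros u Hu. replace (G u) with (minus (G u) 0) by (unfold minus, plus, opp; simpl; ring).
    apply (is_derive_minus (V := RN)); [now apply dF|apply (is_derive_const (V := RN))].
  - assert (Hi : is_lim (fun u => / (1 + u)) p_infty 0).
    { apply (is_lim_inv (fun u => 1 + u) p_infty p_infty); [|discriminate].
      apply (is_lim_plus (fun _ => 1) (fun u => u) p_infty 1 p_infty); [apply is_lim_const|apply is_lim_id|].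
      reflexivity. }
    apply is_lim_ext with (fun u => (F u + k u) + C * / (1 + u) - l).
    { intros u. unfold k. ring. }
    replace (Finite 0) with (Finite (l + C * 0 - l)) by (f_equal; ring).
    apply is_lim_minus'; [apply is_lim_plus'; [exact Hl|]|apply is_lim_const].
    apply (is_lim_scal_l _ C p_infty (Finite 0)), Hi.
Qed.

(** * The regularized kernel *)

Section Kernel.

(* c n stands for B_n(x) / n! *)
Variables (x : R) (c : nat -> R).
Hypothesis Hx : 0 < x.
Hypothesis Hc : locally' 0 (fun t => is_pseries c t (t * exp (x * t) / (exp t - 1))).

Definition bernoulli_disk (e : R) : Prop :=
  0 < e /\ forall t, Rabs t < e -> t <> 0 ->
    is_series (fun n => c n * t ^ n) (t * exp (x * t) / (exp t - 1)).

Lemma bernoulli_disk_ex : exists e, bernoulli_disk e.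
Proof.
  destruct Hc as [e He]. exists e; split; [apply cond_pos|]. intros t Ht H0.
  apply is_pseries_R, He; auto. unfold ball; simpl; unfold AbsRing_ball, abs, minus, plus, opp; simpl.
  now replace (t + - 0) with t by ring.
Qed.

Lemma exp_minus_1_neq t : t <> 0 -> exp t - 1 <> 0.
Proof.
  intros Ht H. apply Ht. apply exp_inv. rewrite exp_0; lra.
Qed.

Lemma bernoulli_cv : Rbar_lt 0 (CV_radius c) /\
  locally 0 (fun t => PSeries c t * (exp t - 1) = t * exp (x * t) /\ Rbar_lt (Rabs t) (CV_radius c)).
Proof.
  destruct bernoulli_disk_ex as [e [He H]].
  assert (Ha := pow_series_abs_conv c (e / 2) ltac:(lra)
    (ex_intro _ _ (H (e / 2) ltac:(rewrite Rabs_pos_eq; lra) ltac:(lra)))).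
  assert (Hd : forall t, Rabs t < e / 4 -> Rbar_lt (Rabs t) (CV_radius c)).
  { intros t Ht. apply CV_radius_gt with (e / 2 / 2); auto; lra. }
  split.
  - rewrite <- Rabs_R0. apply Hd. rewrite Rabs_R0; lra.
  - exists (mkposreal (e / 4) ltac:(lra)). intros t Ht. apply ball_R in Ht; simpl in Ht.
    rewrite Rminus_0_r in Ht. split; [|now apply Hd].
    destruct (Req_dec t 0) as [->|Hn].
    + rewrite exp_0; ring.
    + unfold PSeries. rewrite (is_series_unique _ _ (H t ltac:(lra) Hn)).
      field. now apply exp_minus_1_neq.
Qed.

Lemma bernoulli_first_coefs : c 0%nat = 1 /\ c 1%nat = x - 1 / 2.
Proof.
  destruct bernoulli_cv as [Hr Hl].
  set (P := PSeries c). set (P1 := PSeries (PS_derive c)). set (P2 := PSeries (PS_derive (PS_derive c))).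
  assert (dP : forall t, Rbar_lt (Rabs t) (CV_radius c) -> is_derive P t (P1 t)).
  { intros t Ht. now apply is_derive_PSeries. }
  assert (dP1 : forall t, Rbar_lt (Rabs t) (CV_radius c) -> is_derive P1 t (P2 t)).
  { intros t Ht. apply is_derive_PSeries. now rewrite CV_radius_derive. }
  assert (P0 : P 0 = c 0%nat) by (apply PSeries_0).
  assert (P10 : P1 0 = c 1%nat) by (unfold P1; rewrite PSeries_0; unfold PS_derive; simpl; ring).
  clearbody P2.
  (* P(t) (e^t - 1) = t e^{xt} holds near 0; differentiate it twice and put t = 0 *)
  assert (H1 : locally 0 (fun t => P1 t * (exp t - 1) + P t * exp t = exp (x * t) + x * t * exp (x * t))).
  { apply locally_locally in Hl. revert Hl. apply filter_imp. intros t Ht.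
    assert (Ht' := locally_singleton _ _ Ht). destruct Ht' as [_ Hcv].
    assert (D1 : is_derive (fun t => P t * (exp t - 1)) t (P1 t * (exp t - 1) + P t * exp t)).
    { apply (is_derive_mult P (fun t => exp t - 1) t (P1 t) (exp t)); auto.
      - auto_derive; auto; ring.
      - intros; apply Rmult_comm. }
    assert (D2 : is_derive (fun t => P t * (exp t - 1)) t (exp (x * t) + x * t * exp (x * t))).
    { apply is_derive_ext_loc with (fun t => t * exp (x * t)).
      - revert Ht; apply filter_imp. intros s [Hs _]. now rewrite <- Hs.
      - auto_derive; auto; ring. }
    rewrite <- (is_derive_unique _ _ _ D1). now apply is_derive_unique. }
  assert (Hr0 : Rbar_lt (Rabs 0) (CV_radius c)) by now rewrite Rabs_R0.
  assert (E1 := locally_singleton _ _ H1). cbn beta in E1.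
  rewrite Rmult_0_r, exp_0, P0 in E1.
  split; [lra|].
  assert (D1 : is_derive (fun t => P1 t * (exp t - 1) + P t * exp t) 0
     ((P2 0 * (exp 0 - 1) + P1 0 * exp 0) + (P1 0 * exp 0 + P 0 * exp 0))).
  { apply (is_derive_plus (V := RN)).
    - apply (is_derive_mult P1 (fun t => exp t - 1) 0 (P2 0) (exp 0)); auto.
      + auto_derive; auto; ring.
      + intros; apply Rmult_comm.
    - apply (is_derive_mult P exp 0 (P1 0) (exp 0)); auto.
      + apply is_derive_exp.
      + intros; apply Rmult_comm. }
  assert (D2 : is_derive (fun t => P1 t * (exp t - 1) + P t * exp t) 0 (2 * x)).
  { apply is_derive_ext_loc with (fun t => exp (x * t) + x * t * exp (x * t)).
    - revert H1; apply filter_imp. intros s Hs. now rewrite <- Hs.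
    - auto_derive; auto. rewrite Rmult_0_r, exp_0. ring. }
  apply is_derive_unique in D1. apply is_derive_unique in D2.
  rewrite D1, exp_0, P0, P10 in D2. lra.
Qed.

(** e^{-xu} / (u (1 - e^{-u})) without its singular part at 0.  The pole in 1/u is
    removed together with a factor e^{-u}, without which the sum over u = mt
    would diverge. *)
Definition kernel_rest (u : R) : R :=
  exp (- (x * u)) * / (1 - exp (- u)) * / u + -1 * / u ^ 2 + (c 1%nat) * (exp (- (1 * u)) * / u).

(** The second summand comes from (e^{-u} - 1)/u. *)
Definition kernel_coef (j : nat) : R :=
  (-1) ^ j * c (S (S j)) + c 1%nat * ((-1) ^ S j / INR (fact (S j))).

Lemma kernel_rest_smooth k : smooth_decay k 2 kernel_rest.
Proof.
  apply smooth_decay_plus; [apply smooth_decay_plus|].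
  - apply smooth_decay_mult; [|apply smooth_decay_inv].
    apply smooth_decay_mult; [now apply smooth_decay_exp|apply smooth_decay_geom].
  - apply smooth_decay_scal, smooth_decay_inv_sq.
  - apply smooth_decay_scal. apply smooth_decay_mult; [apply smooth_decay_exp; lra|apply smooth_decay_inv].
Qed.

Lemma kernel_rest_series e u : bernoulli_disk e -> 0 < u < e ->
  is_series (fun j => kernel_coef j * u ^ j) (kernel_rest u).
Proof.
  intros [He H] Hu.
  destruct bernoulli_first_coefs as [c0 c1].
  assert (Hs := H (- u) ltac:(rewrite Rabs_Ropp, Rabs_pos_eq; lra) ltac:(lra)).
  assert (Hs2 : is_series (fun n => c (S (S n)) * (- u) ^ (S (S n)))
     (- u * exp (x * - u) / (exp (- u) - 1) - c 0%nat - c 1%nat * (- u))).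
  { apply (is_series_incr_1 (V := RN) (fun n => c (S n) * (- u) ^ (S n))).
    apply (is_series_incr_1 (V := RN) (fun n => c n * (- u) ^ n)).
    eapply is_series_eq; [exact Hs|]. unfold plus; simpl; ring. }
  assert (Hx1 : is_series (fun n => (- u) ^ S n / INR (fact (S n))) (exp (- u) - 1)).
  { apply (is_series_incr_1 (V := RN) (fun n => (- u) ^ n / INR (fact n))).
    eapply is_series_eq; [apply is_series_exp|]. unfold plus; simpl; field. }
  assert (Hpow : forall k, (- u) ^ k = (-1) ^ k * u ^ k).
  { intros k; rewrite <- Rpow_mult_distr; f_equal; ring. }
  eapply is_series_eq.
  - eapply is_series_ext; [|exact (is_series_plus (V := RN) _ _ _ _
      (is_series_scal (V := RN) (/ u ^ 2) _ _ Hs2)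
      (is_series_scal (V := RN) (c 1%nat / u) _ _ Hx1))].
    intros k. unfold kernel_coef, scal, plus; simpl AbelianMonoid.plus; simpl ModuleSpace.scal.
    unfold mult; simpl Ring.mult. rewrite !Hpow.
    assert (H3 := INR_fact_neq_0 (S k)).
    match goal with |- ?a = ?b => change (@eq R a b) end.
    change (u ^ S (S k)) with (u * (u * u ^ k)). change (u ^ S k) with (u * u ^ k).
    change ((-1) ^ S (S k)) with (-1 * (-1 * (-1) ^ k)). change ((-1) ^ S k) with (-1 * (-1) ^ k).
    cbn -[INR fact pow]. change (fact k + k * fact k)%nat with (fact (S k)). field. split; auto; lra.
  - unfold kernel_rest, scal, plus; simpl. unfold mult; simpl.
    rewrite c0. replace (x * - u) with (- (x * u)) by ring. rewrite Rmult_1_l.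
    assert (H2 := one_minus_exp_pos u ltac:(lra)).
    field. repeat split; lra.
Qed.

(** The removable singularity at 0 is filled by the power series, which also
    extends the function to a neighbourhood of 0, so that derivatives at 0 are
    ordinary two-sided derivatives. *)
Definition kernel_smooth (e u : R) : R :=
  if Rlt_dec u (e / 4) then PSeries kernel_coef u else kernel_rest u.

Lemma kernel_smooth_pos e u : bernoulli_disk e -> 0 < u ->
  kernel_smooth e u = kernel_rest u.
Proof.
  intros He Hu. unfold kernel_smooth. destruct Rlt_dec as [H|H]; auto.
  unfold PSeries. apply is_series_unique. apply (kernel_rest_series e); auto.
  destruct He; lra.
Qed.

Lemma kernel_coef_radius e t : bernoulli_disk e -> Rabs t < e / 4 ->
  Rbar_lt (Rabs t) (CV_radius kernel_coef).
Proof.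
  intros He Ht. assert (H0 := proj1 He). apply CV_radius_gt with (e / 2 / 2); [lra|].
  apply pow_series_abs_conv; [lra|].
  eexists; apply (kernel_rest_series e (e / 2) He); lra.
Qed.

Lemma kernel_smooth_near0 e u : 0 < e -> Rabs u < e / 4 ->
  locally u (fun y => PSeries kernel_coef y = kernel_smooth e y).
Proof.
  intros He Hu. exists (mkposreal (e / 4 - u) ltac:(apply Rabs_lt_between in Hu; lra)).
  intros y Hy. apply ball_R in Hy; simpl in Hy. apply Rabs_lt_between in Hy.
  unfold kernel_smooth. destruct Rlt_dec; auto; lra.
Qed.

Lemma kernel_smooth_Derive_n0 e j : bernoulli_disk e ->
  Derive_n (kernel_smooth e) j 0 = kernel_coef j * INR (fact j).
Proof.
  intros He. assert (H0 := proj1 He).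
  rewrite <- (Derive_n_ext_loc (PSeries kernel_coef) (kernel_smooth e) j 0).
  - apply Derive_n_coef. rewrite <- Rabs_R0. apply (kernel_coef_radius e); auto. rewrite Rabs_R0; lra.
  - apply kernel_smooth_near0; auto. rewrite Rabs_R0; lra.
Qed.

Lemma kernel_smooth_ex_derive_n e j u : bernoulli_disk e -> - (e / 4) < u ->
  ex_derive_n (kernel_smooth e) j u.
Proof.
  intros He Hu. assert (H0 := proj1 He).
  destruct (Rle_or_lt u 0) as [Hneg|Hpos].
  - assert (Hr : Rabs u < e / 4) by (apply Rabs_lt_between; lra).
    apply (ex_derive_n_ext_loc (PSeries kernel_coef)); [now apply kernel_smooth_near0|].
    apply ex_derive_n_PSeries. now apply (kernel_coef_radius e).
  - apply (ex_derive_n_ext_loc kernel_rest).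
    + apply locally_pos; auto. intros y Hy. symmetry. now apply kernel_smooth_pos.
    + apply (proj1 (smooth_decay_Derive_n j 2 _ (kernel_rest_smooth j))); auto.
Qed.

Lemma kernel_smooth_bound e n : bernoulli_disk e ->
  exists C, forall u, 0 <= u -> Rabs (Derive_n (kernel_smooth e) n u) <= C / (1 + u) ^ 2.
Proof.
  intros He. assert (H0 := proj1 He).
  assert (Hcont : forall u, 0 <= u <= 1 -> continuity_pt (fun u => Rabs (Derive_n (kernel_smooth e) n u)) u).
  { intros u Hu. apply (continuity_pt_comp (Derive_n (kernel_smooth e) n) Rabs); [|apply Rcontinuity_abs].
    apply continuity_pt_filterlim.
    apply (ex_derive_continuous (V := RN)).
    apply (kernel_smooth_ex_derive_n e (S n) u); auto; lra. }
  destruct (continuity_ab_maj _ 0 1 ltac:(lra) Hcont) as [m [Hm _]].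
  set (M1 := Rabs (Derive_n (kernel_smooth e) n m)) in *.
  destruct (smooth_decay_Derive_n n 2 _ (kernel_rest_smooth n)) as [_ Hd].
  destruct (Hd 1 ltac:(lra)) as [M2 HM2].
  assert (E : forall u, 0 < u -> Derive_n (kernel_smooth e) n u = Derive_n kernel_rest n u).
  { intros u Hu. apply Derive_n_ext_loc. apply locally_pos; auto.
    intros y Hy. now apply kernel_smooth_pos. }
  assert (M1p : 0 <= M1) by apply Rabs_pos.
  assert (M2p : 0 <= M2).
  { specialize (HM2 1 ltac:(lra)). assert (H := Rabs_pos (Derive_n kernel_rest n 1)).
    replace (M2 / 1 ^ 2) with M2 in HM2 by field. lra. }
  (* on [0, 1] by compactness, beyond 1 by the decay of the closed formula *)
  exists (4 * (M1 + M2)). intros u Hu.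
  destruct (Rle_or_lt u 1) as [Hu1|Hu1].
  - eapply Rle_trans; [apply Hm; lra|].
    assert (H4 : / 4 <= / (1 + u) ^ 2) by (apply Rinv_le_contravar; nra).
    unfold Rdiv. apply Rle_trans with (4 * (M1 + M2) * / 4); [lra|].
    apply Rmult_le_compat_l; lra.
  - rewrite E by lra. eapply Rle_trans; [apply HM2; lra|].
    unfold Rdiv.
    assert (H4 : / u ^ 2 <= 4 * / (1 + u) ^ 2).
    { replace (4 * / (1 + u) ^ 2) with (/ ((1 + u) ^ 2 / 4)) by (field; lra).
      apply Rinv_le_contravar; [|nra]. apply Rdiv_lt_0_compat; [apply pow_lt; lra|lra]. }
    assert (Hi : 0 < / (1 + u) ^ 2) by (apply Rinv_0_lt_compat, pow_lt; lra).
    apply Rle_trans with (M2 * (4 * / (1 + u) ^ 2)); [apply Rmult_le_compat_l; lra|].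
    nra.
Qed.

Lemma kernel_tower : exists e (H : R -> R), bernoulli_disk e /\
  decaying_tower (fun n => match n with O => H | S n' => Derive_n (kernel_smooth e) n' end).
Proof.
  destruct bernoulli_disk_ex as [e He]. assert (H0 := proj1 He).
  assert (Hdc : forall u, - (e / 4) < u -> continuous (kernel_smooth e) u).
  { intros u Hu. apply (ex_derive_continuous (V := RN)).
    apply (kernel_smooth_ex_derive_n e 1 u); auto. }
  destruct (kernel_smooth_bound e 0 He) as [C HC].
  destruct (primitive_vanishing_at_infinity (kernel_smooth e) C) as [H [H1 H2]]; auto.
  { intros u Hu; apply Hdc; lra. }
  { exists (mkposreal (e / 4) ltac:(lra)). intros y Hy. apply Hdc.
    apply ball_R in Hy; simpl in Hy. apply Rabs_lt_between in Hy. lra. }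
  exists e, H. split; auto. split; [|split]; auto.
  - intros [|n] u Hu; [now apply H1|].
    apply Derive_correct. apply (kernel_smooth_ex_derive_n e (S n) u); auto; lra.
  - intros n. now apply kernel_smooth_bound.
Qed.

Variable z : nat -> R.
Hypothesis Hz : em_recursion (em_coef z).

(** The constant I is the integral of the kernel over [0,oo[, and the values of the
    derivatives at 0 are read off the power series. *)
Lemma kernel_rest_expansion : exists I, forall K,
  bigO (S K) (fun t => dilated_sum kernel_rest t - I
     - psum (fun i => z i * kernel_coef i * t ^ S i) K).
Proof.
  destruct kernel_tower as [e [H [He Ht]]].
  exists (- H 0). intros K.
  eapply bigO_ext; [|exact (euler_maclaurin (em_coef z) Hz _ Ht (S K) 0)].
  intros t Hti. cbn beta.
  rewrite psum_first. cbn [em_coef Nat.add].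
  rewrite (psum_ext _ (fun i => z i * kernel_coef i * t ^ S i)).
  - replace (dilated_sum (Derive_n (kernel_smooth e) 0) t) with (dilated_sum kernel_rest t).
    + simpl pow. ring.
    + unfold dilated_sum. apply Series_ext. intros m. change (Derive_n (kernel_smooth e) 0) with (kernel_smooth e).
      rewrite kernel_smooth_pos; auto.
      apply Rmult_lt_0_compat; [apply lt_0_INR; lia|lra].
  - intros i _. rewrite kernel_smooth_Derive_n0 by auto. field. apply INR_fact_neq_0.
Qed.

End Kernel.

(** * The expansion of log ((1 - e^{-t}) / t) *)

Section ExponentialSums.

Variable z : nat -> R.
Hypothesis Hz : em_recursion (em_coef z).

Lemma exp_decay_bound u : 0 <= u -> exp (- u) <= 4 / (1 + u) ^ 2.
Proof.
  intros Hu. rewrite exp_Ropp. unfold Rdiv.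
  replace (4 * / (1 + u) ^ 2) with (/ ((1 + u) / 2) ^ 2) by (field; lra).
  apply Rinv_le_contravar; [apply pow_lt; lra|].
  replace u with (u / 2 + u / 2) at 2 by field. rewrite exp_plus.
  assert (H := exp_ineq1_le (u / 2)). simpl. nra.
Qed.

Lemma exp_tower : decaying_tower (fun n u => (-1) ^ S n * exp (- u)).
Proof.
  split; [|split].
  - intros n u Hu. auto_derive; auto. simpl; ring.
  - intros n; exists 4; intros u Hu. rewrite Rabs_mult, pow_1_abs, Rmult_1_l.
    rewrite Rabs_pos_eq by (left; apply exp_pos). now apply exp_decay_bound.
  - apply (decay_lim _ 4). intros u Hu. rewrite Rabs_mult, pow_1_abs, Rmult_1_l.
    rewrite Rabs_pos_eq by (left; apply exp_pos). now apply exp_decay_bound.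
Qed.

Lemma exp_nat_mul n y : exp (INR n * y) = exp y ^ n.
Proof.
  induction n as [|n IH]; [simpl; now rewrite Rmult_0_l, exp_0|].
  rewrite S_INR, Rmult_plus_distr_r, exp_plus, IH, Rmult_1_l. simpl; ring.
Qed.

Lemma dilated_sum_exp t : 0 < t ->
  dilated_sum (fun u => (-1) ^ 2 * exp (- u)) t = t * (exp (- t) / (1 - exp (- t))).
Proof.
  intros Ht. assert (H := one_minus_exp_pos t Ht). assert (Hp := exp_pos (- t)).
  unfold dilated_sum. rewrite Series_scal_l. f_equal.
  rewrite (Series_ext _ (fun m => exp (- t) * exp (- t) ^ m)).
  - rewrite Series_scal_l, Series_geom; [reflexivity|]. rewrite Rabs_pos_eq; lra.
  - intros m. change (exp (- t) * exp (- t) ^ m) with (exp (- t) ^ S m).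
    replace ((-1) ^ 2) with 1 by ring. rewrite Rmult_1_l.
    rewrite <- exp_nat_mul. f_equal. ring.
Qed.

(** Euler-Maclaurin for e^{-u}, whose sum is a geometric series. *)
Lemma geometric_expansion K :
  bigO K (fun t => exp (- t) / (1 - exp (- t)) - / t
     - psum (fun i => z i * (-1) ^ i / INR (fact i) * t ^ i) K).
Proof.
  destruct (euler_maclaurin (em_coef z) Hz _ exp_tower (S K) 0) as [C H].
  exists C. intros t Ht. specialize (H t Ht). cbn beta in H.
  rewrite (dilated_sum_exp t), psum_first in H by lra.
  rewrite (psum_ext _ (fun i => t * (z i * (-1) ^ i / INR (fact i) * t ^ i))) in H.
  - rewrite psum_scal in H. cbn [em_coef Nat.add] in H. rewrite Ropp_0, exp_0 in H.
    apply Rmult_le_reg_l with t; [lra|].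
    rewrite <- (Rabs_pos_eq t) at 1 by lra. rewrite <- Rabs_mult.
    replace (t * (C * t ^ K)) with (C * t ^ S K) by (simpl; ring).
    match type of H with Rabs ?a <= _ => match goal with |- Rabs ?b <= _ => replace b with a; [exact H|] end end.
    simpl pow. assert (Hq := one_minus_exp_pos t ltac:(lra)). field. lra.
  - intros i _. cbn [em_coef Nat.add]. rewrite Ropp_0, exp_0. simpl pow. field. apply INR_fact_neq_0.
Qed.

(** The function expanded in [geometric_expansion] is the derivative of
    log ((1 - e^{-t})/t); integrate it from 0. *)
Lemma log_expansion K :
  bigO (S K) (fun t => ln ((1 - exp (- t)) / t)
     - psum (fun i => z i * (-1) ^ i / INR (fact (S i)) * t ^ S i) K).
Proof.
  destruct (geometric_expansion K) as [C H].
  assert (C0 : 0 <= C).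
  { specialize (H 1 ltac:(lra)). rewrite pow1, Rmult_1_r in H.
    eapply Rle_trans; [apply Rabs_pos|exact H]. }
  exists C. intros t Ht.
  set (p := fun t => psum (fun i => z i * (-1) ^ i / INR (fact (S i)) * t ^ S i) K).
  set (r := fun t => ln ((1 - exp (- t)) / t) - p t).
  set (r' := fun t => exp (- t) / (1 - exp (- t)) - / t
     - psum (fun i => z i * (-1) ^ i / INR (fact i) * t ^ i) K).
  assert (dp : forall s, is_derive p s (psum (fun i => z i * (-1) ^ i / INR (fact i) * s ^ i) K)).
  { intros s. unfold p. clear. induction K as [|n IH]; cbn [psum].
    - apply (is_derive_const (V := RN)).
    - apply (is_derive_plus (V := RN)); auto.
      set (a := z n * (-1) ^ n). rewrite fact_simpl, mult_INR.
      assert (H1 := INR_fact_neq_0 n). assert (H2 : INR (S n) <> 0) by (apply not_0_INR; lia).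
      auto_derive; auto. cbn [pred]. unfold Rdiv. 
      change (match n with O => 1 | S _ => INR n + 1 end) with (INR (S n)). field; auto. }
  assert (dr : forall s, 0 < s -> is_derive r s (r' s)).
  { intros s Hs. assert (Hq := one_minus_exp_pos s Hs).
    apply (is_derive_minus (V := RN)); [|apply dp].
    auto_derive.
    - split; [lra|]. split; auto. apply Rdiv_lt_0_compat; lra.
    - field. lra. }
  (* the formula for r degenerates at 0, so the mean value theorem is applied on [s, t] with s -> 0 *)
  assert (Hr0 : exists D, forall s, 0 < s <= 1 -> Rabs (r s) <= D * s).
  { assert (Hp : bigO 1 p).
    { unfold p. apply bigO_psum. intros i _. apply bigO_scal.
      exists 1. intros s Hs. rewrite Rabs_pos_eq by (apply pow_le; lra).
      rewrite pow_1, Rmult_1_l. simpl. rewrite <- (Rmult_1_r s) at 3. apply Rmult_le_compat_l; [lra|].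
      rewrite <- (pow1 i). apply pow_incr; lra. }
    destruct Hp as [D HD]. exists (1 + D). intros s Hs.
    specialize (HD s Hs). rewrite pow_1 in HD.
    assert (Hq := one_minus_exp_pos s ltac:(lra)).
    assert (Hl : Rabs (ln ((1 - exp (- s)) / s)) <= s).
    { apply Rabs_le_between; split.
      - apply Rle_trans with (ln (exp (- s))); [rewrite ln_exp; lra|].
        apply ln_le; [apply exp_pos|].
        apply Rmult_le_reg_r with (s * exp s); [apply Rmult_lt_0_compat; [lra|apply exp_pos]|].
        rewrite exp_Ropp. assert (He := exp_pos s). assert (H1 := exp_ineq1_le s).
        replace (/ exp s * (s * exp s)) with s by (field; lra).
        replace ((1 - / exp s) / s * (s * exp s)) with (exp s - 1) by (field; lra). lra.
      - apply Rle_trans with 0; [|lra]. rewrite <- ln_1. apply ln_le; [apply Rdiv_lt_0_compat; lra|].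
        apply Rmult_le_reg_r with s; [lra|]. unfold Rdiv. rewrite Rmult_assoc, Rinv_l by lra.
        assert (H1 := exp_ineq1_le (- s)). lra. }
    unfold r. eapply Rle_trans; [apply (Rabs_triang (ln ((1 - exp (- s)) / s)) (- p s))|]. rewrite Rabs_Ropp. lra. }
  destruct Hr0 as [D HD].
  apply (le_of_small _ _ D t); [lra|]. intros s Hs.
    assert (Hmv : Rabs (r t - r s) <= C * t ^ S K).
    { destruct (mean_value r r' s t ltac:(lra)) as [y [Hy E]]; [intros; apply dr; lra|].
      rewrite E, Rabs_mult, (Rabs_pos_eq (t - s)) by lra.
      specialize (H y ltac:(lra)). fold (r' y) in H.
      replace (C * t ^ S K) with (C * t ^ K * t) by (simpl; ring).
      apply Rmult_le_compat; [apply Rabs_pos|lra| |lra].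
      eapply Rle_trans; [exact H|]. apply Rmult_le_compat_l; auto. apply pow_incr; lra. }
    specialize (HD s ltac:(lra)).
    assert (E0 : r t = (r t - r s) + r s) by ring.
    change (Rabs (r t) <= C * t ^ S K + D * s). rewrite E0.
    eapply Rle_trans; [apply Rabs_triang|]. lra.
Qed.

End ExponentialSums.

(** * The Lambert series of - log (q^x, q)_oo *)

Lemma log_series w : 0 <= w < 1 -> is_series (fun m => w ^ S m / INR (S m)) (- ln (1 - w)).
Proof.
  intros Hw.
  set (a := fun n : nat => match n with O => 0 | S k => / INR (S k) end).
  assert (Ha : forall n, Rabs (a n) <= 1).
  { intros [|n]; unfold a; [rewrite Rabs_R0; lra|].
    assert (H := lt_0_INR (S n) ltac:(lia)). 
    rewrite Rabs_pos_eq by (left; now apply Rinv_0_lt_compat).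
    apply Rle_trans with (/ 1); [|rewrite Rinv_1; lra].
    apply Rinv_le_contravar; [lra|]. apply (le_INR 1); lia. }
  assert (Hcv : forall z, 0 <= z < 1 -> Rbar_lt (Rabs z) (CV_radius a)).
  { intros z Hz. apply CV_radius_gt with ((1 + z) / 2).
    - rewrite Rabs_pos_eq; lra.
    - apply (ex_series_abs_le _ (fun n => ((1 + z) / 2) ^ n)).
      + intros n. rewrite Rabs_mult, Rabs_Rabsolu.
        assert (H : 0 <= ((1 + z) / 2) ^ n) by (apply pow_le; lra).
        rewrite (Rabs_pos_eq (_ ^ n)) by auto.
        rewrite <- (Rmult_1_l (_ ^ n)) at 2. apply Rmult_le_compat_r; auto.
      + apply ex_series_geom. rewrite Rabs_pos_eq; lra. }
  assert (Hd : forall z, 0 <= z < 1 -> is_derive (fun z => PSeries a z + ln (1 - z)) z 0).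
  { intros z Hz.
    replace 0 with (/ (1 - z) + - / (1 - z)) by ring.
    apply (is_derive_plus (V := RN)).
    - replace (/ (1 - z)) with (PSeries (PS_derive a) z); [now apply is_derive_PSeries, Hcv|].
      unfold PSeries. rewrite (Series_ext _ (fun n => z ^ n)).
      + rewrite Series_geom; auto. rewrite Rabs_pos_eq; lra.
      + intros n. unfold PS_derive, a. rewrite Rinv_r by (apply not_0_INR; lia). ring.
    - auto_derive; [lra|field; lra]. }
  assert (E : PSeries a w + ln (1 - w) = 0).
  { assert (E0 : PSeries a 0 + ln (1 - 0) = 0).
    { rewrite PSeries_0, Rminus_0_r, ln_1. simpl. ring. }
    destruct (Req_dec w 0) as [->|Hn]; auto.
    assert (Hw0 : 0 < w) by lra.
    rewrite <- E0. symmetry.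
    apply (eq_is_derive (V := RN) (fun z => PSeries a z + ln (1 - z)) 0 w); auto.
    intros z Hz; apply Hd; lra. }
  assert (Hs : is_series (fun k => a k * w ^ k) (PSeries a w)).
  { apply is_pseries_R, PSeries_correct, CV_radius_inside, Hcv; auto. }
  apply is_series_ext with (fun m => a (S m) * w ^ S m).
  { intros m; unfold a, Rdiv; rewrite Rmult_comm; reflexivity. }
  apply (is_series_incr_1 (V := RN) (fun k => a k * w ^ k)).
  eapply is_series_eq; [exact Hs|]. unfold plus; simpl. lra.
Qed.

Definition lambert_kernel (y u : R) : R := exp (- (y * u)) / (1 - exp (- u)).

Definition lambert_term (y t : R) (m : nat) : R := lambert_kernel y (INR (S m) * t) / INR (S m).

Definition lambert_sum (y t : R) : R := Series (lambert_term y t).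

Lemma scaled_pos m t : 0 < t -> 0 < INR (S m) * t.
Proof. intros Ht; apply Rmult_lt_0_compat; auto. apply lt_0_INR; lia. Qed.

Lemma lambert_term_pos y t m : 0 < t -> 0 < lambert_term y t m.
Proof.
  intros Ht. unfold lambert_term, lambert_kernel.
  assert (H := one_minus_exp_pos _ (scaled_pos m t Ht)).
  apply Rdiv_lt_0_compat; [apply Rdiv_lt_0_compat; auto using exp_pos|apply lt_0_INR; lia].
Qed.

Lemma lambert_summable y t : 0 < y -> 0 < t -> ex_series (lambert_term y t).
Proof.
  intros Hy Ht.
  assert (Hq := one_minus_exp_pos t Ht).
  apply (ex_series_abs_le _ (fun m => / (1 - exp (- t)) * (exp (- (y * t)) ^ m))).
  - intros m. rewrite Rabs_pos_eq by (left; now apply lambert_term_pos).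
    unfold lambert_term, lambert_kernel.
    assert (H1 : 1 <= INR (S m)) by (apply (le_INR 1); lia).
    assert (H2 := one_minus_exp_pos _ (scaled_pos m t Ht)).
    assert (H3 : 1 - exp (- t) <= 1 - exp (- (INR (S m) * t))).
    { assert (exp (- (INR (S m) * t)) <= exp (- t)); [|lra]. apply exp_le_mono. nra. }
    rewrite <- exp_nat_mul.
    assert (H4 : exp (- (y * (INR (S m) * t))) <= exp (INR m * - (y * t))).
    { apply exp_le_mono. rewrite S_INR. assert (0 < y * t) by now apply Rmult_lt_0_compat. nra. }
    assert (Hp := exp_pos (- (y * (INR (S m) * t)))).
    unfold Rdiv. rewrite (Rmult_comm (exp _)), Rmult_assoc.
    apply Rmult_le_compat.
    + left; now apply Rinv_0_lt_compat.
    + apply Rmult_le_pos; [lra|]. left; apply Rinv_0_lt_compat; lra.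
    + now apply Rinv_le_contravar.
    + apply Rle_trans with (exp (- (y * (INR (S m) * t))) * 1); [|lra].
      apply Rmult_le_compat_l; [lra|]. rewrite <- Rinv_1. apply Rinv_le_contravar; lra.
  - apply (ex_series_scal (V := RN) (/ (1 - exp (- t)))).
    apply ex_series_geom. rewrite Rabs_pos_eq by (left; apply exp_pos).
    rewrite <- exp_0. apply exp_increasing. assert (0 < y * t) by now apply Rmult_lt_0_compat. lra.
Qed.

(** The difference of the terms is e^{-ymt}/m: this is the removal of one factor
    from the q-Pochhammer symbol. *)
Lemma lambert_sum_shift y t : 0 < y -> 0 < t ->
  lambert_sum y t - lambert_sum (y + 1) t = - ln (1 - exp (- (y * t))).
Proof.
  intros Hy Ht. assert (Hyt : 0 < y * t) by now apply Rmult_lt_0_compat.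
  unfold lambert_sum. rewrite <- Series_minus by (apply lambert_summable; lra).
  rewrite <- (is_series_unique _ _ (log_series (exp (- (y * t))) ltac:(split; [left; apply exp_pos|
     assert (H := one_minus_exp_pos _ Hyt); lra]))).
  apply Series_ext. intros m. unfold lambert_term, lambert_kernel.
  rewrite <- exp_nat_mul.
  assert (H2 := one_minus_exp_pos _ (scaled_pos m t Ht)).
  assert (H3 := lt_0_INR (S m) ltac:(lia)).
  replace (- ((y + 1) * (INR (S m) * t))) with (- (y * (INR (S m) * t)) + - (INR (S m) * t)) by ring.
  rewrite exp_plus. replace (INR (S m) * - (y * t)) with (- (y * (INR (S m) * t))) by ring.
  field. lra.
Qed.

Lemma lambert_sum_nonneg y t : 0 < y -> 0 < t -> 0 <= lambert_sum y t.
Proof.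
  intros Hy Ht. unfold lambert_sum.
  assert (H : forall m, 0 <= lambert_term y t m) by (intros m; left; now apply lambert_term_pos).
  eapply Rle_trans; [apply (H 0%nat)|].
  now apply (series_term_le _ _ 0%nat H), Series_correct, lambert_summable.
Qed.

Lemma lambert_sum_decay y t n : 0 < y -> 0 < t ->
  lambert_sum (y + INR n) t <= exp (- t) ^ n * lambert_sum y t.
Proof.
  intros Hy Ht. unfold lambert_sum. rewrite <- Series_scal_l.
  assert (Hn := pos_INR n).
  apply Series_le.
  - intros m; split; [left; now apply lambert_term_pos|].
    unfold lambert_term, lambert_kernel, Rdiv. rewrite <- !Rmult_assoc.
    apply Rmult_le_compat_r; [left; apply Rinv_0_lt_compat, lt_0_INR; lia|].
    apply Rmult_le_compat_r; [left; now apply Rinv_0_lt_compat, one_minus_exp_pos, scaled_pos|].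
    rewrite <- exp_nat_mul, <- exp_plus. apply exp_le_mono.
    assert (H1 : 1 <= INR (S m)) by (apply (le_INR 1); lia).
    assert (INR n * t <= INR n * (INR (S m) * t)) by (apply Rmult_le_compat_l; nra). nra.
  - apply (ex_series_scal (V := RN)). now apply lambert_summable.
Qed.

(** By [lambert_sum_shift] each factor is the exponential of a difference, and the
    differences telescope. *)
Lemma partial_pochhammer x t N : 0 < x -> 0 < t ->
  prod_f_R0 (fun i => 1 - exp (- (x * t)) * exp (- t) ^ i) N
  = exp (- (lambert_sum x t - lambert_sum (x + INR (S N)) t)).
Proof.
  intros Hx Ht.
  assert (Hstep : forall i, 1 - exp (- (x * t)) * exp (- t) ^ i
     = exp (- (lambert_sum (x + INR i) t - lambert_sum (x + INR (S i)) t))).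
  { intros i. assert (Hi := pos_INR i).
    rewrite S_INR, <- Rplus_assoc, lambert_sum_shift by lra.
    rewrite Ropp_involutive, <- exp_nat_mul, <- exp_plus.
    rewrite exp_ln.
    - do 2 f_equal. ring.
    - apply one_minus_exp_pos. apply Rmult_lt_0_compat; lra. }
  induction N as [|N IH].
  - cbn [prod_f_R0]. rewrite Hstep. simpl INR. now rewrite Rplus_0_r.
  - cbn [prod_f_R0]. rewrite IH, Hstep, <- exp_plus. f_equal. ring.
Qed.

Lemma qPochhammer_lambert x t : 0 < x -> 0 < t ->
  qPochhammer (Rpower (exp (- t)) x) (exp (- t)) = exp (- lambert_sum x t).
Proof.
  intros Hx Ht. unfold qPochhammer.
  rewrite (is_lim_seq_unique _ (exp (- lambert_sum x t))); auto.
  apply is_lim_seq_ext with (fun N => exp (- (lambert_sum x t - lambert_sum (x + INR (S N)) t))).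
  { intros N. rewrite <- partial_pochhammer by auto.
    unfold Rpower. rewrite ln_exp. now replace (x * - t) with (- (x * t)) by ring. }
  assert (Hl : is_lim_seq (fun N => lambert_sum (x + INR (S N)) t) 0).
  { apply (is_lim_seq_incr_1 (fun N => lambert_sum (x + INR N) t)).
    apply (is_lim_seq_le_le (fun _ => 0) _ (fun N => exp (- t) ^ N * lambert_sum x t)).
    - intros n; split; [|now apply lambert_sum_decay].
      apply lambert_sum_nonneg; auto. assert (H := pos_INR n); lra.
    - apply is_lim_seq_const.
    - replace (Finite 0) with (Rbar_mult 0 (lambert_sum x t)) by (simpl; f_equal; ring).
      apply is_lim_seq_scal_r. apply is_lim_seq_geom.
      rewrite Rabs_pos_eq by (left; apply exp_pos). assert (H := one_minus_exp_pos t Ht); lra. }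
  apply (is_lim_seq_continuous exp (fun N => - (lambert_sum x t - lambert_sum (x + INR (S N)) t))).
  - apply derivable_continuous_pt, derivable_pt_exp.
  - replace (Finite (- lambert_sum x t)) with (Rbar_opp (Finite (lambert_sum x t - 0)))
      by (simpl; f_equal; ring).
    apply -> is_lim_seq_opp. apply is_lim_seq_minus'; [apply is_lim_seq_const|exact Hl].
Qed.

Definition zeta2 : R := Series (fun m => / INR (S m) ^ 2).

Lemma zeta2_summable : ex_series (fun m => / INR (S m) ^ 2).
Proof.
  apply (ex_series_incr_1 (V := RN) (fun m => / INR (S m) ^ 2)).
  exact inv_base_sq_summable.
Qed.

Section Expansion.

Variables (x : R) (c : nat -> R).
Hypothesis Hx : 0 < x.
Hypothesis Hc : locally' 0 (fun t => is_pseries c t (t * exp (x * t) / (exp t - 1))).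

Lemma lambert_split t : 0 < t ->
  lambert_sum x t = zeta2 / t + c 1%nat * ln (1 - exp (- t)) + dilated_sum (kernel_rest x c) t.
Proof.
  intros Ht.
  assert (Hw : 0 <= exp (- t) < 1).
  { split; [left; apply exp_pos|]. assert (H := one_minus_exp_pos t Ht); lra. }
  assert (H1 := is_series_scal (V := RN) (- / t) _ _ (Series_correct _ zeta2_summable)).
  assert (H2 := is_series_scal (V := RN) (c 1%nat) _ _ (log_series _ Hw)).
  assert (H3 := Series_correct _ (lambert_summable x t Hx Ht)).
  assert (H := is_series_plus (V := RN) _ _ _ _ (is_series_plus (V := RN) _ _ _ _ H3 H1) H2).
  assert (E : dilated_sum (kernel_rest x c) t = lambert_sum x t + - / t * zeta2 + c 1%nat * - ln (1 - exp (- t))).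
  { unfold dilated_sum. apply is_series_unique. eapply is_series_ext; [|exact H].
    intros m.
    change (lambert_term x t m + - / t * / INR (S m) ^ 2 + c 1%nat * (exp (- t) ^ S m / INR (S m))
      = t * kernel_rest x c (INR (S m) * t)).
    unfold lambert_term, lambert_kernel, kernel_rest.
    rewrite Rmult_1_l, <- exp_nat_mul.
    replace (INR (S m) * - t) with (- (INR (S m) * t)) by ring.
    assert (G2 := one_minus_exp_pos _ (scaled_pos m t Ht)).
    assert (G3 := lt_0_INR (S m) ltac:(lia)).
    set (N := INR (S m)) in *. clearbody N.
    field. lra. }
  rewrite E. field. lra.
Qed.

Variable z : nat -> R.
Hypothesis Hz : em_recursion (em_coef z).

(** The second summands of the [kernel_coef] and the expansion of
    log ((1 - e^{-t})/t) cancel. *)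
Lemma lambert_expansion : exists I, forall K,
  bigO (S K) (fun t => lambert_sum x t - (zeta2 / t + c 1%nat * ln t + I
     + psum (fun i => z i * (-1) ^ i * c (S (S i)) * t ^ S i) K)).
Proof.
  destruct (kernel_rest_expansion x c Hx Hc z Hz) as [I HI].
  exists I. intros K.
  assert (Hl := log_expansion z Hz K).
  eapply bigO_ext; [|exact (bigO_plus _ _ _ (HI K) (bigO_scal _ (c 1%nat) _ Hl))].
  intros t Ht. cbn beta. rewrite lambert_split by lra.
  assert (Hq := one_minus_exp_pos t ltac:(lra)).
  unfold Rdiv at 1. rewrite ln_mult by (auto; apply Rinv_0_lt_compat; lra). rewrite ln_Rinv by lra.
  rewrite (psum_ext (fun i => z i * kernel_coef c i * t ^ S i)
    (fun i => z i * (-1) ^ i * c (S (S i)) * t ^ S i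
        + - c 1%nat * (z i * (-1) ^ i / INR (fact (S i)) * t ^ S i))).
  - rewrite psum_plus, psum_scal. ring.
  - intros i _. unfold kernel_coef. change ((-1) ^ S i) with (-1 * (-1) ^ i). unfold Rdiv. ring.
Qed.

End Expansion.

(** * The constant term *)

Definition is_lambert_constant (y I : R) : Prop :=
  bigO 1 (fun t => lambert_sum y t - (zeta2 / t + (y - 1 / 2) * ln t + I)).

Lemma bigO1_le (F G : R -> R) a b :
  bigO 1 (fun t => F t - a) -> bigO 1 (fun t => G t - b) ->
  (forall t, 0 < t <= 1 -> F t <= G t) -> a <= b.
Proof.
  intros [C1 H1] [C2 H2] HFG. apply (le_of_small a b (C1 + C2) 1 Rlt_0_1). intros t Ht.
  specialize (H1 t Ht); specialize (H2 t Ht); specialize (HFG t Ht).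
  rewrite pow_1 in H1, H2. apply Rabs_le_between in H1. apply Rabs_le_between in H2. lra.
Qed.

Lemma bigO1_eq (F : R -> R) a b :
  bigO 1 (fun t => F t - a) -> bigO 1 (fun t => F t - b) -> a = b.
Proof.
  intros H1 H2. apply Rle_antisym; [apply (bigO1_le F F)|apply (bigO1_le F F)]; auto; intros; lra.
Qed.

Definition lambert_reg (y t : R) : R := lambert_sum y t - zeta2 / t - (y - 1 / 2) * ln t.

Lemma lambert_constant_reg y I : is_lambert_constant y I <-> bigO 1 (fun t => lambert_reg y t - I).
Proof.
  split; apply bigO_ext; intros t Ht; unfold lambert_reg; ring.
Qed.

Lemma lambert_constant_unique y I I' :
  is_lambert_constant y I -> is_lambert_constant y I' -> I = I'.
Proof. rewrite !lambert_constant_reg. apply bigO1_eq. Qed.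

Lemma log_one_minus_exp_bigO y : 0 < y -> bigO 1 (fun t => ln (1 - exp (- (y * t))) - ln t - ln y).
Proof.
  intros Hy. exists y. intros t Ht. rewrite pow_1.
  set (s := y * t). assert (Hs : 0 < s) by (apply Rmult_lt_0_compat; lra).
  replace (ln (1 - exp (- s)) - ln t - ln y) with (ln (1 - exp (- s)) - ln s)
    by (unfold s; rewrite ln_mult by lra; ring).
  assert (Hq := one_minus_exp_pos s Hs).
  apply Rabs_le_between; split.
  - assert (ln (exp (- s) * s) <= ln (1 - exp (- s))).
    { apply ln_le; [apply Rmult_lt_0_compat; auto using exp_pos|].
      apply Rmult_le_reg_r with (exp s); [apply exp_pos|].
      rewrite exp_Ropp. assert (He := exp_pos s). assert (H1 := exp_ineq1_le s).
      replace (/ exp s * s * exp s) with s by (field; lra).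
      replace ((1 - / exp s) * exp s) with (exp s - 1) by (field; lra). lra. }
    rewrite ln_mult, ln_exp in H by (auto using exp_pos). lra.
  - assert (ln (1 - exp (- s)) <= ln s); [|lra].
    apply ln_le; auto. assert (H1 := exp_ineq1_le (- s)). lra.
Qed.

Lemma lambert_constant_succ y I : 0 < y ->
  is_lambert_constant y I -> is_lambert_constant (y + 1) (I + ln y).
Proof.
  rewrite !lambert_constant_reg. intros Hy H.
  eapply bigO_ext; [|exact (bigO_plus _ _ _ H (log_one_minus_exp_bigO y Hy))].
  intros t Ht. cbn beta. unfold lambert_reg.
  assert (E := lambert_sum_shift y t Hy ltac:(lra)). lra.
Qed.

(** The inequality v^s <= 1 - s + s v gives the convexity of the Lambert series in
    y and the logarithmic convexity of Gamma alike. *)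
Lemma weighted_amgm v s : 0 < v -> 0 <= s <= 1 -> exp (s * ln v) <= 1 - s + s * v.
Proof.
  intros Hv Hs.
  (* tangent line of the convex function exp at s ln v *)
  assert (T : forall a b, exp a + exp a * (b - a) <= exp b).
  { intros a b. replace b with (a + (b - a)) at 2 by ring. rewrite exp_plus.
    assert (H := exp_ineq1_le (b - a)). assert (Hp := exp_pos a). nra. }
  assert (H0 := T (s * ln v) 0). assert (H1 := T (s * ln v) (ln v)).
  rewrite exp_0 in H0. rewrite exp_ln in H1 by auto.
  set (e := exp (s * ln v)) in *. set (l := ln v) in *. nra.
Qed.

Lemma lambert_sum_convex y s t : 0 < y -> 0 <= s <= 1 -> 0 < t ->
  lambert_sum (y + s) t <= (1 - s) * lambert_sum y t + s * lambert_sum (y + 1) t.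
Proof.
  intros Hy Hs Ht. unfold lambert_sum.
  assert (E1 := lambert_summable y t Hy Ht). assert (E2 := lambert_summable (y + 1) t ltac:(lra) Ht).
  rewrite <- !Series_scal_l, <- Series_plus by (apply (ex_series_scal (V := RN)); auto).
  apply Series_le.
  2:{ apply (ex_series_plus (V := RN)); apply (ex_series_scal (V := RN)); auto. }
  intros m; split; [left; now apply lambert_term_pos|].
  unfold lambert_term, lambert_kernel, Rdiv.
  assert (G2 := one_minus_exp_pos _ (scaled_pos m t Ht)).
  assert (G3 := lt_0_INR (S m) ltac:(lia)).
  set (u := INR (S m) * t) in *.
  assert (Ha := weighted_amgm (exp (- u)) s (exp_pos _) Hs). rewrite ln_exp in Ha.
  replace (- ((y + s) * u)) with (- (y * u) + s * - u) by ring.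
  replace (- ((y + 1) * u)) with (- (y * u) + - u) by ring.
  rewrite !exp_plus.
  assert (Hp := exp_pos (- (y * u))).
  apply Rle_trans with (exp (- (y * u)) * (1 - s + s * exp (- u)) * / (1 - exp (- u)) * / INR (S m));
    [|right; ring].
  apply Rmult_le_compat_r; [left; now apply Rinv_0_lt_compat|].
  apply Rmult_le_compat_r; [left; now apply Rinv_0_lt_compat|].
  apply Rmult_le_compat_l; lra.
Qed.

Lemma lambert_constant_convex y s I I' : 0 < y -> 0 <= s <= 1 ->
  is_lambert_constant y I -> is_lambert_constant (y + s) I' -> I' <= I + s * ln y.
Proof.
  intros Hy Hs H H'. assert (H1 := lambert_constant_succ y I Hy H).
  rewrite lambert_constant_reg in *.
  replace (I + s * ln y) with ((1 - s) * I + s * (I + ln y)) by ring.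
  apply (bigO1_le (lambert_reg (y + s)) (fun t => (1 - s) * lambert_reg y t + s * lambert_reg (y + 1) t)); auto.
  - eapply bigO_ext; [|exact (bigO_plus _ _ _ (bigO_scal _ (1 - s) _ H) (bigO_scal _ s _ H1))].
    intros t Ht; cbn beta; ring.
  - intros t Ht. unfold lambert_reg.
    assert (Hcv := lambert_sum_convex y s t Hy Hs ltac:(lra)).
    assert (E : (1 - s) * (lambert_sum y t - zeta2 / t - (y - 1 / 2) * ln t)
      + s * (lambert_sum (y + 1) t - zeta2 / t - (y + 1 - 1 / 2) * ln t)
      = (1 - s) * lambert_sum y t + s * lambert_sum (y + 1) t - zeta2 / t - (y + s - 1 / 2) * ln t) by ring.
    lra.
Qed.

Lemma lambert_sum_duplication t : 0 < t ->
  lambert_sum (1 / 2) t + lambert_sum 1 t = lambert_sum 1 (t / 2).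
Proof.
  intros Ht. unfold lambert_sum. rewrite <- Series_plus by (apply lambert_summable; lra).
  apply Series_ext. intros m. unfold lambert_term, lambert_kernel.
  set (u := INR (S m) * t). replace (INR (S m) * (t / 2)) with (u / 2) by (unfold u; field).
  assert (Hu : 0 < u) by now apply scaled_pos.
  assert (G2 := one_minus_exp_pos (u / 2) ltac:(lra)).
  assert (G3 := lt_0_INR (S m) ltac:(lia)).
  set (w := exp (- (u / 2))) in *. assert (Hw : 0 < w) by apply exp_pos.
  assert (E : exp (- u) = w * w) by (unfold w; rewrite <- exp_plus; f_equal; field).
  replace (- (1 / 2 * u)) with (- (u / 2)) by field. rewrite !Rmult_1_l.
  rewrite E. fold w. field. split; [lra|]. split; [lra|nra].
Qed.

(** The constants at 1 cancel in the duplication formula, and the logarithm of t/2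
    leaves log 2. *)
Lemma lambert_constant_half I1 I2 :
  is_lambert_constant (1 / 2) I2 -> is_lambert_constant 1 I1 -> I2 = - (ln 2 / 2).
Proof.
  intros H2 H1. rewrite lambert_constant_reg in *.
  assert (H : bigO 1 (fun t => lambert_reg 1 (t / 2) - I1)).
  { destruct H1 as [C H1]. exists (C / 2). intros t Ht. rewrite pow_1.
    specialize (H1 (t / 2) ltac:(lra)). rewrite pow_1 in H1. lra. }
  assert (E : I2 + I1 + (ln 2 / 2) = I1); [|lra].
  apply (bigO1_eq (fun t => lambert_reg 1 (t / 2))); auto.
  eapply bigO_ext; [|exact (bigO_plus _ _ _ H2 H1)].
  intros t Ht; cbn beta. unfold lambert_reg.
  rewrite <- lambert_sum_duplication by lra. 
  assert (El : ln (t / 2) = ln t - ln 2) by (unfold Rdiv; rewrite ln_mult, ln_Rinv by lra; ring).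
  rewrite El.
  field. lra.
Qed.

(** * A characterization of Gamma *)

(** The middle condition is the part of logarithmic convexity between y and y + 1
    that determines the function; it is linear in g, so it can be checked by
    integrating a pointwise inequality. *)
Definition gamma_like (g : R -> R) : Prop :=
  (forall y, 0 < y -> g (y + 1) = y * g y) /\
  (forall y s, 0 < y -> 0 <= s <= 1 -> g (y + s) <= exp (s * ln y) * g y) /\
  g 1 = 1.

Lemma gamma_like_fact g n : gamma_like g -> g (INR n + 1) = INR (fact n).
Proof.
  intros [H1 [_ H3]]. induction n as [|n IH].
  - simpl. rewrite Rplus_0_l. exact H3.
  - rewrite S_INR, H1 by (assert (H := pos_INR n); lra). rewrite IH.
    rewrite fact_simpl, mult_INR, S_INR. reflexivity.
Qed.

Fixpoint rising_real (s : R) (n : nat) : R :=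
  match n with O => 1 | S n' => (s + INR n') * rising_real s n' end.

Lemma rising_real_pos s n : 0 < s -> 0 < rising_real s n.
Proof.
  intros Hs; induction n as [|n IH]; simpl; [lra|].
  apply Rmult_lt_0_compat; auto. assert (H := pos_INR n); lra.
Qed.

Lemma gamma_like_rising g s n : gamma_like g -> 0 < s -> g (s + INR n) = rising_real s n * g s.
Proof.
  intros [H1 _] Hs; induction n as [|n IH]; [simpl; rewrite Rplus_0_r; ring|].
  rewrite S_INR, <- Rplus_assoc, H1 by (assert (H := pos_INR n); lra).
  rewrite IH; simpl; ring.
Qed.

(** Both values lie between bounds in terms of n! that differ by the factor
    1 + 1/(n+1). *)
Lemma gamma_like_compare g h s n : gamma_like g -> gamma_like h -> 0 < s <= 1 ->
  g (s + INR (S n)) <= (1 + / INR (S n)) * h (s + INR (S n)).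
Proof.
  intros Hg Hh Hs.
  assert (Fg := gamma_like_fact g n Hg). assert (Fh := gamma_like_fact h n Hh).
  destruct Hg as [_ [Cg _]], Hh as [Rh [Ch _]].
  assert (HN := lt_0_INR (S n) ltac:(lia)). rewrite <- S_INR in Fg, Fh.
  set (N := INR (S n)) in *. rewrite (Rplus_comm s N).
  assert (A := Cg N s HN ltac:(lra)). rewrite Fg in A.
  assert (B := Ch (N + s) (1 - s) ltac:(lra) ltac:(lra)).
  replace (N + s + (1 - s)) with (N + 1) in B by ring. rewrite Rh, Fh in B by lra.
  set (F := INR (fact n)) in *. assert (HF : 0 < F) by apply INR_fact_lt_0.
  set (X := h (N + s)) in *. set (Y := g (N + s)) in *.
  set (p := exp (s * ln N)) in *. set (q := exp ((1 - s) * ln (N + s))) in *.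
  assert (Hp : 0 < p) by apply exp_pos. assert (Hq : 0 < q) by apply exp_pos.
  assert (HX : 0 < X) by nra.
  assert (Hpq : p * q <= N + 1).
  { unfold p, q. rewrite <- exp_plus.
    apply Rle_trans with (exp (s * ln (N + 1) + (1 - s) * ln (N + 1))).
    - apply exp_le_mono. apply Rplus_le_compat; (apply Rmult_le_compat_l; [lra|]); apply ln_le; lra.
    - replace (s * ln (N + 1) + (1 - s) * ln (N + 1)) with (ln (N + 1)) by ring.
      rewrite exp_ln; lra. }
  apply Rmult_le_reg_l with N; auto.
  replace (N * ((1 + / N) * X)) with ((N + 1) * X) by (field; lra).
  apply Rle_trans with (N * (p * F)); [apply Rmult_le_compat_l; lra|].
  replace (N * (p * F)) with (p * (N * F)) by ring.
  apply Rle_trans with (p * (q * X)); [apply Rmult_le_compat_l; lra|].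
  rewrite <- Rmult_assoc. apply Rmult_le_compat_r; lra.
Qed.

Lemma gamma_like_le_unit g h s : gamma_like g -> gamma_like h -> 0 < s <= 1 -> g s <= h s.
Proof.
  intros Hg Hh Hs.
  apply le_of_scaled. intros n. assert (A := gamma_like_compare g h s n Hg Hh Hs).
  rewrite (gamma_like_rising g), (gamma_like_rising h) in A by (auto; lra).
  assert (P := rising_real_pos s (S n) ltac:(lra)).
  apply Rmult_le_reg_l with (rising_real s (S n)); auto. lra.
Qed.

Lemma gamma_like_unique g h y : gamma_like g -> gamma_like h -> 0 < y -> g y = h y.
Proof.
  intros Hg Hh.
  assert (H : forall n y, 0 < y <= INR (S n) -> g y = h y).
  { induction n as [|n IH]; intros z Hz.
    - simpl in Hz. apply Rle_antisym; apply gamma_like_le_unit; auto.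
    - destruct (Rle_or_lt z 1) as [H1|H1].
      + apply IH. split; [lra|]. apply Rle_trans with 1; auto. apply (le_INR 1); lia.
      + replace z with (z - 1 + 1) by ring.
        rewrite (proj1 Hg), (proj1 Hh) by lra. rewrite IH; auto.
        rewrite S_INR in Hz. lra. }
  intros Hy. destruct (nfloor_ex y ltac:(lra)) as [n [Hn1 Hn2]].
  apply (H n). rewrite S_INR; lra.
Qed.

Lemma gamma_like_pos g y : gamma_like g -> 0 < y -> 0 < g y.
Proof.
  intros Hg Hy. destruct (nfloor_ex y ltac:(lra)) as [n [Hn1 Hn2]].
  assert (F := gamma_like_fact g (S n) Hg).
  destruct Hg as [H1 [H2 _]].
  (* y lies in [n, n+1], and the bound from y + 1 to n + 2 involves g (n + 2) = (n + 1)! > 0 *)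
  assert (A := H2 (y + 1) (INR n + 1 - y) ltac:(lra) ltac:(lra)).
  replace (y + 1 + (INR n + 1 - y)) with (INR (S n) + 1) in A by (rewrite S_INR; ring).
  rewrite F, H1 in A by auto. assert (HF := INR_fact_lt_0 (S n)).
  set (e := exp _) in A. assert (He : 0 < e) by apply exp_pos.
  assert (He2 : 0 < e * y) by now apply Rmult_lt_0_compat. nra.
Qed.

Definition wallis (n : nat) : R := RInt (fun x => sin x ^ n) 0 (PI / 2).

Lemma sin_pow_continuous n x : continuous (fun x => sin x ^ n) x.
Proof.
  apply (ex_derive_continuous (V := RN)). auto_derive; auto.
Qed.

Lemma wallis_0 : wallis 0 = PI / 2.
Proof.
  unfold wallis. rewrite (RInt_ext _ (fun _ => 1)) by (intros; reflexivity).
  rewrite RInt_const. unfold scal; simpl; unfold mult; simpl. ring.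
Qed.

Lemma wallis_1 : wallis 1 = 1.
Proof.
  unfold wallis. apply is_RInt_unique.
  replace 1 with (minus (- cos (PI / 2)) (- cos 0)).
  - apply (is_RInt_derive (V := RCN) (fun x => - cos x)).
    + intros x _. auto_derive; auto. simpl; ring.
    + intros x _. apply sin_pow_continuous.
  - rewrite cos_PI2, cos_0. unfold minus, plus, opp; simpl; ring.
Qed.

(** The two sides differ by the integral of the derivative of sin^{n+1} cos. *)
Lemma wallis_rec n : INR (S (S n)) * wallis (S (S n)) = INR (S n) * wallis n.
Proof.
  assert (E : forall k, ex_RInt (fun x => sin x ^ k) 0 (PI / 2)).
  { intros k. apply (ex_RInt_continuous (V := RCN)). intros z _. apply sin_pow_continuous. }
  assert (H : is_RInt (fun x => INR (S n) * sin x ^ n - INR (S (S n)) * sin x ^ S (S n)) 0 (PI / 2)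
     (minus (sin (PI / 2) ^ S n * cos (PI / 2)) (sin 0 ^ S n * cos 0))).
  { apply (is_RInt_derive (V := RCN) (fun x => sin x ^ S n * cos x)).
    - intros x _. auto_derive; auto. cbn [pred].
      change (match n with O => 1 | S _ => INR n + 1 end) with (INR (S n)).
      rewrite (S_INR (S n)). simpl pow.
      assert (Hc : cos x * cos x = 1 - sin x * sin x) by (assert (H := sin2_cos2 x); unfold Rsqr in H; lra).
      transitivity (INR (S n) * sin x ^ n * (cos x * cos x) - sin x * sin x * sin x ^ n); [ring|].
      rewrite Hc. ring.
    - intros x _. apply (ex_derive_continuous (V := RN)). auto_derive; auto. }
  rewrite cos_PI2, sin_0, pow_i in H by lia.
  assert (H2 := is_RInt_minus (V := RN) _ _ _ _ _ _
    (is_RInt_scal (V := RN) _ _ _ (INR (S n)) _ (RInt_correct (V := RCN) _ _ _ (E n)))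
    (is_RInt_scal (V := RN) _ _ _ (INR (S (S n))) _ (RInt_correct (V := RCN) _ _ _ (E (S (S n)))))).
  apply (is_RInt_unique (V := RCN)) in H.
  apply (is_RInt_unique (V := RCN)) in H2.
  assert (H3 : INR (S n) * wallis n - INR (S (S n)) * wallis (S (S n)) = 0); [|lra].
  refine (eq_trans _ (eq_trans (eq_trans (eq_sym H2) H) _)).
  - reflexivity.
  - unfold minus, plus, opp; simpl; ring.
Qed.

Lemma wallis_decr n : wallis (S n) <= wallis n.
Proof.
  unfold wallis. assert (HP := PI_RGT_0).
  apply RInt_le; [lra| | |].
  1,2: apply (ex_RInt_continuous (V := RCN)); intros z _; apply sin_pow_continuous.
  intros x Hx. assert (H1 := SIN_bound x).
  assert (H0 : 0 <= sin x) by (apply sin_ge_0; lra).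
  simpl. rewrite <- (Rmult_1_l (sin x ^ n)) at 2.
  apply Rmult_le_compat_r; [now apply pow_le|lra].
Qed.

Lemma wallis_pos n : 0 < wallis n.
Proof.
  assert (H : 0 < wallis n /\ 0 < wallis (S n)); [|apply H].
  induction n as [|n [IH1 IH2]].
  - rewrite wallis_0, wallis_1. assert (H := PI_RGT_0). lra.
  - split; auto. assert (R := wallis_rec n).
    assert (H1 := lt_0_INR (S n) ltac:(lia)). assert (H2 := lt_0_INR (S (S n)) ltac:(lia)).
    apply Rmult_lt_reg_l with (INR (S (S n))); auto. rewrite R, Rmult_0_r.
    now apply Rmult_lt_0_compat.
Qed.

Lemma exp_half_ln y : 0 < y -> exp (1 / 2 * ln y) * exp (1 / 2 * ln y) = y.
Proof. intros Hy. rewrite <- exp_plus. replace (1 / 2 * ln y + 1 / 2 * ln y) with (ln y) by field. now apply exp_ln. Qed.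

(** The recursion fixes U and V up to their values at 0 and 1, and two consecutive
    terms of a decreasing solution have ratio tending to 1. *)
Lemma sequence_ratio_le (U V : nat -> R) :
  (forall n, 0 < V n) -> (forall n, U (S n) <= U n) -> (forall n, V (S n) <= V n) ->
  (forall n, INR (S (S n)) * U (S (S n)) = INR (S n) * U n) ->
  (forall n, INR (S (S n)) * V (S (S n)) = INR (S n) * V n) ->
  0 < U 0%nat -> U 1%nat * V 0%nat <= U 0%nat * V 1%nat.
Proof.
  intros PV DU DV RU RV U0.
  assert (E : forall n m, U n * V m = U m * V n -> U (S (S n)) * V m = U m * V (S (S n))).
  { intros n m H. apply Rmult_eq_reg_l with (INR (S (S n))); [|apply not_0_INR; lia].
    rewrite <- Rmult_assoc, RU, (Rmult_comm (U m)), <- Rmult_assoc, RV.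
    rewrite !Rmult_assoc. f_equal. lra. }
  assert (H0 : forall n, U (2 * n)%nat * V 0%nat = U 0%nat * V (2 * n)%nat).
  { induction n as [|n IH]; [simpl; ring|].
    replace (2 * S n)%nat with (S (S (2 * n))) by lia. now apply E. }
  assert (H1 : forall n, U (S (2 * n)) * V 1%nat = U 1%nat * V (S (2 * n))).
  { induction n as [|n IH]; [simpl; ring|].
    replace (2 * S n)%nat with (S (S (2 * n))) by lia. now apply E. }
  apply le_of_scaled. intros n.
  assert (V0 := PV 0%nat). assert (V1 := PV 1%nat). assert (Vn := PV (S (2 * n))).
  assert (D1 := DU (2 * n)%nat). assert (D2 := DV (S (2 * n))). assert (R2 := RV (2 * n)%nat).
  specialize (H0 n). specialize (H1 n).
  rewrite !S_INR, mult_INR in R2. simpl (INR 2) in R2. rewrite S_INR. assert (Hn := pos_INR n).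
  set (N := INR n) in *. set (v := V (S (2 * n))) in *. set (v0 := V (2 * n)%nat) in *.
  assert (Hv : v0 <= (1 + / (N + 1)) * v).
  { apply Rmult_le_reg_l with (2 * N + 1); [lra|].
    apply Rle_trans with ((2 * N + 2) * v); [nra|].
    replace ((2 * N + 1) * ((1 + / (N + 1)) * v)) with (((2 * N + 2) + N / (N + 1)) * v) by (field; lra).
    apply Rmult_le_compat_r; [lra|].
    assert (0 <= N / (N + 1)) by (apply Rmult_le_pos; [lra|left; apply Rinv_0_lt_compat; lra]). lra. }
  apply Rmult_le_reg_r with v; auto.
  apply Rle_trans with (U 0%nat * V 1%nat * v0).
  - replace (U 1%nat * V 0%nat * v) with (U (S (2 * n)) * V 1%nat * V 0%nat) by (rewrite H1; ring).
    replace (U 0%nat * V 1%nat * v0) with (U (2 * n)%nat * V 1%nat * V 0%nat)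
      by (rewrite Rmult_assoc, (Rmult_comm (V 1%nat)), <- Rmult_assoc, H0; ring).
    apply Rmult_le_compat_r; [lra|]. apply Rmult_le_compat_r; lra.
  - replace ((1 + / (N + 1)) * (U 0%nat * V 1%nat) * v) with (U 0%nat * V 1%nat * ((1 + / (N + 1)) * v)) by ring.
    apply Rmult_le_compat_l; auto. apply Rmult_le_pos; lra.
Qed.

(** The quotients g((n+1)/2) / g(n/2+1) obey the recursion of the Wallis integrals,
    and logarithmic convexity makes them decreasing; so they are proportional
    to the Wallis integrals. *)
Lemma gamma_like_half g : gamma_like g -> g (1 / 2) * g (1 / 2) = PI.
Proof.
  intros Hg. assert (Hg' := Hg). destruct Hg' as [H1 [H2 H3]].
  set (c := fun n => g ((INR n + 1) / 2)).
  assert (Pc : forall n, 0 < c n).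
  { intros n; apply gamma_like_pos; auto. assert (H := pos_INR n). lra. }
  assert (Rc : forall n, c (S (S n)) = (INR n + 1) / 2 * c n).
  { intros n. unfold c. rewrite !S_INR.
    replace ((INR n + 1 + 1 + 1) / 2) with ((INR n + 1) / 2 + 1) by field.
    apply H1. assert (H := pos_INR n). lra. }
  assert (Lc : forall n, c (S n) * c (S n) <= c n * c (S (S n))).
  { intros n. rewrite Rc. assert (Hn := pos_INR n).
    assert (H := H2 ((INR n + 1) / 2) (1 / 2) ltac:(lra) ltac:(lra)).
    replace ((INR n + 1) / 2 + 1 / 2) with ((INR (S n) + 1) / 2) in H by (rewrite S_INR; field).
    fold (c n) (c (S n)) in H. rewrite <- (exp_half_ln ((INR n + 1) / 2)) by lra.
    set (e := exp _) in *.
    replace (c n * (e * e * c n)) with ((e * c n) * (e * c n)) by ring.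
    assert (P := Pc (S n)). apply Rmult_le_compat; lra. }
  set (V := fun n => c n / c (S n)).
  assert (PV : forall n, 0 < V n) by (intros n; apply Rdiv_lt_0_compat; auto).
  assert (DV : forall n, V (S n) <= V n).
  { intros n. unfold V. assert (P0 := Pc n). assert (P1 := Pc (S n)). assert (P2 := Pc (S (S n))).
    apply Rmult_le_reg_r with (c (S n) * c (S (S n))); [now apply Rmult_lt_0_compat|].
    replace (c (S n) / c (S (S n)) * (c (S n) * c (S (S n)))) with (c (S n) * c (S n)) by (field; lra).
    replace (c n / c (S n) * (c (S n) * c (S (S n)))) with (c n * c (S (S n))) by (field; lra).
    apply Lc. }
  assert (RV : forall n, INR (S (S n)) * V (S (S n)) = INR (S n) * V n).
  { intros n. unfold V. rewrite (Rc n), (Rc (S n)). rewrite !S_INR.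
    assert (P1 := Pc (S n)). assert (Hn := pos_INR n). field. lra. }
  assert (HP := PI_RGT_0).
  assert (A := sequence_ratio_le wallis V PV wallis_decr DV wallis_rec RV (wallis_pos 0)).
  assert (A' := sequence_ratio_le V wallis wallis_pos DV wallis_decr RV wallis_rec (PV 0%nat)).
  rewrite wallis_0, wallis_1 in A, A'.
  assert (E : V 0%nat = PI / 2 * V 1%nat) by lra.
  unfold V in E. rewrite (Rc 0%nat) in E.
  assert (c0 : c 0%nat = g (1 / 2)) by (unfold c; simpl; f_equal; field).
  assert (c1 : c 1%nat = 1) by (refine (eq_trans _ H3); unfold c; simpl; f_equal; field).
  assert (P0 := Pc 0%nat). rewrite c0 in P0, E. rewrite c1 in E. simpl INR in E.
  assert (E2 : g (1 / 2) * (g (1 / 2) / 1) = g (1 / 2) * (PI / 2 * (1 / ((0 + 1) / 2 * g (1 / 2))))) by now rewrite E.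
  replace (g (1 / 2) * g (1 / 2)) with (g (1 / 2) * (g (1 / 2) / 1)) by field.
  rewrite E2. field. lra.
Qed.

(** * The Gamma integral *)

Definition gamma_integrand (y t : R) : R := Rpower t (y - 1) * exp (- t).

Lemma gamma_integrand_continuous y t : 0 < t -> continuous (gamma_integrand y) t.
Proof.
  intros Ht. apply (ex_derive_continuous (V := RN)).
  unfold gamma_integrand, Rpower. auto_derive. auto.
Qed.

(** Improper integrals are handled through primitives with limits at both ends:
    linear combinations and comparisons are immediate, and integration by parts
    is a change of primitive. *)
Definition is_improper_primitive (F f : R -> R) (l0 l1 : R) : Prop :=
  (forall t, 0 < t -> is_derive F t (f t)) /\
  filterlim F (at_right 0) (locally l0) /\ filterlim F (Rbar_locally p_infty) (locally l1).

Lemma at_right_pos : at_right 0 (fun t => 0 < t).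
Proof. exists (mkposreal 1 Rlt_0_1). intros y _ Hy; exact Hy. Qed.

Lemma improper_integral f F l0 l1 :
  (forall t, 0 < t -> continuous f t) -> is_improper_primitive F f l0 l1 ->
  RInt_gen f (at_right 0) (Rbar_locally p_infty) = l1 - l0.
Proof.
  intros Hf [Hd [H0 H1]].
  apply (is_RInt_gen_unique (V := RCN)).
  intros P [eps HP]. assert (He := cond_pos eps).
  set (e2 := mkposreal (eps / 2) ltac:(lra)).
  exists (fun a => 0 < a /\ ball (M := R_UniformSpace) l0 e2 (F a))
         (fun b => 0 < b /\ ball (M := R_UniformSpace) l1 e2 (F b)).
  - apply filter_and; [apply at_right_pos|]. apply H0. now exists e2.
  - apply filter_and; [exists 0; auto|]. apply H1. now exists e2.
  - intros a b [Ha1 Ha2] [Hb1 Hb2]. exists (F b - F a). split.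
    + apply (is_RInt_derive (V := RCN)).
      * intros t Ht. apply Hd. assert (0 < Rmin a b) by now apply Rmin_pos. lra.
      * intros t Ht. apply Hf. assert (0 < Rmin a b) by now apply Rmin_pos. lra.
    + apply HP. apply ball_R in Ha2. apply ball_R in Hb2. simpl in Ha2, Hb2.
      change (Rabs ((F b - F a) - (l1 - l0)) < eps).
      apply Rabs_lt_between in Ha2. apply Rabs_lt_between in Hb2. apply Rabs_lt_between. lra.
Qed.

Lemma improper_le f g F G l0 l1 m0 m1 :
  is_improper_primitive F f l0 l1 -> is_improper_primitive G g m0 m1 ->
  (forall t, 0 < t -> f t <= g t) -> l1 - l0 <= m1 - m0.
Proof.
  intros [dF [F0 F1]] [dG [G0 G1]] Hfg.
  apply Rnot_lt_le; intros Hlt. set (eps := (l1 - l0 - (m1 - m0)) / 4).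
  assert (He : 0 < eps) by (unfold eps; lra).
  assert (B : forall (H : R -> R) (FF : (R -> Prop) -> Prop) l, filterlim H FF (locally l) ->
     FF (fun t => Rabs (H t - l) < eps)).
  { intros H FF l HF. apply (HF (fun y => Rabs (y - l) < eps)). exists (mkposreal eps He). intros y Hy; exact Hy. }
  destruct (filter_ex (F := at_right 0) _ (filter_and _ _ at_right_pos
    (filter_and _ _ (B _ _ _ F0) (B _ _ _ G0)))) as [a [Ha [Fa Ga]]].
  assert (Hab : Rbar_locally p_infty (fun t => a < t)) by (exists a; auto).
  destruct (filter_ex (F := Rbar_locally p_infty) _ (filter_and _ _ Hab
    (filter_and _ _ (B _ _ _ F1) (B _ _ _ G1)))) as [b [Hb [Fb Gb]]].
  (* close to both ends the primitives are within a quarter of the gap from their limits *)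
  assert (H := nonneg_derivative_le (fun t => G t - F t) (fun t => g t - f t) a b ltac:(lra)).
  assert (G a - F a <= G b - F b).
  { apply H.
    - intros s Hs. apply (is_derive_minus (V := RN)); [apply dG|apply dF]; lra.
    - intros s Hs. specialize (Hfg s ltac:(lra)). lra. }
  apply Rabs_lt_between in Fa. apply Rabs_lt_between in Ga.
  apply Rabs_lt_between in Fb. apply Rabs_lt_between in Gb.
  unfold eps in *. lra.
Qed.

Lemma filterlim_lin (FF : (R -> Prop) -> Prop) {HF : Filter FF} (F G : R -> R) a b l m :
  filterlim F FF (locally l) -> filterlim G FF (locally m) ->
  filterlim (fun t => a * F t + b * G t) FF (locally (a * l + b * m)).
Proof.
  intros H1 H2.
  apply (filterlim_comp_2 (G := locally (a * l)) (H := locally (b * m)) (fun t => a * F t) (fun t => b * G t) plus).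
  - apply (filterlim_comp _ _ _ F (fun y => a * y) FF (locally l)); auto.
    apply (filterlim_scal_r (V := RN) a l).
  - apply (filterlim_comp _ _ _ G (fun y => b * y) FF (locally m)); auto.
    apply (filterlim_scal_r (V := RN) b m).
  - apply (filterlim_plus (V := RN)).
Qed.

Lemma improper_lin f g F G l0 l1 m0 m1 a b :
  is_improper_primitive F f l0 l1 -> is_improper_primitive G g m0 m1 ->
  is_improper_primitive (fun t => a * F t + b * G t) (fun t => a * f t + b * g t)
    (a * l0 + b * m0) (a * l1 + b * m1).
Proof.
  intros [dF [F0 F1]] [dG [G0 G1]]. split; [|split].
  - intros t Ht. apply (is_derive_plus (V := RN)); apply is_derive_scal; auto.
  - apply (filterlim_lin (at_right 0)); auto.
  - apply (filterlim_lin (Rbar_locally p_infty)); auto.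
Qed.

Lemma improper_ext f g F l0 l1 :
  (forall t, 0 < t -> f t = g t) -> is_improper_primitive F f l0 l1 -> is_improper_primitive F g l0 l1.
Proof. intros E [H1 H2]; split; auto. intros t Ht; rewrite <- E; auto. Qed.

Lemma Rpower_le_exp y t : 0 < y -> 0 < t -> Rpower t y <= exp (y * ln (2 * y)) * exp (t / 2).
Proof.
  intros Hy Ht. unfold Rpower. rewrite <- exp_plus. apply exp_le_mono.
  assert (Hl : ln (t / (2 * y)) <= t / (2 * y)).
  { assert (H := exp_ineq1_le (ln (t / (2 * y)))). rewrite exp_ln in H by (apply Rdiv_lt_0_compat; lra). lra. }
  unfold Rdiv in Hl at 1. rewrite ln_mult, ln_Rinv in Hl by (try apply Rinv_0_lt_compat; lra).
  apply Rmult_le_compat_l with (r := y) in Hl; [|lra].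
  replace (y * (t / (2 * y))) with (t / 2) in Hl by (field; lra). lra.
Qed.

Lemma Rpower_exp_lim_0 y : 0 < y -> filterlim (fun t => Rpower t y * exp (- t)) (at_right 0) (locally 0).
Proof.
  intros Hy P [eps HP]. assert (He := cond_pos eps).
  exists (mkposreal (Rpower eps (/ y)) (exp_pos _)). intros t Ht Ht0.
  apply HP. apply ball_R in Ht. simpl in Ht. rewrite Rminus_0_r, Rabs_pos_eq in Ht by lra.
  change (Rabs (Rpower t y * exp (- t) - 0) < eps). rewrite Rminus_0_r.
  assert (Hp : 0 < Rpower t y) by apply exp_pos. assert (Hp2 := exp_pos (- t)).
  rewrite Rabs_pos_eq by nra.
  assert (Hlt : Rpower t y < eps).
  { replace (pos eps) with (Rpower (Rpower eps (/ y)) y).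
    - apply Rlt_Rpower_l; lra.
    - rewrite Rpower_mult, Rinv_l by lra. apply Rpower_1; lra. }
  assert (Hq := one_minus_exp_pos t Ht0). nra.
Qed.

Lemma Rpower_exp_lim_infty y : 0 < y ->
  filterlim (fun t => Rpower t y * exp (- t)) (Rbar_locally p_infty) (locally 0).
Proof.
  intros Hy P [eps HP]. assert (He := cond_pos eps).
  set (K := exp (y * ln (2 * y))). assert (HK : 0 < K) by apply exp_pos.
  exists (2 * K / eps). intros t Ht.
  assert (Hke : 0 < 2 * K / eps) by (apply Rdiv_lt_0_compat; lra).
  apply HP. change (Rabs (Rpower t y * exp (- t) - 0) < eps). rewrite Rminus_0_r.
  assert (Hp : 0 < Rpower t y) by apply exp_pos. assert (Hp2 := exp_pos (- t)).
  rewrite Rabs_pos_eq by nra.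
  assert (H := Rpower_le_exp y t Hy ltac:(lra)). fold K in H.
  apply Rle_lt_trans with (K * exp (- (t / 2))).
  - replace (- (t / 2)) with (t / 2 + - t) by field. rewrite exp_plus, <- Rmult_assoc.
    apply Rmult_le_compat_r; lra.
  - rewrite exp_Ropp.
    assert (H1 := exp_ineq1_le (t / 2)).
    apply Rmult_lt_reg_r with (exp (t / 2)); [apply exp_pos|].
    rewrite Rmult_assoc, Rinv_l, Rmult_1_r by (apply Rgt_not_eq, exp_pos).
    apply Rlt_le_trans with (eps * (t / 2)); [|apply Rmult_le_compat_l; lra].
    replace K with (eps * (2 * K / eps / 2)) by (field; lra).
    apply Rmult_lt_compat_l; lra.
Qed.

Lemma monotone_limit_0 (F : R -> R) (M : R) :
  (forall a b, 0 < a <= b -> F a <= F b) -> (forall t, 0 < t -> Rabs (F t) <= M) ->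
  exists l : R, filterlim F (at_right 0) (locally l).
Proof.
  intros Hm Hb.
  destruct (monotone_limit (fun t => - F (/ t)) M) as [l Hl].
  - intros a b Hab. apply Ropp_le_contravar, Hm.
    split; [apply Rinv_0_lt_compat; lra|apply Rinv_le_contravar; lra].
  - intros t Ht. rewrite Rabs_Ropp. now apply Hb, Rinv_0_lt_compat.
  - exists (- l).
    apply (filterlim_ext_loc (fun t => - - F (/ / t))).
    + exists (mkposreal 1 Rlt_0_1). intros t _ Ht. rewrite Ropp_involutive, Rinv_inv. reflexivity.
    + apply (filterlim_comp _ _ _ (fun t => - F (/ / t)) Ropp _ (locally l)).
      * exact (filterlim_comp _ _ _ Rinv (fun t => - F (/ t)) _ _ _ filterlim_Rinv_0_right Hl).
      * apply (filterlim_opp (V := RN)).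
Qed.

Lemma gamma_primitive y : 0 < y ->
  exists F l0 l1, is_improper_primitive F (gamma_integrand y) l0 l1.
Proof.
  intros Hy.
  set (F := fun t => RInt (gamma_integrand y) 1 t).
  assert (dF : forall t, 0 < t -> is_derive F t (gamma_integrand y t)).
  { intros t Ht. apply (is_derive_RInt (V := RN) (gamma_integrand y) F 1).
    - apply locally_pos; auto. intros s Hs. apply (RInt_correct (V := RCN)).
      apply (ex_RInt_continuous (V := RCN)). intros z Hz.
      apply gamma_integrand_continuous. assert (0 < Rmin 1 s) by (apply Rmin_pos; lra). lra.
    - now apply gamma_integrand_continuous. }
  assert (Hpos : forall t, 0 < gamma_integrand y t).
  { intros t; apply Rmult_lt_0_compat; apply exp_pos. }
  assert (Hmono : forall a b, 0 < a <= b -> F a <= F b).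
  { intros a b Hab. apply (nonneg_derivative_le F (gamma_integrand y)); [lra| |].
    - intros s Hs; apply dF; lra.
    - intros s _; left; apply Hpos. }
  (* the bounded function t^y / (1 + t^y) has derivative y t^{y-1} / (1 + t^y)^2,
     which dominates the integrand at both ends at once *)
  set (K := exp (y * ln (2 * y))). assert (HK : 0 < K) by apply exp_pos.
  set (c := (1 + K) ^ 2 / y).
  assert (Hc : 0 < c) by (apply Rdiv_lt_0_compat; [apply pow_lt; lra|lra]).
  set (G := fun t => c * (Rpower t y / (1 + Rpower t y))).
  assert (HG : forall t, 0 < t -> 0 <= G t <= c).
  { intros t Ht. assert (Hp : 0 < Rpower t y) by apply exp_pos. unfold G.
    assert (H1 : 0 <= Rpower t y / (1 + Rpower t y)) by (left; apply Rdiv_lt_0_compat; lra).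
    assert (H2 : Rpower t y / (1 + Rpower t y) <= 1).
    { apply Rmult_le_reg_r with (1 + Rpower t y); [lra|]. unfold Rdiv. rewrite Rmult_assoc, Rinv_l by lra. lra. }
    split; [apply Rmult_le_pos; lra|]. rewrite <- (Rmult_1_r c) at 2. apply Rmult_le_compat_l; lra. }
  assert (dG : forall t, 0 < t -> is_derive G t (c * (y * Rpower t (y - 1) / (1 + Rpower t y) ^ 2))).
  { intros t Ht. unfold G.
    assert (Hp : 0 < Rpower t y) by apply exp_pos.
    replace (Rpower t (y - 1)) with (Rpower t y / t).
    - unfold Rpower in *. auto_derive; [repeat split; lra|]. field. lra.
    - unfold Rminus. rewrite Rpower_plus, Rpower_Ropp, Rpower_1 by auto. reflexivity. }
  assert (Hle : forall t, 0 < t -> gamma_integrand y t <= c * (y * Rpower t (y - 1) / (1 + Rpower t y) ^ 2)).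
  { intros t Ht. unfold gamma_integrand, c.
    assert (Hp : 0 < Rpower t y) by apply exp_pos. assert (Hp1 : 0 < Rpower t (y - 1)) by apply exp_pos.
    replace ((1 + K) ^ 2 / y * (y * Rpower t (y - 1) / (1 + Rpower t y) ^ 2))
      with (Rpower t (y - 1) * ((1 + K) ^ 2 / (1 + Rpower t y) ^ 2)) by (field; lra).
    apply Rmult_le_compat_l; [lra|].
    assert (H := Rpower_le_exp y t Hy Ht). fold K in H.
    assert (H1 := exp_ineq1_le (t / 2)).
    assert (Hs : (1 + Rpower t y) ^ 2 <= (1 + K) ^ 2 * exp t).
    { replace t with (t / 2 + t / 2) at 2 by field. rewrite exp_plus.
      replace ((1 + K) ^ 2 * (exp (t / 2) * exp (t / 2))) with (((1 + K) * exp (t / 2)) ^ 2) by ring.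
      apply pow_incr. nra. }
    apply Rmult_le_reg_r with ((1 + Rpower t y) ^ 2); [apply pow_lt; lra|].
    replace ((1 + K) ^ 2 / (1 + Rpower t y) ^ 2 * (1 + Rpower t y) ^ 2) with ((1 + K) ^ 2)
      by (field; lra).
    rewrite exp_Ropp. apply Rmult_le_reg_l with (exp t); [apply exp_pos|].
    assert (He := exp_pos t).
    replace (exp t * (/ exp t * (1 + Rpower t y) ^ 2)) with ((1 + Rpower t y) ^ 2) by (field; lra).
    lra. }
  assert (Hcmp : forall a b, 0 < a <= b -> F b - F a <= c).
  { intros a b Hab.
    assert (H : G a - F a <= G b - F b).
    { apply (nonneg_derivative_le (fun t => G t - F t) (fun t => c * (y * Rpower t (y - 1) / (1 + Rpower t y) ^ 2) - gamma_integrand y t)); [lra| |].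
      - intros s Hs. apply (is_derive_minus (V := RN)); [apply dG|apply dF]; lra.
      - intros s Hs. specialize (Hle s ltac:(lra)). lra. }
    assert (A := HG a ltac:(lra)). assert (B := HG b ltac:(lra)). lra. }
  assert (F1 : F 1 = 0) by (apply (RInt_point (V := RCN))).
  assert (HFb : forall t, 0 < t -> Rabs (F t) <= c).
  { intros t Ht. apply Rabs_le_between. destruct (Rle_or_lt t 1) as [H|H].
    - assert (A := Hcmp t 1 ltac:(lra)). assert (B := Hmono t 1 ltac:(lra)). lra.
    - assert (A := Hcmp 1 t ltac:(lra)). assert (B := Hmono 1 t ltac:(lra)). lra. }
  destruct (monotone_limit_0 F c Hmono HFb) as [l0 H0].
  destruct (monotone_limit F c Hmono HFb) as [l1 H1].
  exists F, l0, l1. split; [exact dF|split; assumption].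
Qed.

Lemma Gamma_of_primitive y F l0 l1 :
  is_improper_primitive F (gamma_integrand y) l0 l1 -> Gamma y = l1 - l0.
Proof.
  intros H. apply (improper_integral (gamma_integrand y) F l0 l1); auto.
  intros t Ht; now apply gamma_integrand_continuous.
Qed.

Lemma boundary_primitive y : 0 < y ->
  is_improper_primitive (fun t => Rpower t y * exp (- t))
    (fun t => y * gamma_integrand y t - gamma_integrand (y + 1) t) 0 0.
Proof.
  intros Hy. split; [|split].
  - intros t Ht. unfold gamma_integrand. replace (y + 1 - 1) with y by ring.
    replace (Rpower t (y - 1)) with (Rpower t y / t).
    + unfold Rpower. auto_derive; auto. field. lra.
    + unfold Rminus. rewrite Rpower_plus, Rpower_Ropp, Rpower_1 by auto. reflexivity.
  - now apply Rpower_exp_lim_0.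
  - now apply Rpower_exp_lim_infty.
Qed.

Lemma Gamma_succ y : 0 < y -> Gamma (y + 1) = y * Gamma y.
Proof.
  intros Hy. destruct (gamma_primitive y Hy) as [F [l0 [l1 HF]]].
  assert (H := improper_lin _ _ _ _ _ _ _ _ y (-1) HF (boundary_primitive y Hy)).
  apply (improper_ext _ (gamma_integrand (y + 1))) in H; [|intros t Ht; ring].
  rewrite (Gamma_of_primitive _ _ _ _ H), (Gamma_of_primitive _ _ _ _ HF). ring.
Qed.

(** Integrate v^s <= 1 - s + s v at v = t/y against t^{y-1} e^{-t}, and use the
    functional equation for the term with t^y. *)
Lemma Gamma_log_convex y s : 0 < y -> 0 <= s <= 1 -> Gamma (y + s) <= exp (s * ln y) * Gamma y.
Proof.
  intros Hy Hs.
  destruct (gamma_primitive y Hy) as [F [l0 [l1 HF]]].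
  destruct (gamma_primitive (y + 1) ltac:(lra)) as [G [m0 [m1 HG]]].
  destruct (gamma_primitive (y + s) ltac:(lra)) as [H [n0 [n1 HH]]].
  assert (Hi := Gamma_succ y Hy).
  rewrite (Gamma_of_primitive _ _ _ _ HG), (Gamma_of_primitive _ _ _ _ HF) in Hi.
  rewrite (Gamma_of_primitive _ _ _ _ HH), (Gamma_of_primitive _ _ _ _ HF).
  set (e := exp (s * ln y)).
  assert (L := improper_le _ _ _ _ _ _ _ _ HH
    (improper_lin _ _ _ _ _ _ _ _ (e * (1 - s)) (e * (s / y)) HF HG)).
  replace (e * (l1 - l0)) with
    (e * (1 - s) * l1 + e * (s / y) * m1 - (e * (1 - s) * l0 + e * (s / y) * m0)).
  - apply L. intros t Ht. unfold gamma_integrand.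
    assert (A := weighted_amgm (t / y) s ltac:(apply Rdiv_lt_0_compat; lra) Hs).
    replace (y + 1 - 1) with (y - 1 + 1) by ring. replace (y + s - 1) with (y - 1 + s) by ring.
    rewrite !Rpower_plus, Rpower_1 by auto.
    assert (E : Rpower t s = e * exp (s * ln (t / y))).
    { unfold e, Rpower, Rdiv. rewrite <- exp_plus, ln_mult, ln_Rinv by (auto; now apply Rinv_0_lt_compat).
      f_equal; ring. }
    rewrite E.
    assert (He : 0 < e) by apply exp_pos.
    assert (Hp : 0 < Rpower t (y - 1) * exp (- t)) by (apply Rmult_lt_0_compat; apply exp_pos).
    apply Rle_trans with ((Rpower t (y - 1) * exp (- t)) * (e * (1 - s + s * (t / y)))).
    + replace (Rpower t (y - 1) * (e * exp (s * ln (t / y))) * exp (- t))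
        with ((Rpower t (y - 1) * exp (- t)) * (e * exp (s * ln (t / y)))) by ring.
      apply Rmult_le_compat_l; [lra|]. apply Rmult_le_compat_l; lra.
    + right. field. lra.
  - replace (e * (1 - s) * l1 + e * (s / y) * m1 - (e * (1 - s) * l0 + e * (s / y) * m0))
      with (e * (1 - s) * (l1 - l0) + e * (s / y) * (m1 - m0)) by ring.
    rewrite Hi. field. lra.
Qed.

Lemma Gamma_1 : Gamma 1 = 1.
Proof.
  assert (Hlim : filterlim (fun t => - exp (- t)) (at_right 0) (locally (- exp (- 0)))).
  { intros P HP. apply (filter_le_within (F := locally 0) (fun u => 0 < u)).
    assert (Hcont : continuous (fun t => - exp (- t)) 0).
    { apply (ex_derive_continuous (V := RN)). auto_derive; auto. }
    apply (Hcont P HP). }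
  rewrite Ropp_0, exp_0 in Hlim.
  rewrite (Gamma_of_primitive 1 (fun t => - exp (- t)) (- (1)) 0); [ring|].
  split; [|split]; auto.
  - intros t Ht. unfold gamma_integrand. rewrite Rminus_diag, Rpower_O by auto.
    auto_derive; auto; ring.
  - assert (H := is_lim_opp _ _ _ (is_lim_comp exp (fun t => - t) p_infty 0 m_infty is_lim_exp_m
      ltac:(apply (is_lim_opp (fun t => t) p_infty p_infty), is_lim_id) ltac:(exists 0; discriminate))).
    simpl in H. rewrite Ropp_0 in H. exact H.
Qed.

Lemma Gamma_gamma_like : gamma_like Gamma.
Proof.
  split; [|split]; [exact Gamma_succ|exact Gamma_log_convex|exact Gamma_1].
Qed.

(** * The expansion of the q-Pochhammer symbol *)

Definition bernoulli_coef (B : nat -> R -> R) (y : R) (n : nat) : R := B n y / INR (fact n).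

Section Expansion_at_1.

Variables (zeta : C -> C) (B : nat -> R -> R).
Hypothesis Hzeta : is_riemann_zeta zeta.
Hypothesis HB : is_bernoulli_poly B.

Lemma lambert_constant_ex y : 0 < y -> exists I, is_lambert_constant y I.
Proof.
  intros Hy.
  destruct (lambert_expansion y (bernoulli_coef B y) Hy (HB y) (zeta_at_neg zeta) (em_coef_recursion zeta Hzeta)) as [I HI].
  exists I. eapply bigO_ext; [|exact (HI 0%nat)]. intros t Ht. cbn [psum].
  rewrite (proj2 (bernoulli_first_coefs y (bernoulli_coef B y) (HB y))). ring.
Qed.

Lemma lambert_constant_value y I : 0 < y -> is_lambert_constant y I ->
  exp (- I) = sqrt (2 * PI) / Gamma y.
Proof.
  intros Hy HI.
  assert (Hch : forall u, exists J, 0 < u -> is_lambert_constant u J).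
  { intros u. destruct (Rlt_dec 0 u) as [Hu|Hu].
    - destruct (lambert_constant_ex u Hu) as [J HJ]. now exists J.
    - exists 0. intros H; contradiction. }
  destruct (functional_choice _ Hch) as [J HJ].
  (* e^{J - J 1} has the three properties that characterize Gamma; J 1 is then read off at 1/2 *)
  set (h := fun u => exp (J u - J 1)).
  assert (Hh : gamma_like h).
  { split; [|split].
    - intros u Hu. unfold h.
      rewrite (lambert_constant_unique (u + 1) (J (u + 1)) (J u + ln u)).
      + replace (J u + ln u - J 1) with (ln u + (J u - J 1)) by ring.
        rewrite exp_plus, exp_ln; auto.
      + apply HJ; lra.
      + apply lambert_constant_succ; auto.
    - intros u s Hu Hs. unfold h. rewrite <- exp_plus. apply exp_le_mono.
      assert (A := lambert_constant_convex u s (J u) (J (u + s)) Hu Hs (HJ u Hu) (HJ (u + s) ltac:(lra))).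
      lra.
    - unfold h. replace (J 1 - J 1) with 0 by ring. apply exp_0. }
  assert (E := gamma_like_unique h Gamma y Hh Gamma_gamma_like Hy).
  assert (H2 := gamma_like_half h Hh).
  assert (Hhalf := lambert_constant_half (J 1) (J (1 / 2)) (HJ (1 / 2) ltac:(lra)) (HJ 1 ltac:(lra))).
  rewrite (lambert_constant_unique y I (J y) HI (HJ y Hy)).
  rewrite <- E.
  assert (HJ1 : exp (- J 1) = sqrt (2 * PI)).
  { rewrite <- (sqrt_pow2 (exp (- J 1))) by (left; apply exp_pos). f_equal.
    rewrite <- H2. unfold h. rewrite Hhalf.
    replace (exp (- (ln 2 / 2) - J 1) * exp (- (ln 2 / 2) - J 1))
      with (exp (- ln 2) * (exp (- J 1) * exp (- J 1))) by (rewrite <- !exp_plus; f_equal; field).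
    rewrite (exp_Ropp (ln 2)), exp_ln by lra. simpl; field. }
  unfold h. rewrite <- HJ1. unfold Rdiv. rewrite <- exp_Ropp, <- exp_plus. f_equal. ring.
Qed.

Lemma Re_zeta_2 : Re (zeta (RtoC 2)) = zeta2.
Proof.
  destruct (is_cseries_of _ _ (proj1 Hzeta (RtoC 2) ltac:(simpl; lra))) as [H _].
  unfold zeta2. symmetry. apply is_series_unique. eapply is_series_ext; [|exact H].
  intros n. cbn beta.
  replace (RtoC 2) with (RtoC (INR 2)) by (f_equal; simpl; ring). rewrite cpower_inv, cpower_opp_nat by (apply lt_0_INR; lia).
  reflexivity.
Qed.

Lemma expansion_term_0 x t : 0 < t -> expansion_term zeta B x (exp (- t)) 0 = - (zeta2 / t).
Proof.
  intros Ht. unfold expansion_term. cbn [INR Z.of_nat fact].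
  replace (2 - 0) with 2 by ring. rewrite Re_zeta_2.
  assert (H := proj1 (bernoulli_first_coefs x (bernoulli_coef B x) (HB x))). unfold bernoulli_coef in H. cbn [fact INR] in H.
  replace (B 0%nat x) with 1 by lra.
  rewrite ln_exp. simpl. field. lra.
Qed.

Lemma expansion_term_SS x t i : 0 < t ->
  expansion_term zeta B x (exp (- t)) (S (S i)) = - (zeta_at_neg zeta i * (-1) ^ i * bernoulli_coef B x (S (S i)) * t ^ S i).
Proof.
  intros Ht. unfold expansion_term, bernoulli_coef, zeta_at_neg.
  replace (2 - INR (S (S i))) with (- INR i) by (rewrite !S_INR; ring).
  replace (Z.of_nat (S (S i)) - 1)%Z with (Z.of_nat (S i)) by lia.
  rewrite <- pow_powerRZ, ln_exp. replace (- t) with (-1 * t) by ring.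
  rewrite Rpow_mult_distr. change ((-1) ^ S i) with (-1 * (-1) ^ i).
  field. apply (INR_fact_neq_0 (S (S i))).
Qed.

Lemma expansion_prod_psum x t N : 0 < t ->
  expansion_prod zeta B x (exp (- t)) N
  = exp (- (zeta2 / t + psum (fun i => zeta_at_neg zeta i * (-1) ^ i * bernoulli_coef B x (S (S i)) * t ^ S i) (pred N))).
Proof.
  intros Ht. unfold expansion_prod. induction N as [|N IH].
  - cbn [prod_f_R0 Nat.eqb pred psum]. rewrite expansion_term_0 by auto. f_equal; ring.
  - cbn [prod_f_R0]. rewrite IH. destruct N as [|N].
    + cbn [Nat.eqb pred]. ring.
    + cbn [Nat.eqb pred psum]. rewrite expansion_term_SS by auto.
      rewrite <- exp_plus. f_equal. ring.
Qed.

End Expansion_at_1.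

Lemma exp_minus_1_bound e : Rabs (exp e - 1) <= Rabs e * exp (Rabs e).
Proof.
  assert (H1 := exp_ineq1_le e). assert (H2 := exp_ineq1_le (- e)).
  rewrite exp_Ropp in H2. assert (He := exp_pos e).
  assert (H3 : (1 + - e) * exp e <= 1).
  { apply Rmult_le_reg_r with (/ exp e); [now apply Rinv_0_lt_compat|].
    rewrite Rmult_assoc, Rinv_r, Rmult_1_r by lra. lra. }
  destruct (Rle_or_lt 0 e) as [H|H].
  - rewrite (Rabs_pos_eq e) by auto. rewrite Rabs_pos_eq by lra. lra.
  - rewrite (Rabs_left e) by auto. rewrite exp_Ropp.
    assert (exp e < 1) by (rewrite <- exp_0; now apply exp_increasing).
    rewrite Rabs_left by lra.
    assert (1 <= / exp e) by (rewrite <- Rinv_1; apply Rinv_le_contravar; lra).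
    apply Rle_trans with (- e * 1); [lra|]. apply Rmult_le_compat_l; lra.
Qed.

Theorem theorem3p2 (zeta : C -> C) (B : nat -> R -> R)
    (Hzeta : is_riemann_zeta zeta) (HB : is_bernoulli_poly B)
    (x : R) (hx : 0 < x) :
  product_expansion_at_1
    (fun q => qPochhammer (Rpower q x) q)
    (fun q => sqrt (2 * PI) / Gamma x * Rpower (ln (1 / q)) (1 / 2 - x))
    (fun q N => expansion_prod zeta B x q N).
Proof.
  intros N.
  destruct (lambert_expansion x (bernoulli_coef B x) hx (HB x) (zeta_at_neg zeta) (em_coef_recursion zeta Hzeta)) as [I HI].
  assert (c1 := proj2 (bernoulli_first_coefs x (bernoulli_coef B x) (HB x))).
  assert (HIc : is_lambert_constant x I).
  { eapply bigO_ext; [|exact (HI 0%nat)]. intros t Ht. cbn [psum]. rewrite c1. ring. }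
  assert (HV := lambert_constant_value zeta B Hzeta HB x I hx HIc).
  (* the factor k = 1 is missing, so N = 0 is covered by the bound for N = 1 *)
  destruct (bigO_weaken (S (pred N)) N _ ltac:(lia) (HI (pred N))) as [C HC].
  exists (Rabs C * exp (Rabs C)).
  (* for e^{-1} < q < 1 the parameter t = - ln q lies in ]0, 1[ *)
  assert (Hd : 0 < 1 - exp (- (1))) by (apply one_minus_exp_pos; lra).
  exists (mkposreal _ Hd). intros q Hq Hq1. apply ball_R in Hq. simpl in Hq. apply Rabs_lt_between in Hq.
  assert (Hq0 : exp (- (1)) < q) by lra.
  assert (Hqp : 0 < q) by (assert (H := exp_pos (- (1))); lra).
  set (t := - ln q).
  assert (Hqt : q = exp (- t)) by (unfold t; rewrite Ropp_involutive, exp_ln; auto).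
  assert (Ht : 0 < t <= 1).
  { unfold t. split.
    - assert (ln q < ln 1) by (apply ln_increasing; auto). rewrite ln_1 in *; lra.
    - assert (ln (exp (- (1))) < ln q) by (apply ln_increasing; auto using exp_pos). rewrite ln_exp in *; lra. }
  specialize (HC t Ht). cbn beta in HC.
  set (p := psum (fun i => zeta_at_neg zeta i * (-1) ^ i * bernoulli_coef B x (S (S i)) * t ^ S i) (pred N)) in *.
  set (e := lambert_sum x t - (zeta2 / t + bernoulli_coef B x 1%nat * ln t + I + p)) in *.
  exists (exp (- e) - 1).
  assert (Hlq : Rabs (ln q) = t) by (rewrite Hqt, ln_exp, Rabs_Ropp, Rabs_pos_eq; lra).
  assert (HtN : 0 <= t ^ N <= 1).
  { split; [apply pow_le; lra|]. rewrite <- (pow1 N). apply pow_incr; lra. }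
  assert (HC1 : Rabs e <= Rabs C * t ^ N).
  { eapply Rle_trans; [exact HC|]. apply Rmult_le_compat_r; [lra|apply Rle_abs]. }
  split.
  - rewrite Hlq. eapply Rle_trans; [apply exp_minus_1_bound|]. rewrite Rabs_Ropp.
    assert (Hc0 := Rabs_pos C).
    replace (Rabs C * exp (Rabs C) * t ^ N) with (Rabs C * t ^ N * exp (Rabs C)) by ring.
    apply Rmult_le_compat; [apply Rabs_pos|left; apply exp_pos|exact HC1|].
    apply exp_le_mono. eapply Rle_trans; [exact HC1|].
    rewrite <- (Rmult_1_r (Rabs C)) at 2. apply Rmult_le_compat_l; lra.
  - replace (ln (1 / q)) with t.
    2:{ unfold t, Rdiv. rewrite Rmult_1_l, ln_Rinv by auto. reflexivity. }
    rewrite Hqt at 1 2. rewrite qPochhammer_lambert by (auto; lra).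
    rewrite Hqt, (expansion_prod_psum zeta B Hzeta HB) by lra. fold p.
    rewrite <- HV. unfold Rpower.
    replace (1 + (exp (- e) - 1)) with (exp (- e)) by ring.
    rewrite <- !exp_plus. f_equal. unfold e. rewrite c1. ring.
Qed.
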